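(* With \[ \vartheta_4(a_0,a_1,a_2,a_3):=\frac{1}{4J_4}\Big[a_0\overline{J}_{4,8}\overline{J}_{6,16}+a_1q^2\overline{J}_{0,8}\overline{J}_{14,16}+a_2q\overline{J}_{4,8}\overline{J}_{14,16}+a_3q\overline{J}_{0,8}\overline{J}_{6,16}\Big] \] and \[ G_4(b_0,b_1):=b_0\big(-1+q^2g(-q^2;q^{16})\big)+b_1\,q^5g(-q^6;q^{16}), \] we have \begin{align*} D(0,4)&=\vartheta_4(-5,3,1,1)+2G_4(-1,0),\\ D(1,4)=D(3,4)&=\vartheta_4(3,-1,-3,1)+G_4(1,1),\\ D(2,4)&=\vartheta_4(-1,-1,5,-3)+2G_4(0,-1). \end{align*}
   Context: Throughout, $q$ is a complex number with $0<|q|<1$. Write $(x)_n=(x;q)_n=\prod_{i=0}^{n-1}(1-q^ix)$ and $(x)_\infty=(x;q)_\infty=\prod_{i\ge0}(1-q^ix)$. Let $j(x;q)=(x)_\infty(q/x)_\infty(q)_\infty=\sum_{n\in\mathbb Z}(-1)^nq^{\binom n2}x^n$. For integers $a$ and $m\ge1$: $J_{a,m}=j(q^a;q^m)$, $\overline{J}_{a,m}=j(-q^a;q^m)$, and $J_m=J_{m,3m}=\prod_{i\ge1}(1-q^{mi})$. The universal mock theta function is $g(x;q)=x^{-1}\big(-1+\sum_{n\ge0}\frac{q^{n^2}}{(x)_{n+1}(q/x)_n}\big)$. Ranks: define integers $N(m,n)$ ($m\in\mathbb Z$, $n\ge0$) by $\sum_{n\ge0}\sum_{m\in\mathbb Z}N(m,n)z^mq^n=\sum_{n\ge0}\frac{q^{n^2}}{(zq)_n(z^{-1}q)_n}$;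 for $n\ge1$, $N(m,n)$ is the number of partitions of $n$ with rank (largest part minus number of parts) equal to $m$, and $N(m,0)=\delta_{m,0}$. For $M\ge1$ and an integer $a$, $N(a,M;n)=\sum_{m\equiv a \pmod M}N(m,n)$. Let $p(n)$ be the number of partitions of $n$ ($p(0)=1$). The rank deviation is $D(a,M)=\sum_{n\ge0}\big(N(a,M;n)-p(n)/M\big)q^n$. *)

(* Defs.v *)
From Stdlib Require Import Reals ZArith List Arith ClassicalEpsilon.
Import ListNotations.
Open Scope R_scope.

Record CC := mkC { Re : R ; Im : R }.

Definition RtoC (x : R) : CC := mkC x 0.
Definition C0 : CC := RtoC 0.
Definition C1 : CC := RtoC 1.
Definition Cadd (z w : CC) : CC := mkC (Re z + Re w) (Im z + Im w).
Definition Copp (z : CC) : CC := mkC (- Re z) (- Im z).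
Definition Csub (z w : CC) : CC := Cadd z (Copp w).
Definition Cmul (z w : CC) : CC :=
  mkC (Re z * Re w - Im z * Im w) (Re z * Im w + Im z * Re w).
Definition Cinv (z : CC) : CC :=
  mkC (Re z / (Re z * Re z + Im z * Im z)) (- Im z / (Re z * Re z + Im z * Im z)).
Definition Cdiv (z w : CC) : CC := Cmul z (Cinv w).
Fixpoint Cpow (z : CC) (n : nat) : CC :=
  match n with O => C1 | S k => Cmul (Cpow z k) z end.
Definition Cnorm (z : CC) : R := sqrt (Re z * Re z + Im z * Im z).

Declare Scope C_scope.
Delimit Scope C_scope with Cs.
Infix "+" := Cadd : C_scope.
Infix "-" := Csub : C_scope.
Infix "*" := Cmul : C_scope.
Infix "/" := Cdiv : C_scope.
Notation "- z" := (Copp z) : C_scope.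
Infix "^" := Cpow : C_scope.

Definition Ccv (u : nat -> CC) (l : CC) : Prop :=
  forall eps : R, 0 < eps -> exists N : nat, forall n : nat, (N <= n)%nat ->
    Cnorm (Csub (u n) l) < eps.

(** The limit of u if it exists (it is then unique), and 0 otherwise. *)
Definition Clim (u : nat -> CC) : CC :=
  match excluded_middle_informative (exists l, Ccv u l) with
  | left H => proj1_sig (constructive_indefinite_description _ H)
  | right _ => C0
  end.

Fixpoint csum_part (f : nat -> CC) (n : nat) : CC :=
  match n with O => C0 | S k => Cadd (csum_part f k) (f k) end.
Fixpoint cprod_part (f : nat -> CC) (n : nat) : CC :=
  match n with O => C1 | S k => Cmul (cprod_part f k) (f k) end.

Definition Csum (f : nat -> CC) : CC := Clim (csum_part f).
Definition Cprod (f : nat -> CC) : CC := Clim (cprod_part f).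

Open Scope C_scope.

Definition qpoch (x q : CC) (n : nat) : CC := cprod_part (fun i => C1 - q ^ i * x) n.
Definition qpoch_inf (x q : CC) : CC := Cprod (fun i => C1 - q ^ i * x).
Definition jtheta (x q : CC) : CC := qpoch_inf x q * qpoch_inf (q / x) q * qpoch_inf q q.
Definition Jam (q : CC) (a m : nat) : CC := jtheta (q ^ a) (q ^ m).
Definition Jbar (q : CC) (a m : nat) : CC := jtheta (- (q ^ a)) (q ^ m).
Definition Jm (q : CC) (m : nat) : CC := Jam q m (3 * m).

Definition gmock (x q : CC) : CC :=
  Cinv x * (- C1 + Csum (fun n => q ^ (n * n) / (qpoch x q (S n) * qpoch (q / x) q n))).

Close Scope C_scope.

(** [plist fuel n k]: all partitions of n into parts <= k, each written as a
    non-increasing list of positive integers (fuel >= n suffices). *)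
Fixpoint plist (fuel n k : nat) : list (list nat) :=
  match fuel with
  | O => if Nat.eqb n 0 then [nil] else nil
  | S f =>
      match n with
      | O => [nil]
      | S _ => flat_map (fun j => map (cons j) (plist f (n - j) j)) (seq 1 (Nat.min k n))
      end
  end.

Definition partitions (n : nat) : list (list nat) := plist n n n.

Definition npart (n : nat) : nat := length (partitions n).

Definition rank (l : list nat) : Z := (Z.of_nat (hd O l) - Z.of_nat (length l))%Z.

Definition Nrank (m : Z) (n : nat) : nat :=
  length (filter (fun l => Z.eqb (rank l) m) (partitions n)).

Definition NrankMod (a M : Z) (n : nat) : nat :=
  length (filter (fun l => Z.eqb (Z.modulo (rank l) M) (Z.modulo a M)) (partitions n)).

Definition Drank (a M : Z) (q : CC) : CC :=
  Csum (fun n => Cmul (RtoC (INR (NrankMod a M n) - INR (npart n) / IZR M)) (Cpow q n)).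

Open Scope C_scope.
Definition theta4 (a0 a1 a2 a3 : R) (q : CC) : CC :=
  Cinv (RtoC 4 * Jm q 4) *
  ( RtoC a0 * Jbar q 4 8 * Jbar q 6 16
  + RtoC a1 * q ^ 2 * Jbar q 0 8 * Jbar q 14 16
  + RtoC a2 * q * Jbar q 4 8 * Jbar q 14 16
  + RtoC a3 * q * Jbar q 0 8 * Jbar q 6 16 ).

Definition G4 (b0 b1 : R) (q : CC) : CC :=
  RtoC b0 * (- C1 + q ^ 2 * gmock (- (q ^ 2)) (q ^ 16))
  + RtoC b1 * q ^ 5 * gmock (- (q ^ 6)) (q ^ 16).
Close Scope C_scope.

(* Main.v *)
(* Let R(z) = sum_n q^(n^2) / ((zq)_n (q/z)_n) be the rank generating function and
   A(z; q) = R(z) / (1 - z) = 1 + z g(z; q).  Filtering with fourth roots of unity,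
   D(a,4) = (i^(-a) R(i) + (-1)^a R(-1) + i^a R(-i)) / 4, where R(-1) = f(q) and
   R(i) = R(-i) = phi(q) are third order mock theta functions.

   Watson's identity (q)_oo A(z; q) = sum_k (-1)^k q^(k(3k+1)/2) / (1 - z q^k) follows
   from the Bailey lemma.  The partial fraction expansion in z of
   1 / (j(z; q) j(-q z^2; q^2)) has as residue series, at the poles z = q^(-k), the
   Watson sum of base q, and at the poles z^2 = -q^(-2t-1), according to the parity of
   t, the Watson sums of base q^4 at -q z^2 and -q / z^2.  Hence
     A(z; q) = (q)_oo^2 j(-q; q^2) / (j(z; q) j(-q z^2; q^2))
               + (A(-q z^2; q^4) - 1) / z - (A(-q / z^2; q^4) - 1).
   At z = -1 and z = i this expresses f(q) and phi(q) through A(-q; q^4) and A(q; q^4);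
   a second application, in base q^4 at z = -q, leads to base q^16.  The theta terms
   are simplified with product identities and the 2-dissection
   j(x; q) = j(-q x^2; q^4) - x j(-q^3 x^2; q^4) of the triple product. *)

From HB Require Import structures.
From mathcomp Require Import all_boot all_order all_algebra.
From mathcomp Require Import boolp zify.
From Stdlib Require Import Reals Lra.
Require Import Defs.
Ltac Rring := ring.
Ltac Rfield := field.
From mathcomp Require Import ring.
Set Implicit Arguments.
Unset Strict Implicit.
Unset Printing Implicit Defensive.
Import GRing.Theory.
Delimit Scope ring_scope with ring.
Delimit Scope R_scope with R.
Delimit Scope nat_scope with N.
Local Open Scope ring_scope.
Arguments Cnorm z%_ring_scope.

(** * The field of complex numbers and its limits *)

(** No complex analysis is used. Partial fractions, the Bailey lemma and the triple product are
    first proved as identities between finite products over a field in which q is not a root of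
    unity, and then passed to the limit by dominated convergence ([tannery]). Since [Csum] and
    [Cprod] are limits with default value 0, convergence has to be established each time, which is
    why most statements assert [Ccv] or [Bcv].

    The base is written q = s^2 so that exponents such as k(3k + 1)/2 need no halving. With o^2 =
    -q, the factor j(-q z^2; q^2) splits into two products of base q at o z and -o z. The poles then
    form three geometric progressions with the same ratio, and all residues have one shape. The
    residue constants of the families of o and -o are opposite, so only the difference of their two
    sums has to be computed, and it is this difference that has denominators in z^2.

    The root of unity z = 1, where A has a pole, never occurs: its share of the filter is p(n)/4,
    exactly what the rank deviation subtracts. The other three roots have norm 1, which makes z^rank
    bounded and lets partition counts dominate all series in play. *)

Lemma CC_eq (x y : CC) : Re x = Re y -> Im x = Im y -> x = y.
Proof. by case: x y => [a b] [c d] /= -> ->. Qed.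

Lemma CaddA : associative Cadd.
Proof. by move=> x y z; apply: CC_eq => /=; Rring. Qed.
Lemma CaddC : commutative Cadd.
Proof. by move=> x y; apply: CC_eq => /=; Rring. Qed.
Lemma Cadd0 : left_id C0 Cadd.
Proof. by move=> x; apply: CC_eq => /=; Rring. Qed.
Lemma CaddN : left_inverse C0 Copp Cadd.
Proof. by move=> x; apply: CC_eq => /=; Rring. Qed.
Lemma CmulA : associative Cmul.
Proof. by move=> x y z; apply: CC_eq => /=; Rring. Qed.
Lemma CmulC : commutative Cmul.
Proof. by move=> x y; apply: CC_eq => /=; Rring. Qed.
Lemma Cmul1 : left_id C1 Cmul.
Proof. by move=> x; apply: CC_eq => /=; Rring. Qed.
Lemma CmulD : left_distributive Cmul Cadd.
Proof. by move=> x y z; apply: CC_eq => /=; Rring. Qed.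
Lemma C1_neq0 : C1 <> C0.
Proof. by move=> [] /R1_neq_R0. Qed.

HB.instance Definition _ := gen_eqMixin CC.
HB.instance Definition _ := gen_choiceMixin CC.
HB.instance Definition _ := GRing.isZmodule.Build CC CaddA CaddC Cadd0 CaddN.
HB.instance Definition _ := GRing.Zmodule_isComNzRing.Build CC
  CmulA CmulC Cmul1 CmulD (introN eqP C1_neq0).

Lemma CC_neq0 (x : CC) : x <> C0 -> (Re x * Re x + Im x * Im x <> 0)%R.
Proof.
by case: x => [a b] x0 /= ab0; apply: x0; apply: CC_eq => /=; nra.
Qed.

Lemma CmulV (x : CC) : x != 0%ring -> Cmul (Cinv x) x = C1.
Proof.
move=> /eqP /CC_neq0; case: x => [a b] /= n0.
by apply: CC_eq => /=; Rfield.
Qed.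

Lemma Cinv0 : Cinv C0 = C0.
Proof. by apply: CC_eq => /=; rewrite ?Ropp_0 /Rdiv Rmult_0_l. Qed.

HB.instance Definition _ := GRing.ComNzRing_isField.Build CC CmulV Cinv0.

(* Convertible terms of type [CC] may mention different canonical instances;
   [lra] compares atoms syntactically, so they are identified beforehand. *)
Ltac abstract_norm x :=
  let n := fresh "n" in
  pose (n := Cnorm x);
  repeat match goal with
  | |- context [Cnorm ?y] =>
      let _ := constr:(erefl x : x = y) in change (Cnorm y) with n
  | H : context [Cnorm ?y] |- _ =>
      let _ := constr:(erefl x : x = y) in change (Cnorm y) with n in H
  end; clearbody n.
Ltac abstract_norms :=
  repeat match goal with
  | |- context [Cnorm ?x] => abstract_norm x
  | H : context [Cnorm ?x] |- _ => abstract_norm x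
  end.
Ltac nlra := abstract_norms; lra.
Ltac nnra := abstract_norms; nra.

Lemma Cnorm_ge0 (x : CC) : (0 <= Cnorm x)%R.
Proof. exact: sqrt_pos. Qed.

Lemma Cnorm_sqr (x : CC) : (Cnorm x * Cnorm x = Re x * Re x + Im x * Im x)%R.
Proof. by rewrite /Cnorm sqrt_sqrt //; nnra. Qed.

Lemma Cnorm_mul (x y : CC) : Cnorm (x * y) = (Cnorm x * Cnorm y)%R.
Proof.
rewrite /Cnorm -sqrt_mult; [|nnra|nnra]; congr sqrt.
by case: x y => [a b] [c d] /=; Rring.
Qed.

Lemma Cnorm_eq0 (x : CC) : Cnorm x = 0%R -> x = 0.
Proof.
move=> h; have := Cnorm_sqr x; rewrite h.
by case: x {h} => a b /= h; apply: CC_eq => /=; nnra.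
Qed.

Lemma Cnorm0 : Cnorm 0 = 0%R.
Proof. by rewrite /Cnorm /= Rmult_0_l Rplus_0_l sqrt_0. Qed.

Lemma Cnorm1 : Cnorm 1 = 1%R.
Proof. by rewrite /Cnorm /= Rmult_0_l Rplus_0_r Rmult_1_r sqrt_1. Qed.

Lemma Cnorm_gt0 (x : CC) : x != 0 -> (0 < Cnorm x)%R.
Proof.
move=> x0; case: (Cnorm_ge0 x) => // /esym /Cnorm_eq0 e.
by rewrite e eqxx in x0.
Qed.

Lemma Cnorm_opp (x : CC) : Cnorm (- x) = Cnorm x.
Proof. by rewrite /Cnorm /=; congr sqrt; Rring. Qed.

Lemma Cnorm_triangle (x y : CC) : (Cnorm (x + y) <= Cnorm x + Cnorm y)%R.
Proof.
have h := sqrt_cauchy (Re x) (Im x) (Re y) (Im y).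
rewrite /Rsqr -/(Cnorm x) -/(Cnorm y) in h.
apply: Rsqr_incr_0_var; last first.
  by have := Cnorm_ge0 x; have := Cnorm_ge0 y; nlra.
rewrite /Rsqr Cnorm_sqr /=; have := Cnorm_sqr x; have := Cnorm_sqr y; nnra.
Qed.

Lemma Cnorm_sub (x y : CC) : (Cnorm x - Cnorm y <= Cnorm (x - y))%R.
Proof.
have := Cnorm_triangle (x - y) y; rewrite subrK; nlra.
Qed.

Lemma Cnorm_subC (x y : CC) : Cnorm (x - y) = Cnorm (y - x).
Proof. by rewrite -Cnorm_opp opprB. Qed.

Lemma Cnorm_inv (x : CC) : x != 0 -> Cnorm x^-1 = (/ Cnorm x)%R.
Proof.
move=> x0; have h := Cnorm_gt0 x0.
have : (Cnorm (x^-1 * x) = 1)%R by rewrite mulVf // Cnorm1.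
rewrite Cnorm_mul => e; apply: (Rmult_eq_reg_r (Cnorm x)); last nlra.
by rewrite e Rinv_l //; nlra.
Qed.

Lemma Cnorm_pow (x : CC) n : Cnorm (x ^+ n) = (Cnorm x ^ n)%R.
Proof. by elim: n => [|n IH]; rewrite ?Cnorm1 // exprS Cnorm_mul IH. Qed.

Lemma Re_le_Cnorm (x : CC) : (Rabs (Re x) <= Cnorm x)%R.
Proof.
rewrite -sqrt_Rsqr_abs; apply: sqrt_le_1; rewrite /Rsqr; nnra.
Qed.

Lemma Im_le_Cnorm (x : CC) : (Rabs (Im x) <= Cnorm x)%R.
Proof.
rewrite -sqrt_Rsqr_abs; apply: sqrt_le_1; rewrite /Rsqr; nnra.
Qed.

Lemma Cnorm_le_ReIm (x : CC) : (Cnorm x <= Rabs (Re x) + Rabs (Im x))%R.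
Proof.
apply: Rsqr_incr_0_var.
  rewrite /Rsqr Cnorm_sqr; have := Rsqr_abs (Re x); have := Rsqr_abs (Im x).
  rewrite /Rsqr; have := Rabs_pos (Re x); have := Rabs_pos (Im x); nnra.
have := Rabs_pos (Re x); have := Rabs_pos (Im x); nlra.
Qed.

Lemma CcvP (u : nat -> CC) (l : CC) : Ccv u l <->
  (forall eps, (0 < eps)%R -> exists N : nat, forall n : nat, (N <= n)%N -> (Cnorm (u n - l) < eps)%R).
Proof.
by split=> h e /h [N hN]; exists N => n /leP /hN.
Qed.

Lemma Ccv_unique u l l' : Ccv u l -> Ccv u l' -> l = l'.
Proof.
move=> /CcvP h /CcvP h'; apply/eqP; rewrite -subr_eq0; apply/negPn/negP => /Cnorm_gt0 d.
have [N hN] := h (Cnorm (l - l') / 2)%R ltac:(nlra).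
have [N' hN'] := h' (Cnorm (l - l') / 2)%R ltac:(nlra).
have := hN (maxn N N') (leq_maxl _ _); have := hN' (maxn N N') (leq_maxr _ _).
have := Cnorm_triangle (l - u (maxn N N')) (u (maxn N N') - l').
rewrite addrA subrK (Cnorm_subC l (u _)); nlra.
Qed.

Lemma Clim_eq u l : Ccv u l -> Clim u = l.
Proof.
rewrite /Clim; case: ClassicalEpsilon.excluded_middle_informative => [H|H] h.
  by case: ClassicalEpsilon.constructive_indefinite_description => l' /= /Ccv_unique; apply.
by case: H; exists l.
Qed.

Lemma Ccv_eventually u v l K : (forall n, (K <= n)%N -> u n = v n) -> Ccv u l -> Ccv v l.
Proof.
move=> e /CcvP h; apply/CcvP => eps /h [N hN]; exists (maxn K N) => n.
by rewrite geq_max => /andP[/e <- /hN].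
Qed.

Lemma Ccv_ext u v l : u =1 v -> Ccv u l -> Ccv v l.
Proof. by move=> e; apply: (@Ccv_eventually _ _ _ 0%N) => n _. Qed.

Lemma Ccv_comp u l (phi : nat -> nat) :
  (forall K : nat, exists N : nat, forall n : nat, (N <= n)%N -> (K <= phi n)%N) ->
  Ccv u l -> Ccv (u \o phi) l.
Proof.
move=> hphi /CcvP h; apply/CcvP => eps /h [K hK]; have [N hN] := hphi K.
by exists N => n /hN /hK.
Qed.

Lemma Ccv_const c : Ccv (fun _ => c) c.
Proof. by apply/CcvP => e e0; exists 0%N => n _; rewrite subrr Cnorm0. Qed.

Lemma Ccv_add u v l l' : Ccv u l -> Ccv v l' -> Ccv (fun n => u n + v n) (l + l').
Proof.
move=> /CcvP h /CcvP h'; apply/CcvP => e e0.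
have [N hN] := h (e / 2)%R ltac:(nlra); have [N' hN'] := h' (e / 2)%R ltac:(nlra).
exists (maxn N N') => n; rewrite geq_max => /andP[/hN a /hN' b].
have -> : u n + v n - (l + l') = (u n - l) + (v n - l') by ring.
have := Cnorm_triangle (u n - l) (v n - l'); nlra.
Qed.

Lemma Ccv_bounded u l : Ccv u l -> exists2 B, (0 < B)%R & forall n, (Cnorm (u n) <= B)%R.
Proof.
move=> /CcvP h; have [N hN] := h 1%R ltac:(nlra).
have [B B0 hB] : exists2 B, (0 < B)%R & forall n, (n < N)%N -> (Cnorm (u n) <= B)%R.
  elim: {hN} N => [|N [B B0 IH]]; first by exists 1%R => //; nlra.
  have := Cnorm_ge0 (u N) => h0.
  exists (B + Cnorm (u N))%R; first nlra.
  move=> n; rewrite ltnS leq_eqVlt => /orP[/eqP ->|/IH]; nlra.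
have h0 := Cnorm_ge0 l.
exists (B + Cnorm l + 1)%R; first nlra.
move=> n; case: (ltnP n N) => [/hB|/hN]; first nlra.
have := Cnorm_sub (u n) l; nlra.
Qed.

Lemma Ccv_mul u v l l' : Ccv u l -> Ccv v l' -> Ccv (fun n => u n * v n) (l * l').
Proof.
move=> hu hv; have [B B0 hB] := Ccv_bounded hu.
have h0 := Cnorm_ge0 l'.
move/CcvP: hu => h; move/CcvP: hv => h'; apply/CcvP => e e0.
have d1 : (0 < e / (2 * B))%R by apply: Rdiv_lt_0_compat; nlra.
have d2 : (0 < e / (2 * (Cnorm l' + 1)))%R by apply: Rdiv_lt_0_compat; nlra.
have [N hN] := h _ d2; have [N' hN'] := h' _ d1.
exists (maxn N N') => n; rewrite geq_max => /andP[/hN a /hN' b].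
have -> : u n * v n - l * l' = u n * (v n - l') + (u n - l) * l' by ring.
apply: (Rle_lt_trans _ _ _ (Cnorm_triangle _ _)); rewrite !Cnorm_mul.
have p1 : (Cnorm (u n) * Cnorm (v n - l')%ring < B * (e / (2 * B)) )%R.
  have q1 := Cnorm_ge0 (v n - l'); have := hB n; have := Cnorm_ge0 (u n); nnra.
have p2 : (Cnorm (u n - l)%ring * Cnorm l' <= (Cnorm l' + 1) * (e / (2 * (Cnorm l' + 1))) )%R.
  have q1 := Cnorm_ge0 (u n - l); nnra.
have e1 : (B * (e / (2 * B)) = e / 2)%R by Rfield; nlra.
have e2 : ((Cnorm l' + 1) * (e / (2 * (Cnorm l' + 1))) = e / 2)%R by Rfield; nlra.
nlra.
Qed.

Lemma Ccv_opp u l : Ccv u l -> Ccv (fun n => - u n) (- l).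
Proof.
move=> h; rewrite -mulN1r; apply: Ccv_ext (Ccv_mul (Ccv_const (- 1)) h) => n.
by rewrite mulN1r.
Qed.

Lemma Ccv_sub u v l l' : Ccv u l -> Ccv v l' -> Ccv (fun n => u n - v n) (l - l').
Proof. by move=> h /Ccv_opp; apply: Ccv_add. Qed.

Lemma Ccv_sum K (u : nat -> nat -> CC) l : (forall k, (k < K)%N -> Ccv (fun n => u n k) (l k)) ->
  Ccv (fun n => \sum_(k < K) u n k) (\sum_(k < K) l k).
Proof.
elim: K => [|K IH] h.
  rewrite big_ord0; apply: Ccv_ext (Ccv_const 0) => n; by rewrite big_ord0.
rewrite big_ord_recr /=; apply: Ccv_ext (Ccv_add (IH _) (h K _)) => // [n|k hk].
  by rewrite big_ord_recr.
by apply: h; rewrite ltnW.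
Qed.

Lemma Ccv_inv u l : l != 0 -> Ccv u l -> Ccv (fun n => (u n)^-1) l^-1.
Proof.
move=> l0; have L0 := Cnorm_gt0 l0; move/CcvP => h; apply/CcvP => e e0.
have [N hN] := h (Cnorm l / 2)%R ltac:(nlra).
have d1 : (0 < e * (Cnorm l * Cnorm l / 2))%R by apply: Rmult_lt_0_compat; nnra.
have [N' hN'] := h _ d1.
exists (maxn N N') => n; rewrite geq_max => /andP[/hN a /hN' b].
have hu : (Cnorm l / 2 <= Cnorm (u n))%R.
  by have := Cnorm_sub l (u n); rewrite Cnorm_subC; nlra.
have u0 : u n != 0 by apply/eqP => E; rewrite E Cnorm0 in hu; nlra.
have U0 := Cnorm_gt0 u0.
have -> : (u n)^-1 - l^-1 = (l - u n) / (u n * l) by field; rewrite u0 l0.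
rewrite Cnorm_mul Cnorm_inv ?mulf_neq0 // Cnorm_mul Cnorm_subC.
apply: (Rmult_lt_reg_r (Cnorm (u n) * Cnorm l)); first nnra.
rewrite Rmult_assoc Rinv_l; last nnra.
rewrite Rmult_1_r; apply: (Rlt_le_trans _ _ _ b).
apply: Rmult_le_compat_l; nnra.
Qed.

Lemma Ccv_norm_le u l B : (forall n, (Cnorm (u n) <= B)%R) -> Ccv u l -> (Cnorm l <= B)%R.
Proof.
move=> hB /CcvP h; apply: Rnot_lt_le => lt.
have [N hN] := h (Cnorm l - B)%R ltac:(nlra).
have := hN N (leqnn _); have := hB N; have := Cnorm_sub l (u N); rewrite Cnorm_subC; nlra.
Qed.

(** * Geometric majorants and dominated convergence *)

Lemma pow_ge0 r n : (0 <= r -> 0 <= r ^ n)%R.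
Proof. by move=> h; apply: pow_le. Qed.

Lemma geom_tail_bound (f : nat -> CC) C r m n : (0 <= C)%R -> (0 <= r < 1)%R ->
  (forall i, (Cnorm (f i) <= C * r ^ i)%R) ->
  (Cnorm (\sum_(m <= i < n) f i)%ring <= C * r ^ m / (1 - r))%R.
Proof.
move=> C0 r01 hf.
case: (leqP n m) => [nm|/ltnW mn].
  rewrite big_geq // Cnorm0; apply: Rmult_le_pos; last by left; apply: Rinv_0_lt_compat; nlra.
  by apply: Rmult_le_pos => //; apply: pow_ge0; nlra.
have : (Cnorm (\sum_(m <= i < n) f i)%ring <= C * (r ^ m - r ^ n) / (1 - r))%R.
  rewrite -(subnKC mn); elim: (n - m)%N => [|k IH].
    by rewrite addn0 big_geq // Cnorm0 Rminus_diag /Rdiv; nlra.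
  rewrite addnS big_nat_recr ?leq_addr //=.
  apply: (Rle_trans _ _ _ (Cnorm_triangle _ _)).
  have := hf (m + k)%N.
  have -> : (C * (r ^ m - r * r ^ (m + k)) / (1 - r) =
    C * (r ^ m - r ^ (m + k)) / (1 - r) + C * r ^ (m + k))%R by Rfield; nlra.
  nlra.
move=> h; apply: (Rle_trans _ _ _ h); apply: Rmult_le_compat_r.
  by left; apply: Rinv_0_lt_compat; nlra.
by apply: Rmult_le_compat_l => //; have := @pow_ge0 r n; nlra.
Qed.

Lemma geom_small C r eps : (0 <= r < 1)%R -> (0 < eps)%R ->
  exists K : nat, forall n : nat, (K <= n)%N -> (C * r ^ n < eps)%R.
Proof.
move=> r01 e0.
have hr : (Rabs r < 1)%R by rewrite Rabs_pos_eq; nlra.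
have [K hK] := pow_lt_1_zero r hr (eps / (Rabs C + 1))%R
   ltac:(apply: Rdiv_lt_0_compat; have := Rabs_pos C; nlra).
exists K => n /leP /hK; have p0 : (0 <= r ^ n)%R by apply: pow_ge0; nlra.
rewrite Rabs_pos_eq // => h.
have hc : (C <= Rabs C)%R by exact: Rle_abs.
have h2 : (r ^ n * (Rabs C + 1) < eps)%R.
  have := Rabs_pos C => c0.
  apply: (Rmult_lt_reg_r (/ (Rabs C + 1))); first by apply: Rinv_0_lt_compat; nlra.
  by rewrite Rmult_assoc Rinv_r ?Rmult_1_r //; nlra.
nnra.
Qed.

Lemma Ccv_cauchy u : (forall eps, (0 < eps)%R -> exists N : nat, forall m n : nat, (N <= m)%N -> (m <= n)%N ->
   (Cnorm (u n - u m) < eps)%R) -> exists l, Ccv u l.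
Proof.
move=> h.
have Hc (p : CC -> R) : (forall x y : CC, (Rabs (p x - p y) <= Cnorm (x - y)%ring)%R) ->
    exists l, Un_cv (fun n => p (u n)) l.
  move=> hp; have [l hl] : {l | Un_cv (fun n => p (u n)) l}.
    apply: R_complete => e e0; have [N hN] := h e e0; exists N => n m /leP hn /leP hm.
    apply: (Rle_lt_trans _ _ _ (hp _ _)).
    case: (leqP n m) => [nm|/ltnW mn]; last exact: hN.
    by rewrite Cnorm_subC; apply: hN.
  by exists l.
have [a ha] := Hc Re ltac:(move=> x y; exact: (Re_le_Cnorm (x - y))).
have [b hb] := Hc Im ltac:(move=> x y; exact: (Im_le_Cnorm (x - y))).
exists (mkC a b); apply/CcvP => e e0.
have [N hN] := ha (e / 2)%R ltac:(nlra); have [N' hN'] := hb (e / 2)%R ltac:(nlra).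
exists (maxn N N') => n; rewrite geq_max => /andP[/leP /hN h1 /leP /hN' h2].
apply: (Rle_lt_trans _ _ _ (Cnorm_le_ReIm _)); move: h1 h2; rewrite /R_dist /Rminus /=; nlra.
Qed.

Lemma Ccv_series (f : nat -> CC) C r : (0 <= C)%R -> (0 <= r < 1)%R ->
  (forall i, (Cnorm (f i) <= C * r ^ i)%R) ->
  exists l, Ccv (fun n => \sum_(i < n) f i) l.
Proof.
move=> C0 r01 hf; apply: Ccv_cauchy => e e0.
have [K hK] := geom_small (C / (1 - r)) r01 e0.
exists K => m n Km mn; rewrite -!(big_mkord predT f) (big_cat_nat (n := m)) //= addrAC subrr add0r.
apply: (Rle_lt_trans _ _ _ (geom_tail_bound m n C0 r01 hf)).
have := hK m Km; suff -> : (C * r ^ m / (1 - r) = C / (1 - r) * r ^ m)%R by [].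
by Rfield; nlra.
Qed.

(** Dominated convergence when both the terms and the length of the sum vary. The limits g inherit
    the bound, so both tails beyond K are at most C r^K / (1 - r), while the first K terms converge
    one by one. The common limit is existential; it is identified afterwards by uniqueness of
    limits. *)
Lemma tannery (f : nat -> nat -> CC) (g : nat -> CC) C r : (0 <= C)%R -> (0 <= r < 1)%R ->
  (forall n k, (k < n)%N -> (Cnorm (f n k) <= C * r ^ k)%R) ->
  (forall k, Ccv (fun n => f n k) (g k)) ->
  exists2 L, Ccv (fun n => \sum_(k < n) g k) L & Ccv (fun n => \sum_(k < n) f n k) L.
Proof.
move=> C0 r01 hf hg.
have gb k : (Cnorm (g k) <= C * r ^ k)%R.
  apply: (@Ccv_norm_le (fun n => f (n + k.+1)%N k)).
    by move=> n; apply: hf; rewrite addnS ltnS leq_addl.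
  apply: (@Ccv_comp (fun n => f n k) _ (fun n => n + k.+1)%N) (hg k).
  by move=> K; exists K => n; lia.
have [L hL] := Ccv_series C0 r01 gb; exists L => //.
apply/CcvP => e e0.
have [K hK] := geom_small (C / (1 - r)) r01 (ltac:(nlra) : (0 < e / 3)%R).
have eq_tail m : (C * r ^ m / (1 - r) = C / (1 - r) * r ^ m)%R by Rfield; nlra.
have hh := @Ccv_sum K (fun n k => f n k) g (fun k _ => hg k).
have /CcvP/(_ (e / 3)%R ltac:(nlra)) [N1 hN1] := hh.
exists (maxn K N1) => n; rewrite geq_max => /andP[Kn /hN1 a1].
(* The domination is known only for k < n, whereas [geom_tail_bound] wants it at every index;
   extension by zero bridges the two. *)
pose f' k := if (k < n)%N then f n k else 0.
have f'b k : (Cnorm (f' k) <= C * r ^ k)%R.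
  rewrite /f'; case: ltnP => h; first exact: hf.
  by rewrite Cnorm0; apply: Rmult_le_pos => //; apply: pow_ge0; nlra.
have e1 : \sum_(k < n) f n k = \sum_(k < K) f n k + \sum_(K <= k < n) f' k.
  rewrite -(big_mkord predT (f n)) (big_cat_nat (n := K)) //= big_mkord; congr (_ + _).
  by apply: eq_big_nat => i /andP[_ hi]; rewrite /f' hi.
have tail1 := geom_tail_bound K n C0 r01 f'b.
have tail2 : (Cnorm (L - \sum_(k < K) g k) <= C * r ^ K / (1 - r))%R.
  apply: (@Ccv_norm_le (fun m => \sum_(k < m + K) g k - \sum_(k < K) g k)).
    move=> m; rewrite -!(big_mkord predT g) (big_cat_nat (n := K)) ?leq_addl //=.
    by rewrite addrAC subrr add0r; apply: geom_tail_bound.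
  apply: Ccv_sub (Ccv_const _).
  by apply: (@Ccv_comp (fun m => \sum_(k < m) g k) _ (fun m => m + K)%N) hL => J; exists J => m; lia.
have hKK := hK K (leqnn K); rewrite eq_tail in tail1 tail2.
have -> : \sum_(k < n) f n k - L = (\sum_(k < K) f n k - \sum_(k < K) g k) +
   (\sum_(K <= k < n) f' k - (L - \sum_(k < K) g k)) by rewrite e1; ring.
have h1 := Cnorm_triangle (\sum_(k < K) f n k - \sum_(k < K) g k)
  (\sum_(K <= k < n) f' k - (L - \sum_(k < K) g k)).
have h2 := Cnorm_triangle (\sum_(K <= k < n) f' k) (- (L - \sum_(k < K) g k)).
rewrite Cnorm_opp in h2; nlra.
Qed.

(** * Finite q-series identities *)

Definition poch (F : fieldType) (x q : F) n := \prod_(i < n) (1 - q ^+ i * x).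

Lemma poch0 (F : fieldType) (x q : F) : poch x q 0 = 1.
Proof. by rewrite /poch big_ord0. Qed.

Lemma pochS (F : fieldType) (x q : F) n :
  poch x q n.+1 = poch x q n * (1 - q ^+ n * x).
Proof. by rewrite /poch big_ord_recr. Qed.

Lemma pochSl (F : fieldType) (x q : F) n :
  poch x q n.+1 = (1 - x) * poch (q * x) q n.
Proof.
rewrite /poch big_ord_recl /= expr0 mul1r; congr (_ * _).
by apply: eq_bigr => i _; rewrite /bump /= add1n exprSr -mulrA.
Qed.

Lemma poch_neq0 (F : fieldType) (x q : F) n :
  (forall i, 1 - q ^+ i * x != 0) -> poch x q n != 0.
Proof. by move=> h; apply/prodf_neq0 => i _. Qed.

(* [q] is not a root of unity: [q ^+ n * q = q ^+ n.+1]. *)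
Definition no_root1 (F : fieldType) (q : F) := forall n, 1 - q ^+ n * q != 0.

Lemma pochq_neq0 (F : fieldType) (q : F) n : no_root1 q -> poch q q n != 0.
Proof. exact: poch_neq0. Qed.

(* Multiply by [1 - q^L = (1 - q^(L-m)) + q^(L-m) (1 - q^m)] and induct on [L]. *)
Lemma durfee_rectangle (F : fieldType) (q : F) (L r : nat) : no_root1 q ->
  \sum_(m < L.+1) q ^+ (m * m + r * m) /
     (poch q q (L - m) * poch q q m * poch q q (m + r))
  = (poch q q L * poch q q (L + r))^-1.
Proof.
move=> hq; elim: L r => [|L IH] r.
  by rewrite big_ord1 /= !add0n !poch0 !mul1r muln0 expr0 mul1r.
have nz n : poch q q n != 0 by exact: pochq_neq0.
apply: (mulfI (hq L)).
transitivity (\sum_(m < L.+1) q ^+ (m * m + r * m) /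
     (poch q q (L - m) * poch q q m * poch q q (m + r)) +
   q ^+ (L.+1 + r) * \sum_(m < L.+1) q ^+ (m * m + r.+1 * m) /
     (poch q q (L - m) * poch q q m * poch q q (m + r.+1))).
  rewrite mulr_sumr.
  under eq_bigr => i _.
    have -> : (1 - q ^+ L * q) * (q ^+ (i * i + r * i) / (poch q q (L.+1 - i) *
       poch q q i * poch q q (i + r))) =
      (1 - q ^+ (L.+1 - i)) * (q ^+ (i * i + r * i) / (poch q q (L.+1 - i) *
       poch q q i * poch q q (i + r))) +
      (q ^+ (L.+1 - i) * (1 - q ^+ i)) * (q ^+ (i * i + r * i) /
       (poch q q (L.+1 - i) * poch q q i * poch q q (i + r))).
      rewrite -mulrDl; congr (_ * _); rewrite -exprSr.
      have -> : q ^+ L.+1 = q ^+ (L.+1 - i) * q ^+ i.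
        by rewrite -exprD subnK //; case: i => i /=; lia.
      ring.
    over.
  rewrite big_split /=; congr (_ + _).
    rewrite big_ord_recr /= subnn expr0 subrr mul0r addr0.
    apply: eq_bigr => i _.
    have -> : (L.+1 - i = (L - i).+1)%N by case: i => i /=; lia.
    rewrite pochS -exprSr; move: (nz (L - i)%N) (nz i) (nz (i + r)%N) (hq (L-i)%N).
    by rewrite -exprSr => *; field; do ?(apply/andP; split => //).
  rewrite big_ord_recl [nat_of_ord ord0]/= expr0 subrr mulr0 mul0r add0r mulr_sumr.
  apply: eq_bigr => i _; rewrite !lift0.
  have -> : (L.+1 - i.+1 = L - i)%N by [].
  rewrite (pochS q q i) (addSnnS i r).
  have -> : q ^+ (L.+1 + r) * (q ^+ (i * i + r.+1 * i) /
     (poch q q (L - i) * poch q q i * poch q q (i + r.+1))) =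
     (q ^+ (L - i) * q ^+ (i.+1 * i.+1 + r * i.+1)) /
     (poch q q (L - i) * poch q q i * poch q q (i + r.+1)).
    rewrite mulrA -!exprD; congr (q ^+ _ / _); case: i => i /= hi.
    have : (L - i + i = L)%N by lia.
    by nia.
  move: (nz (L - i)%N) (nz i) (nz (i + r.+1)%N) (hq i); rewrite exprSr => *.
  field; do ?(apply/andP; split => //).
rewrite !IH !addnS !addSn !pochS.
have := nz L; have := nz (L + r)%N; have := hq L; have := hq (L + r)%N.
rewrite -!exprSr => h1 h2 h3 h4.
by field; rewrite h1 h2 h3 h4.
Qed.

(* The Bailey lemma with parameters sent to infinity: the inner sums are Durfee
   rectangles. *)
Lemma bailey (F : fieldType) (q : F) (alpha : nat -> F) N : no_root1 q ->
  \sum_(n < N.+1) q ^+ (n * n) / poch q q (N - n) *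
     (\sum_(j < n.+1) alpha j / (poch q q (n - j) * poch q q (n + j)))
  = \sum_(j < N.+1) q ^+ (j * j) * alpha j / (poch q q (N - j) * poch q q (N + j)).
Proof.
move=> hq.
under eq_bigr => n _.
  rewrite mulr_sumr.
  rewrite (big_ord_widen N.+1 (fun j => q ^+ (n * n) / poch q q (N - n) *
    (alpha j / (poch q q (n - j) * poch q q (n + j))))); last by case: n.
  over.
rewrite (exchange_big_dep predT) //=; apply: eq_bigr => j _.
have hj : (j <= N)%N by case: j.
transitivity (q ^+ (j * j) * alpha j *
  \sum_(m < (N - j).+1) q ^+ (m * m + (2 * j) * m) /
     (poch q q (N - j - m) * poch q q m * poch q q (m + 2 * j))); last first.
  by rewrite durfee_rectangle // -!mulrA; congr (_ * (_ / (_ * poch q q _))); lia.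
rewrite mulr_sumr.
rewrite -(big_mkord (fun n => (j < n.+1)%N) (fun n => q ^+ (n * n) / poch q q (N - n) *
    (alpha j / (poch q q (n - j) * poch q q (n + j))))).
rewrite (big_cat_nat (n := j)) //=; last by lia.
rewrite big_nat_cond big_pred0 ?add0r; last first.
  by move=> i; apply/negbTE; rewrite negb_and; lia.
rewrite big_nat_cond (eq_bigl (fun n => (j <= n < N.+1)%N)); last by move=> i; lia.
rewrite -big_nat -{1}[nat_of_ord j]add0n big_addn big_mkord.
have -> : (N.+1 - j = (N - j).+1)%N by lia.
apply: eq_bigr => -[m /= hm] _.
have -> : (N - (m + j) = N - j - m)%N by lia.
rewrite addnK.
have -> : (m + j + j = m + 2 * j)%N by lia.
have -> : ((m + j) * (m + j) = j * j + (m * m + 2 * j * m))%N by lia.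
by rewrite exprD !invfM !mulrA; ring.
Qed.

(* [alpha j] collects the terms of indices [j] and [-j] of a bilateral sequence;
   the two Bailey pairs below have beta [(n == 0)] and [1 / ((z)_(n+1) (q/z)_n)]. *)
Definition unit_alpha (F : fieldType) (q : F) j : F :=
  if j is i.+1 then (- 1) ^+ j * q ^+ 'C(j, 2) * (1 + q ^+ j) else 1.

Definition rank_alpha (F : fieldType) (z q : F) j : F :=
  if j is i.+1 then
    (- 1) ^+ j * q ^+ 'C(j, 2) * (q ^+ j / (1 - q ^+ j * z) + q ^+ j / (q ^+ j - z))
  else (1 - z)^-1.

(** The partial sums up to J have the closed form [part]. At J equal to the predecessor of the last
    index it is the opposite of the last term, because 1 - q^(2m) = (1 - q^m)(1 + q^m). *)
Lemma unit_beta (F : fieldType) (q : F) n : no_root1 q ->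
  \sum_(j < n.+1) unit_alpha q j / (poch q q (n - j) * poch q q (n + j)) = (n == 0%N)%:R.
Proof.
move=> hq; case: n => [|n]; first by rewrite big_ord1 /= poch0 !mul1r invr1.
have nz m : poch q q m != 0 by exact: pochq_neq0.
have hn : 1 - q ^+ n.+1 != 0 by rewrite exprSr.
have part J : (J <= n)%N ->
  \sum_(j < J.+1) unit_alpha q j / (poch q q (n.+1 - j) * poch q q (n.+1 + j)) =
  (- 1) ^+ J * q ^+ 'C(J.+1, 2) / ((1 - q ^+ n.+1) * poch q q (n - J) * poch q q (n.+1 + J)).
  elim: J => [|J IH] hJ.
    rewrite big_ord1 /= !subn0 addn0 bin_small // !pochS expr0 mulr1 -!exprSr.
    by field; rewrite hn nz.
  rewrite big_ord_recr IH ?(ltnW hJ) //= subSS.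
  have -> : (n - J = (n - J.+1).+1)%N by lia.
  rewrite addnS (pochS _ _ (n - J.+1)) (pochS _ _ (n.+1 + J)) -!exprSr !(binS _ 1) !bin1.
  have h1 : 1 - q ^+ (n - J.+1).+1 != 0 by rewrite exprSr.
  have h2 : 1 - q ^+ (n.+1 + J).+1 != 0 by rewrite exprSr.
  have e1 : (n.+1 = (n - J.+1).+1 + J.+1)%N by lia.
  have e2 : q ^+ n.+1 = q ^+ (n - J.+1).+1 * q ^+ J.+1 by rewrite -exprD -e1.
  have e3 : q ^+ (n.+1 + J).+1 = q ^+ (n - J.+1).+1 * q ^+ J.+1 * q ^+ J.+1.
    by rewrite -!exprD -e1; congr (_ ^+ _); lia.
  rewrite e2 in hn *; rewrite e3 in h2 *.
  move: (nz (n - J.+1)%N) (nz (n.+1 + J)%N).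
  move: (poch q q (n - J.+1)%N) (poch q q (n.+1 + J)%N) => P1 P2 hP1 hP2.
  rewrite !exprD !(exprS (-1)).
  move: (q ^+ (n - J.+1).+1) (q ^+ J.+1) (q ^+ 'C(J, 2)) (q ^+ J) hn h1 h2 => u v w x hn h1 h2.
  by field; rewrite hP1 hP2 hn h1 h2.
rewrite big_ord_recr part //= subnn poch0 subSS.
rewrite addnS subnn poch0 (pochS _ _ (n.+1 + n)) -exprSr.
have h2 : 1 - q ^+ (n.+1 + n).+1 != 0 by rewrite exprSr.
have e3 : q ^+ (n.+1 + n).+1 = q ^+ n.+1 * q ^+ n.+1 by rewrite -!exprD addnS.
rewrite e3 in h2 *; move: (nz (n.+1 + n)%N).
move: hn h2; rewrite !(exprS (-1)); move: (q ^+ n.+1) => u hn h2 hP.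
by field; rewrite hP hn h2.
Qed.

(** Induction on n. Multiplied by the two new factors (1 - q^(n+1) z)(1 - q^(n+1)/z), [rank_alpha]
    splits ([H]) into a part that lowers the denominators from level n + 1 to level n and a multiple
    of [unit_alpha]. The latter sums to 0 by [unit_beta]. *)
Lemma rank_beta (F : fieldType) (z q : F) n : no_root1 q -> z != 0 -> q != 0 ->
  (forall i, 1 - q ^+ i * z != 0) -> (forall i, 1 - q ^+ i * (q / z) != 0) ->
  \sum_(j < n.+1) rank_alpha z q j / (poch q q (n - j) * poch q q (n + j)) =
  (poch z q n.+1 * poch (q / z) q n)^-1.
Proof.
move=> hq hz q0 h1 h2.
have nz m : poch q q m != 0 by exact: pochq_neq0.
elim: n => [|n IH].
  by rewrite big_ord1 /= !pochS !poch0 expr0 !mul1r divr1 mulr1.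
rewrite (pochS z) (pochS (q / z)).
set D := 1 - q ^+ n.+1 * z; set D' := 1 - _ * _.
have hD : D != 0 by exact: h1.
have hD' : D' != 0 by exact: h2.
apply: (mulfI hD); apply: (mulfI hD').
transitivity (\sum_(j < n.+1) rank_alpha z q j / (poch q q (n - j) * poch q q (n + j))); last first.
  have p1 : poch z q n.+1 != 0 by exact: poch_neq0.
  have p2 : poch (q / z) q n != 0 by exact: poch_neq0.
  by rewrite IH; field; rewrite p1 p2 hD hD'.
have H j : (j <= n.+1)%N -> D' * (D * rank_alpha z q j) =
    (1 - q ^+ (n.+1 - j)) * (1 - q ^+ (n.+1 + j)) * rank_alpha z q j +
    q ^+ n.+1 * (1 - z^-1) * unit_alpha q j.
  have -> : D' = 1 - q ^+ n.+1 / z by rewrite /D' mulrA -exprSr.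
  rewrite /D; case: j => [_|j hj].
    rewrite subn0 addn0 /=; move: (h1 0%N); rewrite expr0 mul1r => hz1.
    by field; rewrite hz.
  have -> : q ^+ (n.+1 + j.+1) = q ^+ (n.+1 - j.+1) * q ^+ j.+1 * q ^+ j.+1.
    by rewrite -!exprD; congr (_ ^+ _); lia.
  have -> : q ^+ n.+1 = q ^+ (n.+1 - j.+1) * q ^+ j.+1.
    by rewrite -!exprD; congr (_ ^+ _); lia.
  rewrite /rank_alpha /unit_alpha.
  have e1 : 1 - q ^+ j.+1 * z != 0 by [].
  have e2 : q ^+ j.+1 - z != 0.
    move: (h2 j); apply: contraNneq => /subr0_eq e.
    by rewrite mulrA -exprSr e divff // subrr.
  move: e1 e2; move: (q ^+ j.+1) (q ^+ 'C(_, _)) (q ^+ _) ((-1) ^+ _) => u v w x e1 e2.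
  by field; rewrite hz e1 e2.
rewrite !mulr_sumr.
under eq_bigr => j _.
  have hj : (j <= n.+1)%N by rewrite -ltnS.
  rewrite !mulrA -(mulrA D') (H _ hj) mulrDl -(mulrA (q ^+ n.+1 * (1 - z^-1))).
  over.
rewrite big_split /= -mulr_sumr unit_beta // mulr0 addr0.
rewrite big_ord_recr /= subnn expr0 subrr !mul0r addr0.
apply: eq_bigr => j _.
have -> : (n.+1 - j = (n - j).+1)%N by case: j => j /=; lia.
have -> : (n.+1 + j = (n + j).+1)%N by [].
rewrite !pochS -!exprSr.
move: (nz (n - j)%N) (nz (n + j)%N) (hq (n - j)%N) (hq (n + j)%N); rewrite -!exprSr.
by move=> *; field; do ?(apply/andP; split).
Qed.

Lemma watson_finite (F : fieldType) (z q : F) N : no_root1 q -> z != 0 -> q != 0 ->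
  (forall i, 1 - q ^+ i * z != 0) -> (forall i, 1 - q ^+ i * (q / z) != 0) ->
  \sum_(n < N.+1) q ^+ (n * n) / poch q q (N - n) / (poch z q n.+1 * poch (q / z) q n)
  = \sum_(j < N.+1) q ^+ (j * j) * rank_alpha z q j / (poch q q (N - j) * poch q q (N + j)).
Proof.
by move=> hq z0 q0 h1 h2; rewrite -bailey //; apply: eq_bigr => n _; rewrite rank_beta.
Qed.

(** Finite form of Euler's pentagonal number theorem: the beta of the unit pair keeps only n = 0 in
    the Bailey lemma. *)
Lemma pentagonal_finite (F : fieldType) (q : F) N : no_root1 q ->
  \sum_(j < N.+1) q ^+ (j * j) * unit_alpha q j / (poch q q (N - j) * poch q q (N + j))
  = (poch q q N)^-1.
Proof.
move=> hq; rewrite -bailey // big_ord_recl unit_beta // mulr1 /= subn0 mul1r.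
by rewrite big1 ?addr0 // => i _; rewrite unit_beta // mulr0.
Qed.

(** * Finite partial fractions of a product of three theta functions *)

(** The list holds the reciprocals of the poles, which keeps every factor in the normalised form 1 -
    a z of a q-Pochhammer symbol. The induction removes one pole p at a time. *)
Lemma partial_fractions (F : fieldType) (r : seq F) (z : F) m :
  uniq r -> {in r, forall a, a != 0} -> {in r, forall a, 1 - a * z != 0} ->
  (m < size r)%N ->
  z ^+ m / \prod_(a <- r) (1 - a * z) =
  \sum_(a <- r) a ^- m / ((1 - a * z) * \prod_(b <- r | b != a) (1 - b / a)).
Proof.
elim: r z m => // p r IH z m /= /andP[pr ur] r0 rz hm.
have p0 : p != 0 by apply: r0; rewrite inE eqxx.
have pz : 1 - p * z != 0 by apply: rz; rewrite inE eqxx.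
have r0' : {in r, forall a, a != 0} by move=> a ar; apply: r0; rewrite inE ar orbT.
have rz' : {in r, forall a, 1 - a * z != 0} by move=> a ar; apply: rz; rewrite inE ar orbT.
have neq a : a \in r -> a != p by move=> ar; apply: contraNneq pr => <-.
have rp : {in r, forall a, 1 - a / p != 0}.
  move=> a ar; rewrite subr_eq0 eq_sym; apply: contraNneq (neq _ ar) => e.
  by rewrite -[a](divfK p0) e mul1r.
have rp' : {in r, forall a, 1 - p / a != 0}.
  move=> a ar; rewrite subr_eq0 eq_sym; apply: contraNneq (neq _ ar) => e.
  by rewrite -[p](divfK (r0' _ ar)) e mul1r.
have Q0 : {in r, forall a, \prod_(b <- r | b != a) (1 - b / a) != 0}.
  move=> a ar; rewrite prodf_seq_neq0; apply/allP => b br; apply/implyP => ba.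
  rewrite subr_eq0 eq_sym; apply: contraNneq ba => e.
  by rewrite -[b](divfK (r0' _ ar)) e mul1r.
have split_ k : \sum_(a <- p :: r) a ^- k / ((1 - a * z) * \prod_(b <- p :: r | b != a) (1 - b / a))
  = p ^- k / ((1 - p * z) * \prod_(b <- r) (1 - b / p)) +
    \sum_(a <- r) a ^- k / ((1 - a * z) * ((1 - p / a) * \prod_(b <- r | b != a) (1 - b / a))).
  rewrite big_cons; congr (_ / (_ * _) + _).
    rewrite big_cons eqxx /= big_seq_cond [RHS]big_seq_cond.
    by apply: eq_bigl => b; case br: (b \in r) => //=; rewrite neq.
  rewrite big_seq [RHS]big_seq; apply: eq_bigr => a ar; congr (_ / (_ * _)).
  by rewrite big_cons eq_sym neq.
have small k : (k < size r)%N -> z ^+ k / \prod_(a <- p :: r) (1 - a * z) =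
  \sum_(a <- p :: r) a ^- k / ((1 - a * z) * \prod_(b <- p :: r | b != a) (1 - b / a)).
  move=> hk; rewrite split_ big_cons.
  (* The coefficient at the new pole is the induction hypothesis evaluated at z = 1/p; the identity
     can then be checked separately for each a. *)
  have -> : p ^- k / ((1 - p * z) * \prod_(b <- r) (1 - b / p)) =
    (1 - p * z)^-1 * (p^-1 ^+ k / \prod_(b <- r) (1 - b * p^-1)).
    by rewrite exprVn invfM mulrCA.
  rewrite (IH p^-1) // invfM mulrCA (IH z) // !mulr_sumr -big_split /=.
  rewrite big_seq [RHS]big_seq; apply: eq_bigr => a ar.
  move: (r0' _ ar) (rz' _ ar) (rp _ ar) (rp' _ ar) (Q0 _ ar).
  move: (a ^- k) (\prod_(b <- r | _) _) => u v a0 az ap pa v0.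
  have pa' : a - p != 0 by rewrite subr_eq0 neq.
  have ap' : p - a != 0 by rewrite subr_eq0 eq_sym neq.
  by field; rewrite v0 a0 p0 pz az pa' ap'.
(* The top exponent is out of reach of the induction hypothesis; z = (1 - (1 - p z)) / p lowers it
   by one. *)
move: hm; rewrite ltnS leq_eqVlt => /orP[/eqP em|]; last exact: small.
case: m em => [/esym/size0nil r_nil|k em].
  by rewrite split_ r_nil big_cons !big_nil expr0 invr1 !mulr1 addr0.
have hk : (k < size r)%N by rewrite -em.
have := small _ hk; rewrite !split_ big_cons => e.
transitivity (p^-1 * (z ^+ k / ((1 - p * z) * \prod_(j <- r) (1 - j * z)) -
   z ^+ k / \prod_(j <- r) (1 - j * z))).
  have Qz : \prod_(j <- r) (1 - j * z) != 0.
    by rewrite prodf_seq_neq0; apply/allP => a ar; apply: rz'.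
  by rewrite exprS; field; rewrite pz p0 Qz.
rewrite e IH // addrAC -addrA mulrDr; congr (_ + _).
  rewrite exprS (invfM p) mulrA. by [].
rewrite addrC mulrBr !mulr_sumr -sumrB big_seq [RHS]big_seq.
apply: eq_bigr => a ar.
move: (r0' _ ar) (rz' _ ar) (rp' _ ar) (Q0 _ ar).
rewrite exprS (invfM a (a ^+ k)).
move: (a ^- k) (\prod_(b <- r | _) _) => u v a0 az pa v0.
have pa' : a - p != 0 by rewrite subr_eq0 neq.
by field; rewrite v0 a0 p0 az pa'.
Qed.

(** The factors with j < i carry negative powers of q = s^2. From 1 - x q^(-k) = -x q^(-k) (1 - q^k
    / x) for 1 <= k <= i come the symbol (q/x; q)_i and the prefactor. *)
Lemma prod_shift (F : fieldType) (s x : F) n i : s != 0 -> x != 0 -> (i <= n)%N ->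
  \prod_(j < n) (1 - (s ^+ 2) ^+ j / (s ^+ 2) ^+ i * x) =
  (- x) ^+ i * s ^- (i * i.+1) * poch (s ^+ 2 / x) (s ^+ 2) i * poch x (s ^+ 2) (n - i).
Proof.
move=> s0; elim: i x => [|i IH] x x0 hi.
  rewrite mul0n !expr0 poch0 invr1 !mul1r subn0 /poch.
  by apply: eq_bigr => j _; rewrite mulr1.
have q0 : s ^+ 2 != 0 by rewrite expf_neq0.
have [m em em'] : exists2 m, (n - i = m.+1)%N & (n - i.+1 = m)%N by exists (n - i.+1)%N; lia.
transitivity (\prod_(j < n) (1 - (s ^+ 2) ^+ j / (s ^+ 2) ^+ i * (x / s ^+ 2))).
  apply: eq_bigr => j _; rewrite (exprSr (s ^+ 2) i) invfM; congr (1 - _); ring.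
rewrite IH ?mulf_neq0 ?invr_eq0 ?(ltnW hi) //.
rewrite em em' !pochSl.
have -> : s ^+ 2 / (x / s ^+ 2) = s ^+ 2 * (s ^+ 2 / x) by field; rewrite x0 s0.
have -> : s ^+ 2 * (x / s ^+ 2) = x by field; rewrite s0.
have -> : (- (x / s ^+ 2)) ^+ i = (- x) ^+ i * s ^- (2 * i).
  by rewrite -mulNr exprMn exprVn -exprM.
have -> : (i.+1 * i.+2 = 2 * i + i * i.+1 + 2)%N by lia.
rewrite (exprS (- x)) !exprD; move: (poch _ _ i) (poch _ _ m) ((- x) ^+ i) => u v w.
have s2 : s ^+ (i * i.+1) != 0 by rewrite expf_neq0.
move: s2; move: (s ^+ (i * i.+1)) => b b0.
by field; rewrite x0 s0 b0 expf_neq0.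
Qed.

Lemma prod_shift_punctured (F : fieldType) (s : F) n i : s != 0 -> (i < n)%N ->
  \prod_(0 <= j < n | j != i) (1 - (s ^+ 2) ^+ j / (s ^+ 2) ^+ i) =
  (- 1) ^+ i * s ^- (i * i.+1) * poch (s ^+ 2) (s ^+ 2) i * poch (s ^+ 2) (s ^+ 2) (n - i.+1).
Proof.
move=> s0 hi; rewrite (big_cat_nat (n := i)) //=; last exact: ltnW.
have q0 : s ^+ 2 != 0 by rewrite expf_neq0.
congr (_ * _).
  rewrite big_nat_cond (eq_bigl (fun j => (0 <= j < i)%N)); last by move=> j; lia.
  rewrite -big_nat big_mkord.
  under eq_bigr do rewrite -[X in 1 - X]mulr1.
  by rewrite prod_shift ?oner_eq0 // subnn poch0 divr1 mulr1.
rewrite big_ltn_cond // eqxx /=.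
rewrite big_nat_cond (eq_bigl (fun j => (i.+1 <= j < n)%N)); last by move=> j; lia.
rewrite -big_nat -{1}[i.+1]add0n big_addn big_mkord /poch; apply: eq_bigr => j _.
rewrite exprD (exprSr (s ^+ 2) i) mulrA -(mulrAC _ _ (s ^+ 2)) mulfK ?expf_neq0 //.
Qed.

Definition geom_seq (F : fieldType) (q c : F) n := [seq q ^+ i * c | i <- index_iota 0 n].

Lemma expf_inj_no_root1 (F : fieldType) (q : F) i j :
  q != 0 -> no_root1 q -> q ^+ i = q ^+ j -> i = j.
Proof.
move=> q0 hq; wlog lt : i j / (i < j)%N => [H e|].
  by case: (ltngtP i j) => // h; [exact: H|symmetry; exact: H].
have -> : j = ((j - i).-1.+1 + i)%N by lia.
rewrite exprD => e; have := hq (j - i).-1; rewrite -exprSr.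
rewrite subr_eq0 eq_sym => /eqP[]; apply: (mulIf (expf_neq0 i q0)).
by rewrite -e mul1r.
Qed.

Lemma prod_geom_same (F : fieldType) (s c : F) n i : s != 0 -> no_root1 (s ^+ 2) ->
  c != 0 -> (i < n)%N ->
  \prod_(b <- geom_seq (s ^+ 2) c n | b != (s ^+ 2) ^+ i * c) (1 - b / ((s ^+ 2) ^+ i * c)) =
  (- 1) ^+ i * s ^- (i * i.+1) * poch (s ^+ 2) (s ^+ 2) i * poch (s ^+ 2) (s ^+ 2) (n - i.+1).
Proof.
move=> s0 hq c0 hi; rewrite -prod_shift_punctured // /geom_seq big_map.
have q0 : s ^+ 2 != 0 by rewrite expf_neq0.
apply: eq_big => [j|j _]; last by rewrite -mulf_div divff // mulr1.
rewrite (inj_eq (mulIf c0)); congr (~~ _); apply/eqP/eqP => [|-> //].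
exact: expf_inj_no_root1.
Qed.

Lemma prod_geom_other (F : fieldType) (s c d : F) n i : s != 0 ->
  c != 0 -> d != 0 -> (i <= n)%N -> (forall j, (s ^+ 2) ^+ j * d != (s ^+ 2) ^+ i * c) ->
  \prod_(b <- geom_seq (s ^+ 2) d n | b != (s ^+ 2) ^+ i * c) (1 - b / ((s ^+ 2) ^+ i * c)) =
  (- (d / c)) ^+ i * s ^- (i * i.+1) * poch (s ^+ 2 / (d / c)) (s ^+ 2) i
    * poch (d / c) (s ^+ 2) (n - i).
Proof.
move=> s0 c0 d0 hi neq; rewrite -prod_shift ?mulf_neq0 ?invr_eq0 //.
rewrite /geom_seq big_map big_mkord; apply: eq_big => [j|j _]; first exact: neq.
by rewrite -mulf_div.
Qed.

(** What the other factors leave at the i-th pole of a family, apart from signs and powers of s; x1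
    and x2 are the ratios of the other two families to this one. As i and n - i grow, it tends to
    (q)_oo^2 times two theta products. *)
Definition theta_den (F : fieldType) (q x1 x2 : F) (n i : nat) :=
  poch q q i * poch q q (n - i.+1) * (poch (q / x1) q i * poch x1 q (n - i))
   * (poch (q / x2) q i * poch x2 q (n - i)).

(** Each of the three families puts s^(-i(i+1)) into the denominator: this is the origin of the
    exponent 3 k^2 in the Appell sums. The term -2 i m comes from a^-m. *)
Lemma residue_geom (F : fieldType) (s c d e : F) n m i (z : F) :
  s != 0 -> no_root1 (s ^+ 2) -> c != 0 -> d != 0 -> e != 0 -> (i < n)%N ->
  (forall j, (s ^+ 2) ^+ j * d != (s ^+ 2) ^+ i * c) ->
  (forall j, (s ^+ 2) ^+ j * e != (s ^+ 2) ^+ i * c) ->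
  let a := (s ^+ 2) ^+ i * c in
  a ^- m / ((1 - a * z) *
    (\prod_(b <- geom_seq (s ^+ 2) c n | b != a) (1 - b / a) *
     (\prod_(b <- geom_seq (s ^+ 2) d n | b != a) (1 - b / a) *
      \prod_(b <- geom_seq (s ^+ 2) e n | b != a) (1 - b / a)))) =
  s ^ (3%:Z * i%:Z * (i%:Z + 1) - 2%:Z * i%:Z * m%:Z) * c ^- m * (- (d / c * (e / c))) ^- i /
  ((1 - a * z) * theta_den (s ^+ 2) (d / c) (e / c) n i).
Proof.
move=> s0 hq c0 d0 e0 hi nd ne a.
rewrite prod_geom_same // !prod_geom_other ?(ltnW hi) // /theta_den /a.
have -> : s ^ (3%:Z * i%:Z * (i%:Z + 1) - 2%:Z * i%:Z * m%:Z) =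
  (s ^+ (i * i.+1)) * (s ^+ (i * i.+1)) * (s ^+ (i * i.+1)) * (s ^+ 2 ^+ i ^- m).
  rewrite -!exprM -!exprD exprnP exprnN -expfzDr //; congr (_ ^ _); lia.
set X := 1 - _; move: X => X.
rewrite exprMn invfM.
have -> : - (d / c * (e / c)) = (-1) * ((- (d / c)) * (- (e / c))) by ring.
rewrite (exprMn _ (-1)) (exprMn _ (- (d / c)))
 !invfM !invrK invr_sign.
ring.
Qed.

Definition theta_trunc (F : fieldType) (x q : F) N := poch x q N * poch (q / x) q N.

(** Dividing Z by q^N makes the exponents of q run from -N to N - 1, so that the product becomes a
    symmetric truncation of a theta function. *)
Lemma prod_geom_center (F : fieldType) (s c Z : F) N : s != 0 -> c != 0 -> Z != 0 ->
  \prod_(a <- geom_seq (s ^+ 2) c (N + N)) (1 - a * (Z / (s ^+ 2) ^+ N)) =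
  (- (c * Z)) ^+ N * s ^- (N * N.+1) * theta_trunc (c * Z) (s ^+ 2) N.
Proof.
move=> s0 c0 Z0; rewrite /theta_trunc (mulrC (poch (c * Z) _ _)) mulrA.
rewrite -[X in poch (c * Z) _ X](addnK N N) -prod_shift ?mulf_neq0 // ?leq_addr //.
by rewrite /geom_seq big_map big_mkord; apply: eq_bigr => i _; ring.
Qed.

(** Fourth powers would give q^(4j+2) = q^(4i). *)
Lemma geom_sqrt_opp_neq (F : fieldType) (q d : F) i j :
  q != 0 -> no_root1 q -> d ^+ 2 = - q -> q ^+ j * d != q ^+ i * 1.
Proof.
move=> q0 hq hd; rewrite mulr1; apply/eqP => e.
have : (q ^+ j * d) ^+ 4 = (q ^+ i) ^+ 4 by rewrite e.
rewrite exprMn (exprM d 2 2) hd sqrrN -!exprM -exprD.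
by move=> /(expf_inj_no_root1 q0 hq); lia.
Qed.

Lemma geom_opp_neq (F : fieldType) (q d : F) i j :
  q != 0 -> no_root1 q -> 2%:R != 0 :> F -> d != 0 -> q ^+ j * - d != q ^+ i * d.
Proof.
move=> q0 hq two0 d0; rewrite mulrN -mulNr (inj_eq (mulIf d0)); apply/eqP => e.
have : (- q ^+ j) ^+ 2 = (q ^+ i) ^+ 2 by rewrite e.
rewrite sqrrN -!exprM => /(expf_inj_no_root1 q0 hq) ij.
have {}ij : i = j by lia.
move: e => /eqP; rewrite ij eq_sym -addr_eq0 -mulr2n -mulr_natl mulf_eq0.
by rewrite (negbTE two0) expf_eq0 (negbTE q0) andbF.
Qed.

(* [o] is a square root of [- q], where [q = s ^+ 2], so that
   [(o Z; q) (- o Z; q) = (- q Z^2; q^2)]; the poles are at [Z = q^-k] and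
   [Z = +- 1 / (o q^k)]. *)
Lemma theta3_partial_fractions (F : fieldType) (s o Z : F) N :
  s != 0 -> no_root1 (s ^+ 2) -> o ^+ 2 = - s ^+ 2 -> 2%:R != 0 :> F -> Z != 0 ->
  (forall k : int, 1 - s ^ (2%:Z * k) * Z != 0) ->
  (forall k : int, 1 - s ^ (2%:Z * k) * (o * Z) != 0) ->
  (forall k : int, 1 - s ^ (2%:Z * k) * (- o * Z) != 0) -> (0 < N)%N ->
  (theta_trunc Z (s ^+ 2) N * theta_trunc (o * Z) (s ^+ 2) N
    * theta_trunc (- o * Z) (s ^+ 2) N)^-1 =
  \sum_(i < N + N) let k := i%:Z - N%:Z in
    ((- 1) ^ k * s ^ (3%:Z * k * k + k) /
       ((1 - s ^ (2%:Z * k) * Z) * theta_den (s ^+ 2) o (- o) (N + N) i)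
    + o ^ k * s ^ (3%:Z * k * k + 3%:Z * k) /
       ((1 - s ^ (2%:Z * k) * (o * Z)) * theta_den (s ^+ 2) (1 / o) (- o / o) (N + N) i)
    + (- o) ^ k * s ^ (3%:Z * k * k + 3%:Z * k) /
       ((1 - s ^ (2%:Z * k) * (- o * Z)) *
          theta_den (s ^+ 2) (1 / - o) (o / - o) (N + N) i)).
Proof.
move=> s0 hq ho two0 Z0 hZ hoZ hoZ' hN.
have q0 : s ^+ 2 != 0 by rewrite expf_neq0.
have o0 : o != 0 by move: q0; rewrite -oppr_eq0 -ho expf_eq0.
have o0' : - o != 0 by rewrite oppr_eq0.
pose r := geom_seq (s ^+ 2) 1 (N + N) ++ (geom_seq (s ^+ 2) o (N + N) ++
   geom_seq (s ^+ 2) (- o) (N + N)).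
pose z := Z / (s ^+ 2) ^+ N.
have injq := expf_inj_no_root1 q0 hq.
have n1o i j (d : F) : d ^+ 2 = - s ^+ 2 -> (s ^+ 2) ^+ j * d != (s ^+ 2) ^+ i * 1.
  exact: geom_sqrt_opp_neq.
have ho' : (- o) ^+ 2 = - s ^+ 2 by rewrite sqrrN.
have noo i j : (s ^+ 2) ^+ j * - o != (s ^+ 2) ^+ i * o by exact: geom_opp_neq.
have gz (c : F) i : (s ^+ 2) ^+ i * c * z = s ^ (2%:Z * (i%:Z - N%:Z)) * (c * Z).
  rewrite /z mulrBr expfzDr // -!exprM exprnP.
  by rewrite -[_ * N%:Z]/((2 * N)%N%:Z) -exprnN exprnP; ring.
have mem (c : F) a : a \in geom_seq (s ^+ 2) c (N + N) -> exists2 i, (i < N + N)%N & a = (s ^+ 2) ^+ i * c.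
  by move=> /mapP[i]; rewrite mem_index_iota => hi ->; exists i.
have ur1 (c : F) : c != 0 -> uniq (geom_seq (s ^+ 2) c (N + N)).
  move=> c0; rewrite map_inj_uniq ?iota_uniq // => i j /(mulIf c0); exact: injq.
have ur : uniq r.
  rewrite !cat_uniq !ur1 ?oner_eq0 //= !andbT; apply/andP; split; apply/hasPn => a.
    rewrite mem_cat => /orP[] /mem[i _ ->]; apply/negP => /mem[j _ /eqP].
      by rewrite (negbTE (n1o _ _ _ ho)).
    by rewrite (negbTE (n1o _ _ _ ho')).
  move=> /mem[i _ ->]; apply/negP => /mem[j _ /eqP].
  by rewrite (negbTE (noo _ _)).
have r0 : {in r, forall a, a != 0}.
  by move=> a; rewrite !mem_cat => /or3P[] /mem[i _ ->]; rewrite mulf_neq0 ?oner_eq0 ?expf_neq0.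
have rz : {in r, forall a, 1 - a * z != 0}.
  by move=> a; rewrite !mem_cat => /or3P[] /mem[i _ ->]; rewrite gz // mul1r.
(* The exponent 3N is chosen to cancel the factor Z^(3N) produced by the three centred products; it
   is below the number 6N of poles because N > 0. *)
have sr : (3 * N < size r)%N.
  by rewrite !size_cat !size_map !size_iota; lia.
have := partial_fractions ur r0 rz sr.
(* [K] is the sign and power of s left over after Z has cancelled; dividing by it recentres the
   exponents from i to k = i - N. *)
pose K := (- 1) ^+ N * s ^ (N%:Z - 3%:Z * N%:Z * N%:Z).
have K0 : K != 0 by rewrite mulf_neq0 ?signr_eq0 ?expfz_neq0.
have -> : z ^+ (3 * N) / \prod_(a <- r) (1 - a * z) = K * (theta_trunc Z (s ^+ 2) N * theta_trunc (o * Z) (s ^+ 2) N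
    * theta_trunc (- o * Z) (s ^+ 2) N)^-1.
  rewrite !big_cat /=.
  have -> : \prod_(a <- geom_seq (s ^+ 2) 1 (N + N)) (1 - a * z) =
     (- Z) ^+ N * s ^- (N * N.+1) * theta_trunc Z (s ^+ 2) N.
    by rewrite prod_geom_center ?oner_eq0 // mul1r.
  rewrite !prod_geom_center ?oner_eq0 // /z exprMn exprVn.
  have e1 : (- Z) ^+ N * (- (o * Z)) ^+ N * (- (- o * Z)) ^+ N =
     (- 1) ^+ N * s ^+ (2 * N) * Z ^+ (3 * N).
    rewrite (exprM s) (exprM Z) -!exprMn; congr (_ ^+ N).
    by rewrite mulN1r -ho; ring.
  have e2 : ((s ^+ 2) ^+ N) ^- (3 * N) = s ^ (N%:Z - 3%:Z * N%:Z * N%:Z) * (s ^+ (2 * N)) *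
    (s ^- (N * N.+1) * s ^- (N * N.+1) * s ^- (N * N.+1)).
    rewrite -!exprM !exprnN exprnP -!expfzDr //; congr (_ ^ _); lia.
  transitivity (Z ^+ (3 * N) * ((s ^+ 2) ^+ N) ^- (3 * N) *
    ((- Z) ^+ N * (- (o * Z)) ^+ N * (- (- o * Z)) ^+ N)^-1 *
    (s ^- (N * N.+1) * s ^- (N * N.+1) * s ^- (N * N.+1))^-1 *
    (theta_trunc Z (s ^+ 2) N * theta_trunc (o * Z) (s ^+ 2) N *
     theta_trunc (- o * Z) (s ^+ 2) N)^-1).
    by rewrite !invfM; ring.
  congr (_ * _); rewrite e1 e2 /K !invfM invr_sign.
  have sN0 : s ^+ (2 * N) != 0 by rewrite expf_neq0.
  have ZN0 : Z ^+ (3 * N) != 0 by rewrite expf_neq0.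
  have sM0 : s ^- (N * N.+1) != 0 by rewrite invr_eq0 expf_neq0.
  move: (s ^ _) (s ^- _) ((-1) ^+ N) sM0 => u v w v0.
  move: sN0 ZN0; move: (s ^+ _) (Z ^+ _) => a b a0 b0.
  by field; rewrite a0 b0 v0.
move=> /(canRL (mulKf K0)) ->.
(* The three families are treated by one statement, with c the family of the pole and d, e the other
   two in either order. *)
have split_sum (c d e : F) (h : nat -> F) : c != 0 -> d != 0 -> e != 0 ->
   (forall i j, (s ^+ 2) ^+ j * d != (s ^+ 2) ^+ i * c) ->
   (forall i j, (s ^+ 2) ^+ j * e != (s ^+ 2) ^+ i * c) ->
   (forall b, b \in geom_seq (s ^+ 2) c (N + N) -> forall (f : F -> F),
     \prod_(x <- r | x != b) f x =
      \prod_(x <- geom_seq (s ^+ 2) c (N + N) | x != b) f x *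
      (\prod_(x <- geom_seq (s ^+ 2) d (N + N) | x != b) f x *
      \prod_(x <- geom_seq (s ^+ 2) e (N + N) | x != b) f x)) ->
   (forall i, K^-1 * (s ^ (3%:Z * i%:Z * (i%:Z + 1) - 2%:Z * i%:Z * (3 * N)%N%:Z) *
       c ^- (3 * N) * (- (d / c * (e / c))) ^- i) = h i) ->
   K^-1 * \sum_(a <- geom_seq (s ^+ 2) c (N + N))
      a ^- (3 * N) / ((1 - a * z) * \prod_(b <- r | b != a) (1 - b / a)) =
   \sum_(i < N + N) h i / ((1 - s ^ (2%:Z * (i%:Z - N%:Z)) * (c * Z)) *
      theta_den (s ^+ 2) (d / c) (e / c) (N + N) i).
  move=> c0 d0 e0 nd ne hr hh.
  rewrite {1}/geom_seq big_map big_mkord mulr_sumr; apply: eq_bigr => i _.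
  rewrite hr ?residue_geom // -?hh -?gz ?mulrA //.
  by apply: map_f; rewrite mem_index_iota ltn_ord.
have sgn i : (- 1) ^+ N * (- 1) ^ (i%:Z - N%:Z) = (- 1) ^+ i :> F.
  by rewrite 2!exprnP -expfzDr ?oppr_eq0 ?oner_eq0 //; congr (_ ^ _); lia.
(* Stated for c so as to serve both o and -o; c^2 = -s^2 trades even powers of c for signs and
   powers of s. *)
have coef_o (c : F) i : c ^+ 2 = - s ^+ 2 ->
    K^-1 * (s ^ (3%:Z * i%:Z * (i%:Z + 1) - 2%:Z * i%:Z * (3 * N)%N%:Z) *
       c ^- (3 * N) * (- (1 / c * (- c / c))) ^- i) =
    c ^ (i%:Z - N%:Z) *
      s ^ (3%:Z * (i%:Z - N%:Z) * (i%:Z - N%:Z) + 3%:Z * (i%:Z - N%:Z)).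
  move=> hc; have c0 : c != 0 by move: q0; rewrite -oppr_eq0 -hc expf_eq0.
  apply: (canLR (mulKf K0)); rewrite mulNr divff // mulrN1 opprK mul1r exprVn invrK.
  transitivity (s ^ (3%:Z * i%:Z * (i%:Z + 1) - 2%:Z * i%:Z * (3 * N)%N%:Z) *
    (c ^ (i%:Z - N%:Z) * (c ^+ 2) ^- N)).
    rewrite -mulrA; congr (_ * _); rewrite -exprM [_ ^- (2 * N)]exprnN -expfzDr //.
    by rewrite exprnN [c ^+ i]exprnP -expfzDr //; congr (_ ^ _); lia.
  have -> : (c ^+ 2) ^- N = (- 1) ^+ N * s ^- (2 * N).
    by rewrite hc -(mulN1r (s ^+ 2)) exprMn invfM invr_sign -exprM.
  rewrite /K mulrCA [RHS]mulrCA; congr (_ * _).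
  rewrite mulrCA -[RHS]mulrA; congr (_ * _).
  by rewrite exprnN -!expfzDr //; congr (_ ^ _); lia.
rewrite !big_cat /= !mulrDr.
rewrite (split_sum 1 o (- o) (fun i => (- 1) ^ (i%:Z - N%:Z) *
   s ^ (3%:Z * (i%:Z - N%:Z) * (i%:Z - N%:Z) + (i%:Z - N%:Z)))) ?oner_eq0 //; first last.
- move=> i; apply: (canLR (mulKf K0)).
  rewrite !divr1 expr1n invr1 mulr1 mulrN opprK -expr2 ho -(mulN1r (s ^+ 2)) exprMn invfM invr_sign.
  rewrite /K [RHS]mulrACA sgn [LHS]mulrCA; congr (_ * _).
  by rewrite -exprM exprnN -!expfzDr //; congr (_ ^ _); lia.
- by move=> b _ f; rewrite !big_cat.
- by move=> i j; apply: n1o.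
- by move=> i j; apply: n1o.
rewrite (split_sum o 1 (- o) (fun i => o ^ (i%:Z - N%:Z) *
   s ^ (3%:Z * (i%:Z - N%:Z) * (i%:Z - N%:Z) + 3%:Z * (i%:Z - N%:Z)))) ?oner_eq0 //; first last.
- by move=> i; apply: coef_o.
- by move=> b _ f; rewrite !big_cat /= mulrCA.
- by move=> i j; rewrite eq_sym n1o.
rewrite (split_sum (- o) 1 o (fun i => (- o) ^ (i%:Z - N%:Z) *
   s ^ (3%:Z * (i%:Z - N%:Z) * (i%:Z - N%:Z) + 3%:Z * (i%:Z - N%:Z)))) ?oner_eq0 //; first last.
- by move=> i; rewrite -coef_o // opprK.
- by move=> b _ f; rewrite !big_cat /= mulrA mulrC.
- by move=> i j; rewrite eq_sym noo.
- by move=> i j; rewrite eq_sym n1o.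
rewrite -!big_split /=; apply: eq_bigr => i _.
by rewrite !divr1 mul1r addrA.
Qed.

(** * Finite form of the Jacobi triple product *)

Lemma q_binomial_theorem (F : fieldType) (q z : F) n : no_root1 q ->
  poch z q n = \sum_(k < n.+1)
    (- 1) ^+ k * q ^+ 'C(k, 2) * z ^+ k * (poch q q n / (poch q q k * poch q q (n - k))).
Proof.
move=> hq; have nz m : poch q q m != 0 by exact: pochq_neq0.
elim: n => [|n IH]; first by rewrite big_ord1 /= bin0n subn0 !poch0 !expr0 !mul1r invr1.
rewrite pochS mulrBr mulr1 {1}IH big_ord_recl IH big_ord_recr /=.
rewrite [in RHS]big_ord_recl [in RHS]big_ord_recr /= !subnn !poch0 !subn0.
rewrite mulrDl opprD !addrA; congr (_ + _); last first.
  rewrite /bump /= add1n binS bin1 exprD !mulr1 !divff //.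
  by rewrite !(exprS _ n); ring.
rewrite -addrA; congr (_ + _); first by rewrite !mul1r !divff.
rewrite mulr_suml -sumrB; apply: eq_bigr => i _; rewrite /bump /= add1n subSS.
have [m em em'] : exists2 m, (n - i = m.+1)%N & (n - i.+1 = m)%N.
  by exists (n - i.+1)%N; case: i => i /=; lia.
rewrite em em' (pochS _ _ n) (pochS _ _ m) (pochS _ _ i) -!exprSr binS bin1 !exprD.
have h1 : 1 - q ^+ m.+1 != 0 by rewrite exprSr.
have h2 : 1 - q ^+ i.+1 != 0 by rewrite exprSr.
have -> : q ^+ n.+1 = q ^+ i.+1 * q ^+ m.+1 by rewrite -exprD; congr (_ ^+ _); lia.
have -> : q ^+ n = q ^+ i * q ^+ m.+1 by rewrite -exprD; congr (_ ^+ _); lia.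
rewrite !(exprS _ i) in h2 *.
move: (nz m) (nz i) (nz n) h1 h2 => a b c d e.
by field; rewrite a b d e.
Qed.

(** The q-binomial theorem at x q^(-N) with 2N - 1 factors has 2N terms, which matches the range -N
    <= k < N of the bilateral partial sums. The odd number of factors is why one symbol has length N
    and the other N - 1. *)
Lemma jacobi_finite (F : fieldType) (s x : F) N : s != 0 -> x != 0 ->
  no_root1 (s ^+ 2) -> (0 < N)%N ->
  poch (s ^+ 2 / x) (s ^+ 2) N * poch x (s ^+ 2) N.-1 =
  \sum_(i < N + N) let k := i%:Z - N%:Z in
    (- x) ^ k * s ^ (k * k - k) * (poch (s ^+ 2) (s ^+ 2) (N + N).-1 /
       (poch (s ^+ 2) (s ^+ 2) i * poch (s ^+ 2) (s ^+ 2) (N + N - i.+1))).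
Proof.
move=> s0 x0 hq hN.
have q0 : s ^+ 2 != 0 by rewrite expf_neq0.
have hi : (N <= (N + N).-1)%N by lia.
have x0' : - x != 0 by rewrite oppr_eq0.
pose K := (- x) ^+ N * s ^- (N * N.+1).
have K0 : K != 0 by rewrite mulf_neq0 ?invr_eq0 ?expf_neq0.
apply: (mulfI K0); rewrite mulrA.
have -> : (N.-1 = (N + N).-1 - N)%N by lia.
rewrite -prod_shift // mulr_sumr.
transitivity (poch (x / (s ^+ 2) ^+ N) (s ^+ 2) (N + N).-1).
  by rewrite /poch; apply: eq_bigr => j _; rewrite mulrA mulrAC.
rewrite q_binomial_theorem //.
have -> : ((N + N).-1.+1 = N + N)%N by lia.
apply: eq_bigr => i _.
have -> : ((N + N).-1 - i = N + N - i.+1)%N by lia.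
cbv zeta; rewrite [RHS]mulrA; congr (_ * _).
have -> : (-1) ^+ i * (s ^+ 2) ^+ 'C(i, 2) * (x / (s ^+ 2) ^+ N) ^+ i =
   (- x) ^+ i * ((s ^+ 2) ^+ 'C(i, 2) * ((s ^+ 2) ^+ N) ^- i).
  by rewrite (exprMn _ x) exprVn -(mulN1r x) (exprMn _ (-1) x) mulrACA.
rewrite /K mulrACA; congr (_ * _).
  by rewrite 2!exprnP -expfzDr //; congr (_ ^ _); lia.
have -> : ((s ^+ 2) ^+ 'C(i, 2)) = s ^ (i%:Z * i%:Z - i%:Z).
  rewrite -exprM exprnP; congr (_ ^ _).
  have := bin_ffact i 2; rewrite !ffactnS ffactn0 muln1 (_ : 2`! = 2%N) //; nia.
by rewrite -!exprM !exprnN -!expfzDr //; congr (_ ^ _); lia.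
Qed.

(** * Infinite products and bilateral sums *)

Lemma csum_partE (f : nat -> CC) n : csum_part f n = \sum_(i < n) f i.
Proof. by elim: n => [|n IH]; rewrite ?big_ord0 // big_ord_recr /= IH. Qed.

Lemma cprod_partE (f : nat -> CC) n : cprod_part f n = \prod_(i < n) f i.
Proof. by elim: n => [|n IH]; rewrite ?big_ord0 // big_ord_recr /= IH. Qed.

Lemma CpowE (z : CC) n : Cpow z n = z ^+ n.
Proof. by elim: n => [|n IH] //; rewrite exprSr /= IH. Qed.

Lemma qpochE (x q : CC) n : qpoch x q n = poch x q n.
Proof. by rewrite /qpoch cprod_partE; apply: eq_bigr => i _; rewrite CpowE. Qed.

Lemma Csum_eq (f : nat -> CC) L : Ccv (fun n => \sum_(i < n) f i) L -> Csum f = L.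
Proof. by move=> h; apply: Clim_eq; apply: Ccv_ext h => n; rewrite csum_partE. Qed.

Lemma exp_ge1 t : (1 + t <= exp t)%R.
Proof. by have [->|/exp_ineq1] := Req_dec t 0; rewrite ?exp_0; lra. Qed.

Lemma geom_factor_bound (u d : nat -> CC) C r : (0 <= C)%R -> (0 <= r < 1)%R ->
  (forall n, u n.+1 = u n * (1 + d n)) -> (forall n, (Cnorm (d n) <= C * r ^ n)%R) ->
  forall n, (Cnorm (u n) <= Cnorm (u 0%N) * exp (C / (1 - r)))%R.
Proof.
move=> C0 r01 hu hd n.
have h : (Cnorm (u n) <= Cnorm (u 0%N) * exp (C * (1 - r ^ n) / (1 - r)))%R.
  elim: n => [|n IH].
    by rewrite /= Rminus_diag Rmult_0_r /Rdiv Rmult_0_l exp_0; nlra.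
  rewrite hu Cnorm_mul.
  have -> : (C * (1 - r ^ n.+1) / (1 - r) = C * (1 - r ^ n) / (1 - r) + C * r ^ n)%R.
    by rewrite /=; Rfield; lra.
  rewrite exp_plus -Rmult_assoc; apply: Rmult_le_compat => //; try exact: Cnorm_ge0.
  apply: Rle_trans (Cnorm_triangle _ _) _; apply: Rle_trans (exp_ge1 _).
  by rewrite Cnorm1; have := hd n; nlra.
apply: (Rle_trans _ _ _ h); apply: Rmult_le_compat_l; first exact: Cnorm_ge0.
have le : (C * (1 - r ^ n) / (1 - r) <= C / (1 - r))%R.
  apply: Rmult_le_compat_r; first by left; apply: Rinv_0_lt_compat; lra.
  by have p := @pow_ge0 r n ltac:(lra); nra.
by case: le => [/exp_increasing|->]; lra.
Qed.

(** For the running product u of the 1 + d n, the increments u n * d n form a series that is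
    geometrically dominated, since u is bounded. Stated in this form it covers both a q-Pochhammer
    symbol and its reciprocal. *)
Lemma geom_factor_cv (u d : nat -> CC) C r : (0 <= C)%R -> (0 <= r < 1)%R ->
  (forall n, u n.+1 = u n * (1 + d n)) -> (forall n, (Cnorm (d n) <= C * r ^ n)%R) ->
  exists l, Ccv u l.
Proof.
move=> C0 r01 hu hd; have hb := geom_factor_bound C0 r01 hu hd.
set B := (_ * exp _)%R in hb.
have B0 : (0 <= B)%R by apply: (Rle_trans _ _ _ _ (hb 0%N)); exact: Cnorm_ge0.
have [l hl] : exists l, Ccv (fun n => \sum_(i < n) (u i * d i)) l.
  apply: (@Ccv_series (fun i => u i * d i) (B * C)%R r) => // [|i]; first exact: Rmult_le_pos.
  rewrite Cnorm_mul Rmult_assoc; apply: Rmult_le_compat => //; exact: Cnorm_ge0.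
exists (u 0%N + l); apply: Ccv_ext (Ccv_add (Ccv_const (u 0%N)) hl).
by elim=> [|n IH]; rewrite ?big_ord0 ?addr0 // big_ord_recr /= addrA IH hu mulrDr mulr1.
Qed.

Lemma Ccv_pow0 (q : CC) : (Cnorm q < 1)%R -> Ccv (fun n => q ^+ n) 0.
Proof.
move=> hq; apply/CcvP => e e0.
have [K hK] := geom_small 1 (conj (Cnorm_ge0 q) hq) e0.
by exists K => n /hK; rewrite subr0 Cnorm_pow; nlra.
Qed.

Lemma inv_one_sub_bound (q x : CC) : (Cnorm q < 1)%R ->
  (forall i, 1 - q ^+ i * x != 0) -> exists2 B, (0 < B)%R &
  forall i, (Cnorm (1 - q ^+ i * x)^-1 <= B)%R.
Proof.
move=> hq hx.
have h1 : Ccv (fun i => 1 - q ^+ i * x) (1 - 0 * x).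
  by apply: Ccv_sub (Ccv_const _) (Ccv_mul (Ccv_pow0 hq) (Ccv_const _)).
rewrite mul0r subr0 in h1.
exact: Ccv_bounded (Ccv_inv (oner_neq0 _) h1).
Qed.

Lemma qpoch_inf_cv (q x : CC) : (Cnorm q < 1)%R -> Ccv (poch x q) (qpoch_inf x q).
Proof.
move=> hq; have q0 := Cnorm_ge0 q.
have [l hl] : exists l, Ccv (poch x q) l.
  apply: (@geom_factor_cv _ (fun n => - (q ^+ n * x)) (Cnorm x) (Cnorm q)) => //.
  - exact: Cnorm_ge0.
  - by move=> n; rewrite pochS.
  - by move=> n; rewrite Cnorm_opp Cnorm_mul Cnorm_pow; nlra.
suff -> : qpoch_inf x q = l by [].
by apply: Clim_eq; apply: Ccv_ext hl => n; rewrite -qpochE.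
Qed.

Lemma poch_bound (q x : CC) : (Cnorm q < 1)%R -> exists2 B, (0 < B)%R &
  forall n, (Cnorm (poch x q n) <= B)%R.
Proof. by move=> /(qpoch_inf_cv x) /Ccv_bounded. Qed.

(** 1/(1 - a) = 1 + a/(1 - a) exhibits the reciprocal as a product of the same kind. *)
Lemma poch_inv_cv (q x : CC) : (Cnorm q < 1)%R -> (forall i, 1 - q ^+ i * x != 0) ->
  exists l, Ccv (fun n => (poch x q n)^-1) l.
Proof.
move=> hq hx; have [B B0 hB] := inv_one_sub_bound hq hx.
have q0 := Cnorm_ge0 q; have x0 := Cnorm_ge0 x.
apply: (@geom_factor_cv _ (fun n => q ^+ n * x / (1 - q ^+ n * x)) (B * Cnorm x)%R (Cnorm q)) => //.
- by nnra.
- move=> n; rewrite pochS; have := hx n; have := @poch_neq0 _ _ _ n hx => h1 h2.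
  by field; rewrite h1 h2.
- move=> n; rewrite !Cnorm_mul Cnorm_pow; have := hB n.
  have := Cnorm_ge0 (1 - q ^+ n * x)^-1; have := @pow_ge0 (Cnorm q) n q0.
  move: (Cnorm q ^ n)%R (Cnorm _^-1) => a b a0 b0 bB.
  have : (0 <= a * Cnorm x)%R by apply: Rmult_le_pos.
  by move: (Cnorm x) x0 => c c0; nra.
Qed.

(** The partial products and their reciprocals both converge, and the product of the two limits is
    1. *)
Lemma qpoch_inf_neq0 (q x : CC) : (Cnorm q < 1)%R -> (forall i, 1 - q ^+ i * x != 0) ->
  qpoch_inf x q != 0.
Proof.
move=> hq hx; have [l hl] := poch_inv_cv hq hx.
have h1 := Ccv_mul (qpoch_inf_cv x hq) hl.
have h2 : Ccv (fun n => poch x q n * (poch x q n)^-1) 1.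
  by apply: Ccv_ext (Ccv_const 1) => n; rewrite divff // poch_neq0.
have := Ccv_unique h1 h2 => e; apply/eqP => e0; move: e; rewrite e0 mul0r => /eqP.
by rewrite eq_sym oner_eq0.
Qed.

Lemma poch_inv_bound (q x : CC) : (Cnorm q < 1)%R -> (forall i, 1 - q ^+ i * x != 0) ->
  exists2 B, (0 < B)%R & forall n, (Cnorm (poch x q n)^-1 <= B)%R.
Proof. by move=> hq /(poch_inv_cv hq)[l] /Ccv_bounded. Qed.

Lemma no_root1_norm (q : CC) : (Cnorm q < 1)%R -> no_root1 q.
Proof.
move=> hq n; rewrite subr_eq0; apply/eqP => e.
have : Cnorm (q ^+ n * q) = 1%R by rewrite -e Cnorm1.
rewrite -exprSr Cnorm_pow /= => h; have q0 := Cnorm_ge0 q.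
have : (0 <= Cnorm q ^ n <= 1)%R.
  split; first exact: pow_ge0.
  by rewrite -[X in (_ <= X)%R](pow1 n); apply: pow_incr; lra.
by move: (Cnorm q ^ n)%R h => a h [a0 a1]; nnra.
Qed.

(* [bsum N g] is the sum of [g] over [-N <= k < N]; [Bcv g L] says that the bilateral
   sum of [g] is [L]. *)
Definition bsum (N : nat) (g : int -> CC) := \sum_(i < N + N) g (i%:Z - N%:Z).
Definition Bcv (g : int -> CC) L := Ccv (fun N => bsum N g) L.

Lemma bsum_fold N g : bsum N g = \sum_(j < N) (g j%:Z + g (- j%:Z - 1)).
Proof.
rewrite /bsum big_split_ord /= addrC big_split /=; congr (_ + _).
  by apply: eq_bigr => i _; congr g; lia.
rewrite (reindex_inj rev_ord_inj) /=; apply: eq_bigr => i _; congr g.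
by have := ltn_ord i; lia.
Qed.

(** [tannery] after folding k = j with k = -j - 1; the two indices of a pair account for the doubled
    constant. *)
Lemma tannery_centered (F : nat -> int -> CC) (g : int -> CC) C r : (0 <= C)%R -> (0 <= r < 1)%R ->
  (forall (N i : nat), (i < N + N)%N ->
    (Cnorm (F N (i%:Z - N%:Z)%ring) <= C * r ^ (absz (i%:Z - N%:Z)%ring))%R) ->
  (forall k, Ccv (fun N => F N k) (g k)) ->
  exists2 L, Bcv g L & Ccv (fun N => bsum N (F N)) L.
Proof.
move=> C0 r01 hF hg.
have [||||L h1 h2] := @tannery (fun N j => F N j%:Z + F N (- j%:Z - 1)) (fun j => g j%:Z + g (- j%:Z - 1))
  (C * 2)%R r; rewrite ?/Bcv //.
- lra.
- move=> N j hj; apply: (Rle_trans _ _ _ (Cnorm_triangle _ _)).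
  have := hF N (N + j)%N ltac:(lia).
  have := hF N (N - j.+1)%N ltac:(lia).
  have -> : ((N + j)%N%:Z - N%:Z = j%:Z)%ring by lia.
  have -> : ((N - j.+1)%N%:Z - N%:Z = - j%:Z - 1)%ring by lia.
  have -> : absz (- j%:Z - 1) = j.+1 by lia.
  rewrite absz_nat /=; have p := @pow_ge0 r j ltac:(lra).
  have : (C * (r * r ^ j) <= C * r ^ j)%R by apply: Rmult_le_compat_l => //; nra.
  move: (C * (r * r ^ j))%R => t; rewrite Rmult_assoc (Rmult_comm 2); nlra.
- by move=> k; apply: Ccv_add.
exists L; first by apply: Ccv_ext h1 => N; rewrite bsum_fold.
by apply: Ccv_ext h2 => N; rewrite bsum_fold.
Qed.

(** * Watson's identity and the pentagonal number theorem as limits *)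

Lemma Cnorm_exp_sqr_le (q : CC) n : (Cnorm q < 1)%R -> (Cnorm (q ^+ (n * n)) <= Cnorm q ^ n)%R.
Proof.
move=> hq; have q0 := Cnorm_ge0 q; rewrite Cnorm_pow.
case: n => [|n]; first by rewrite /=; lra.
rewrite mulSn; move: (n * n.+1)%N => m; rewrite pow_add.
have h : (Cnorm q ^ m <= 1)%R.
  by rewrite -[X in (_ <= X)%R](pow1 m); apply: pow_incr; nlra.
have h' : (0 <= Cnorm q ^ n.+1)%R by exact: pow_ge0.
by move: (Cnorm q ^ n.+1)%R (Cnorm q ^ m)%R h h' => a b; nra.
Qed.

Lemma Cnorm_exp_le1 (q : CC) n : (Cnorm q < 1)%R -> (Cnorm (q ^+ n) <= 1)%R.
Proof.
move=> hq; have q0 := Cnorm_ge0 q; rewrite Cnorm_pow.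
by rewrite -[X in (_ <= X)%R](pow1 n); apply: pow_incr; nlra.
Qed.

Lemma Cnorm_sign n : Cnorm ((- 1) ^+ n) = 1%R.
Proof. by rewrite Cnorm_pow Cnorm_opp Cnorm1 pow1. Qed.

Lemma Rmult_le (a b c d : R) : (0 <= a -> 0 <= c -> a <= b -> c <= d -> a * c <= b * d)%R.
Proof. by move=> *; apply: Rmult_le_compat. Qed.

Lemma cvg_pred K : exists N : nat, forall n : nat, (N <= n)%N -> (K <= n.-1)%N.
Proof. by exists K.+1 => n; lia. Qed.

(** For fixed j both symbols in the denominator tend to (q)_oo, whence the square. The proof works
    with [N.-1] because [tannery] sums N terms where the Bailey lemma has N + 1. *)
Lemma bailey_limit (q : CC) (alpha : nat -> CC) B L : (Cnorm q < 1)%R -> (0 <= B)%R ->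
  (forall j, (Cnorm (alpha j) <= B)%R) ->
  Ccv (fun N => \sum_(j < N.+1) q ^+ (j * j) * alpha j / (poch q q (N - j) * poch q q (N + j))) L ->
  Ccv (fun N => \sum_(j < N) q ^+ (j * j) * alpha j) (qpoch_inf q q ^+ 2 * L).
Proof.
move=> hq B0 hB hL; have q0 := Cnorm_ge0 q.
have nz := no_root1_norm hq.
have [D D0 hD] := poch_inv_bound hq nz.
have Q0 := qpoch_inf_neq0 hq nz.
have [||||L' h1 h2] := @tannery (fun N j => q ^+ (j * j) * alpha j / (poch q q (N.-1 - j) * poch q q (N.-1 + j)))
  (fun j => q ^+ (j * j) * alpha j / (qpoch_inf q q * qpoch_inf q q)) (B * D * D)%R (Cnorm q) => //.
- by apply: Rmult_le_pos; nra.
- move=> n k _; rewrite invfM !Cnorm_mul.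
  have := hD (n.-1 - k)%N; have := hD (n.-1 + k)%N; have := hB k; have := Cnorm_exp_sqr_le k hq.
  have := Cnorm_ge0 (poch q q (n.-1 - k))^-1; have := Cnorm_ge0 (poch q q (n.-1 + k))^-1.
  have := Cnorm_ge0 (q ^+ (k * k)); have := Cnorm_ge0 (alpha k).
  move=> *; rewrite -Rmult_assoc (Rmult_comm (B * D * D)) -!Rmult_assoc.
  by do ?[apply: Rmult_le => //; do ?[apply: Rmult_le_pos => //]].
- move=> k; apply: Ccv_mul (Ccv_const _) _; apply: Ccv_inv; first by rewrite mulf_neq0.
  apply: Ccv_mul.
    apply: (@Ccv_comp (poch q q) _ (fun n => n.-1 - k)%N) (qpoch_inf_cv _ hq) => K.
    by exists (K + k).+1 => n; lia.
  apply: (@Ccv_comp (poch q q) _ (fun n => n.-1 + k)%N) (qpoch_inf_cv _ hq) => K.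
  by exists K.+1 => n; lia.
have e : L' = L.
  apply: Ccv_unique h2 _.
  by apply: (@Ccv_eventually _ _ _ 1%N _ (Ccv_comp (@cvg_pred) hL)) => -[|n].
rewrite -e; apply: Ccv_ext (Ccv_mul (Ccv_const (qpoch_inf q q ^+ 2)) h1) => n.
rewrite mulr_sumr; apply: eq_bigr => j _; field; exact: Q0.
Qed.

(** This is A(z; q) = 1 + z g(z; q). *)
Definition appell (z q : CC) : CC :=
  Csum (fun n => q ^+ (n * n) / (poch z q n.+1 * poch (q / z) q n)).

Lemma rank_alpha_bound (z q : CC) : (Cnorm q < 1)%R -> q != 0 -> z != 0 ->
  (forall i, 1 - q ^+ i * z != 0) -> (forall i, 1 - q ^+ i * (q / z) != 0) ->
  exists2 B, (0 <= B)%R & forall j, (Cnorm (rank_alpha z q j) <= B)%R.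
Proof.
move=> hq q0 z0 h1 h2.
have [B1 B10 hB1] := inv_one_sub_bound hq h1.
have [B2 B20 hB2] := inv_one_sub_bound hq h2.
have iz := Cnorm_ge0 z^-1.
exists (B1 + B1 + Cnorm z^-1 * B2)%R; first by nra.
case=> [|j].
  rewrite /rank_alpha; have := hB1 0%N; rewrite expr0 mul1r => h.
  by apply: (Rle_trans _ _ _ h); have := Cnorm_ge0 z^-1; nnra.
have e : q ^+ j.+1 - z = - z * (1 - q ^+ j * (q / z)).
  by rewrite exprSr; field.
rewrite /rank_alpha !Cnorm_mul Cnorm_sign Rmult_1_l.
have a1 := @Cnorm_exp_le1 q 'C(j.+1, 2) hq; have a10 := Cnorm_ge0 (q ^+ 'C(j.+1, 2)).
have a2 := @Cnorm_exp_le1 q j.+1 hq; have a20 := Cnorm_ge0 (q ^+ j.+1).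
have b1 := hB1 j.+1; have b10 := Cnorm_ge0 (1 - q ^+ j.+1 * z)^-1.
have b2 := hB2 j; have b20 := Cnorm_ge0 (1 - q ^+ j * (q / z))^-1.
have t := Cnorm_triangle (q ^+ j.+1 / (1 - q ^+ j.+1 * z)) (q ^+ j.+1 / (q ^+ j.+1 - z)).
rewrite !Cnorm_mul {2}e invfM Cnorm_mul invrN Cnorm_opp in t.
have t1 : (Cnorm (q ^+ j.+1) * Cnorm (1 - q ^+ j.+1 * z)^-1 <= 1 * B1)%R by apply: Rmult_le.
have t2 : (Cnorm z^-1 * Cnorm (1 - q ^+ j * (q / z))^-1 <= Cnorm z^-1 * B2)%R.
  by apply: Rmult_le => //; apply: Rle_refl.
have t20 : (0 <= Cnorm z^-1 * Cnorm (1 - q ^+ j * (q / z))^-1)%R by apply: Rmult_le_pos.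
have t3 : (Cnorm (q ^+ j.+1) * (Cnorm z^-1 * Cnorm (1 - q ^+ j * (q / z))^-1) <= 1 * (Cnorm z^-1 * B2))%R.
  by apply: Rmult_le.
rewrite -[X in (_ <= X)%R]Rmult_1_l; apply: Rmult_le => //; first exact: Cnorm_ge0.
by nlra.
Qed.

(** The left side of the finite identity tends to A / (q)_oo and the right side is handled by
    [bailey_limit], so one factor (q)_oo survives. *)
Lemma watson_limit (z q : CC) : (Cnorm q < 1)%R -> q != 0 -> z != 0 ->
  (forall i, 1 - q ^+ i * z != 0) -> (forall i, 1 - q ^+ i * (q / z) != 0) ->
  Ccv (fun N => \sum_(n < N) q ^+ (n * n) / (poch z q n.+1 * poch (q / z) q n)) (appell z q) /\
  Ccv (fun N => \sum_(j < N) q ^+ (j * j) * rank_alpha z q j) (qpoch_inf q q * appell z q).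
Proof.
move=> hq q0 z0 h1 h2; have q0' := Cnorm_ge0 q.
have nz := no_root1_norm hq.
have [D D0 hD] := poch_inv_bound hq nz.
have [D1 D10 hD1] := poch_inv_bound hq h1.
have [D2 D20 hD2] := poch_inv_bound hq h2.
have Q0 := qpoch_inf_neq0 hq nz.
have [||||L c1 c2] := @tannery (fun N n => q ^+ (n * n) / poch q q (N.-1 - n) / (poch z q n.+1 * poch (q / z) q n))
  (fun n => q ^+ (n * n) / qpoch_inf q q / (poch z q n.+1 * poch (q / z) q n)) (D * D1 * D2)%R (Cnorm q) => //.
- by apply: Rmult_le_pos; nra.
- move=> n k _; rewrite invfM !Cnorm_mul.
  have := hD (n.-1 - k)%N; have := hD1 k.+1; have := hD2 k; have := Cnorm_exp_sqr_le k hq.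
  have := Cnorm_ge0 (poch q q (n.-1 - k))^-1; have := Cnorm_ge0 (poch z q k.+1)^-1.
  have := Cnorm_ge0 (poch (q / z) q k)^-1; have := Cnorm_ge0 (q ^+ (k * k)).
  move=> *; rewrite -Rmult_assoc (Rmult_comm (D * D1 * D2)) -!Rmult_assoc.
  by do ?[apply: Rmult_le => //; do ?[apply: Rmult_le_pos => //]].
- move=> k; apply: Ccv_mul (Ccv_const _); apply: Ccv_mul (Ccv_const _) _; apply: Ccv_inv => //.
  apply: (@Ccv_comp (poch q q) _ (fun n => n.-1 - k)%N) (qpoch_inf_cv _ hq) => K.
  by exists (K + k).+1 => n; lia.
have hA : Ccv (fun N => \sum_(n < N) q ^+ (n * n) / (poch z q n.+1 * poch (q / z) q n))
   (qpoch_inf q q * L).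
  apply: Ccv_ext (Ccv_mul (Ccv_const (qpoch_inf q q)) c1) => n.
  rewrite mulr_sumr; apply: eq_bigr => j _; rewrite !mulrA; congr (_ / _).
  by rewrite mulrC mulKf.
have eA : appell z q = qpoch_inf q q * L by exact: Csum_eq.
rewrite eA; split => //.
have [B B0 hB] := rank_alpha_bound hq q0 z0 h1 h2.
rewrite mulrA -expr2; apply: (bailey_limit hq B0 hB).
have c3 : Ccv (fun N => \sum_(n < N.+1) q ^+ (n * n) / poch q q (N - n) / (poch z q n.+1 * poch (q / z) q n)) L.
  by apply: (@Ccv_comp _ _ (fun n => n.+1) _ c2) => K; exists K => n; lia.
by apply: Ccv_ext c3 => N; rewrite watson_finite.
Qed.

Lemma pentagonal_limit (q : CC) : (Cnorm q < 1)%R ->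
  Ccv (fun N => \sum_(j < N) q ^+ (j * j) * unit_alpha q j) (qpoch_inf q q).
Proof.
move=> hq; have nz := no_root1_norm hq; have Q0 := qpoch_inf_neq0 hq nz.
have hB j : (Cnorm (unit_alpha q j) <= 2)%R.
  case: j => [|j]; rewrite /unit_alpha; first by rewrite Cnorm1; lra.
  rewrite !Cnorm_mul Cnorm_sign Rmult_1_l -[X in (_ <= X)%R]Rmult_1_l.
  apply: Rmult_le; [exact: Cnorm_ge0|exact: Cnorm_ge0|exact: Cnorm_exp_le1|].
  have := Cnorm_triangle 1 (q ^+ j.+1); rewrite Cnorm1.
  by have := @Cnorm_exp_le1 q j.+1 hq; nlra.
have -> : qpoch_inf q q = qpoch_inf q q ^+ 2 * (qpoch_inf q q)^-1 by rewrite expr2 mulfK.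
apply: (bailey_limit hq _ hB); first lra.
by apply: Ccv_ext (Ccv_inv Q0 (qpoch_inf_cv q hq)) => N; rewrite pentagonal_finite.
Qed.

(** * Calculus of bilateral sums *)

Lemma Bcv_ext f g L : f =1 g -> Bcv f L -> Bcv g L.
Proof. by move=> e; apply: Ccv_ext => N; apply: eq_bigr => i _; rewrite e. Qed.

Lemma Bcv_scale c g L : Bcv g L -> Bcv (fun k => c * g k) (c * L).
Proof. by move=> h; apply: Ccv_ext (Ccv_mul (Ccv_const c) h) => N; rewrite mulr_sumr. Qed.

Lemma Bcv_sub f g L L' : Bcv f L -> Bcv g L' -> Bcv (fun k => f k - g k) (L - L').
Proof. by move=> h h'; apply: Ccv_ext (Ccv_sub h h') => N; rewrite -sumrB. Qed.

(** The range -N <= k < N is stable under k -> -k - 1, not under k -> -k. *)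
Lemma Bcv_reflect g L : Bcv g L -> Bcv (fun k => g (- k - 1)) L.
Proof.
apply: Ccv_ext => N; rewrite !bsum_fold; apply: eq_bigr => j _; rewrite addrC.
by congr (_ + g _); ring.
Qed.

Lemma sum_pairs (f : nat -> CC) N :
  \sum_(j < N + N) f j = \sum_(j < N) (f (2 * j)%N + f (2 * j).+1).
Proof.
elim: N => [|N IH]; first by rewrite !big_ord0.
by rewrite addnS addSn !big_ord_recr /= IH -addrA; congr (_ + (f _ + f _)); lia.
Qed.

(** The range -2N <= k < 2N consists exactly of the numbers 2j and 2j + 1 with -N <= j < N, so no
    boundary term appears. *)
Lemma Bcv_even_odd g A B L : Bcv g L -> Bcv (fun k => g (2%:Z * k)) A ->
  Bcv (fun k => g (2%:Z * k + 1)) B -> L = A + B.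
Proof.
move=> hg hA hB; apply: Ccv_unique (Ccv_add hA hB).
have h : Ccv (fun N => bsum (N + N)%N g) L.
  by apply: (@Ccv_comp _ _ (fun N => N + N)%N _ hg) => K; exists K => n; lia.
apply: Ccv_ext h => N; rewrite !bsum_fold (sum_pairs (fun j => g j%:Z + g (- j%:Z - 1))) -big_split /=; apply: eq_bigr => j _.
have -> : 2%:Z * (- j%:Z - 1) + 1 = - (2 * j)%N%:Z - 1 by lia.
have -> : 2%:Z * (- j%:Z - 1) = - (2 * j).+1%:Z - 1 by lia.
have -> : 2%:Z * j%:Z + 1 = (2 * j).+1%:Z by lia.
have -> : 2%:Z * j%:Z = (2 * j)%N%:Z by lia.
ring.
Qed.

(** Pairing j with -j for j <= N covers -N..N, one index more than [bsum N]; the extra term t N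
    tends to 0. *)
Lemma Bcv_of_nat (a : nat -> CC) (t : int -> CC) L : a 0%N = t 0 ->
  (forall j : nat, a j.+1 = t j.+1%:Z + t (- j.+1%:Z)) ->
  Ccv (fun N => t N%:Z) 0 -> Ccv (fun N => \sum_(j < N) a j) L -> Bcv t L.
Proof.
move=> a0 aS ht ha.
have h : Ccv (fun N => \sum_(j < N.+1) a j) L.
  by apply: (@Ccv_comp _ _ (fun N => N.+1) _ ha) => K; exists K => n; lia.
rewrite -(subr0 L); apply: Ccv_ext (Ccv_sub h ht) => N.
rewrite bsum_fold; apply/eqP; rewrite subr_eq; apply/eqP.
elim: N => [|N IH]; first by rewrite big_ord1 big_ord0 add0r.
rewrite big_ord_recr [in RHS]big_ord_recr /= IH aS.
have -> : - N.+1%:Z = - N%:Z - 1 by lia.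
ring.
Qed.

Lemma Cnorm_exp_le (s : CC) m n : (Cnorm s < 1)%R -> (n <= m)%N ->
  (Cnorm (s ^+ m) <= Cnorm s ^ n)%R.
Proof.
move=> hs nm; rewrite -(subnK nm) exprD Cnorm_mul (Cnorm_pow s n).
have := @Cnorm_exp_le1 s (m - n) hs; have := @pow_ge0 _ n (Cnorm_ge0 s).
by move: (Cnorm s ^ n)%R => a; nnra.
Qed.

Lemma Cnorm_expz_le (s : CC) (c : nat) (e k : int) : s != 0 -> (Cnorm s < 1)%R ->
  (`|k| <= e + c%:Z)%ring ->
  (Cnorm (s ^ e)%ring <= Cnorm (s ^- c)%ring * Cnorm s ^ (absz k))%R.
Proof.
move=> s0 hs he.
have -> : s ^ e = s ^- c * s ^+ (absz (e + c%:Z)).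
  by rewrite exprnN exprnP -expfzDr //; congr (_ ^ _); lia.
rewrite Cnorm_mul; apply: Rmult_le_compat_l; first exact: Cnorm_ge0.
by apply: Cnorm_exp_le => //; lia.
Qed.

Lemma expz_norm1 (s : CC) (n : int) : s != 0 -> (Cnorm s < 1)%R -> Cnorm (s ^ n) = 1%R -> n = 0.
Proof.
move=> s0 hs; have p0 := Cnorm_gt0 s0.
have key m : (Cnorm (s ^+ m.+1) < 1)%R.
  rewrite exprS Cnorm_mul; have := @Cnorm_exp_le1 s m hs; have := Cnorm_ge0 (s ^+ m).
  by nnra.
case: n => [[|n]|n] // h; exfalso; first by have := key n; rewrite /= in h; nlra.
have := key n; move: h; rewrite NegzE -exprnN Cnorm_inv ?expf_neq0 // => h.
have p := Cnorm_gt0 (expf_neq0 n.+1 s0).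
have := Rinv_l (Cnorm (s ^+ n.+1)) ltac:(nlra); rewrite h; nlra.
Qed.

(* [z] avoids the zeros [q^-k] of the theta function of base [q = s ^+ 2]. *)
Definition lattice_free (s z : CC) := forall k : int, 1 - s ^ (2%:Z * k) * z != 0.

Lemma lattice_free_nat (s z : CC) : lattice_free s z -> forall i, 1 - (s ^+ 2) ^+ i * z != 0.
Proof. by move=> h i; have := h i%:Z; rewrite -exprM. Qed.

Lemma lattice_free_inv (s z : CC) : s != 0 -> z != 0 ->
  lattice_free s z -> lattice_free s (s ^+ 2 / z).
Proof.
move=> s0 z0 h k; have := h (- k - 1); apply: contraNneq => /subr0_eq e.
have -> : s ^ (2%:Z * (- k - 1)) = (s ^ (2%:Z * k) * s ^+ 2)^-1.
  by rewrite exprnP -expfzDr // invr_expz; congr (_ ^ _); ring.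
rewrite mulrA in e; apply/eqP.
have -> : s ^ (2%:Z * k) * s ^+ 2 = z by rewrite -[z]mul1r e divfK.
by rewrite mulVf // subrr.
Qed.

Lemma lattice_free_inv_nat (s z : CC) : s != 0 -> z != 0 ->
  lattice_free s z -> forall i, 1 - (s ^+ 2) ^+ i * (s ^+ 2 / z) != 0.
Proof. by move=> s0 z0 h; apply: lattice_free_nat; apply: lattice_free_inv. Qed.

Lemma sqr_norm_lt1 (s : CC) : (Cnorm s < 1)%R -> (Cnorm (s ^+ 2) < 1)%R.
Proof. by move=> hs; rewrite Cnorm_pow /=; have := Cnorm_ge0 s; nnra. Qed.

(** For negative k, with a = s^(-2k), 1/(1 - z/a) = -(a/z) / (1 - a/z) brings back nonnegative
    powers of the base. *)
Lemma lattice_inv_bound (s z : CC) : s != 0 -> (Cnorm s < 1)%R -> z != 0 -> lattice_free s z ->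
  exists2 B, (0 < B)%R & forall k : int, (Cnorm (1 - s ^ (2%:Z * k)%ring * z)^-1 <= B)%R.
Proof.
move=> s0 hs z0 h; have hq := sqr_norm_lt1 hs.
have [B1 B10 hB1] := inv_one_sub_bound hq (lattice_free_nat h).
have [B2 B20 hB2] := inv_one_sub_bound hq (lattice_free_inv_nat s0 z0 h).
have iz := Cnorm_gt0 z0.
have iz' := Cnorm_ge0 z^-1.
exists (B1 + Cnorm z^-1 * B2)%R; first nnra.
case=> n.
  have := hB1 n; rewrite -exprM; rewrite [_ ^ (_ * n%:Z)](_ : _ = s ^+ (2 * n)) //.
  nnra.
have b := hB2 n.
have -> : (1 - s ^ (2%:Z * Negz n) * z)^-1 =
   - ((s ^+ 2) ^+ n.+1 * z^-1) * (1 - (s ^+ 2) ^+ n * (s ^+ 2 / z))^-1.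
  have -> : s ^ (2%:Z * Negz n) = ((s ^+ 2) ^+ n.+1)^-1.
    by rewrite -exprM exprnN; congr (_ ^ _); lia.
  have q0 : (s ^+ 2) ^+ n.+1 != 0 by rewrite !expf_neq0.
  have := lattice_free_inv_nat s0 z0 h n; rewrite mulrA -exprSr => q1.
  have q2 : z - (s ^+ 2) ^+ n.+1 != 0.
    by move: q1; apply: contraNneq => /subr0_eq <-; rewrite divff // subrr.
  have q3 : (s ^+ 2) ^+ n.+1 - z != 0 by rewrite -opprB oppr_eq0.
  by move: q0 q1 q2 q3; move: ((s ^+ 2) ^+ n.+1) => a *; field; do ?(apply/andP; split).
rewrite Cnorm_mul Cnorm_opp Cnorm_mul.
have a1 := @Cnorm_exp_le1 _ n.+1 hq.
have a2 : (Cnorm ((s ^+ 2) ^+ n.+1) * Cnorm z^-1 <= 1 * Cnorm z^-1)%R.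
  by apply: Rmult_le => //; [exact: Cnorm_ge0|exact: Rle_refl].
have a3 : (Cnorm ((s ^+ 2) ^+ n.+1) * Cnorm z^-1 * Cnorm (1 - (s ^+ 2) ^+ n * (s ^+ 2 / z))^-1
   <= 1 * Cnorm z^-1 * B2)%R.
  by apply: Rmult_le => //; [apply: Rmult_le_pos; exact: Cnorm_ge0|exact: Cnorm_ge0].
nlra.
Qed.

Definition appell_term (s z : CC) (k : int) : CC :=
  (- 1) ^ k * s ^ (3%:Z * k * k + k) / (1 - s ^ (2%:Z * k) * z).

Lemma Cnorm_signz (k : int) : Cnorm ((- 1) ^ k) = 1%R.
Proof.
case: k => n; first by rewrite -exprnP Cnorm_sign.
by rewrite NegzE -exprnN invr_sign Cnorm_sign.
Qed.

Lemma Ccv_geom0 (u : nat -> CC) C r : (0 <= r < 1)%R -> (forall n, (Cnorm (u n) <= C * r ^ n)%R) -> Ccv u 0.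
Proof.
move=> r01 h; apply/CcvP => e e0; have [K hK] := geom_small C r01 e0.
by exists K => n /hK; rewrite subr0; have := h n; nlra.
Qed.

Lemma pentagonal_exponent_bound (s : CC) (k : int) : s != 0 -> (Cnorm s < 1)%R ->
  (Cnorm ((- 1) ^ k * s ^ (3%:Z * k * k + k))%ring <= 1 * Cnorm s ^ (absz k))%R.
Proof.
move=> s0 hs; rewrite Cnorm_mul Cnorm_signz; apply: Rmult_le_compat_l; first lra.
have := @Cnorm_expz_le s 0 (3%:Z * k * k + k) k s0 hs.
rewrite expr0 invr1 Cnorm1 Rmult_1_l; apply; nia.
Qed.

Lemma appell_term_bound (s z : CC) : s != 0 -> (Cnorm s < 1)%R -> z != 0 -> lattice_free s z ->
  exists2 C, (0 <= C)%R & forall k, (Cnorm (appell_term s z k) <= C * Cnorm s ^ (absz k))%R.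
Proof.
move=> s0 hs z0 h; have [B B0 hB] := lattice_inv_bound s0 hs z0 h.
exists B => [|k]; first lra.
rewrite /appell_term Cnorm_mul Rmult_comm; apply: Rmult_le => //; try exact: Cnorm_ge0.
by have := pentagonal_exponent_bound k s0 hs; lra.
Qed.

Lemma exp_bin2 (s : CC) j : (s ^+ 2) ^+ 'C(j.+1, 2) = s ^ (j.+1%:Z * j%:Z).
Proof.
rewrite -exprM exprnP; congr (_ ^ _).
by have := bin_ffact j.+1 2; rewrite !ffactnS ffactn0 muln1 (_ : 2`! = 2%N) //; nia.
Qed.

(** The second fraction of [rank_alpha] is the term of index -j, since 1/(1 - q^(-j) z) = q^j / (q^j
    - z). *)
Lemma appell_bilateral (s z : CC) : s != 0 -> (Cnorm s < 1)%R -> z != 0 -> lattice_free s z ->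
  Bcv (appell_term s z) (qpoch_inf (s ^+ 2) (s ^+ 2) * appell z (s ^+ 2)).
Proof.
move=> s0 hs z0 h; have hq := sqr_norm_lt1 hs.
have q0 : s ^+ 2 != 0 by rewrite expf_neq0.
have [_ hW] := watson_limit hq q0 z0 (lattice_free_nat h) (lattice_free_inv_nat s0 z0 h).
have [C C0 hC] := appell_term_bound s0 hs z0 h.
apply: (@Bcv_of_nat (fun j => (s ^+ 2) ^+ (j * j) * rank_alpha z (s ^+ 2) j) _ _ _ _ _ hW).
- by rewrite /appell_term /= !mulr0 addr0 !expr0z !mul1r.
- move=> j; rewrite /appell_term /rank_alpha exp_bin2.
  have -> : (- 1) ^ (- j.+1%:Z) = (- 1) ^+ j.+1 :> CC by rewrite -exprnN invr_sign.
  rewrite -exprnP.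
  have e1 : s ^ (2%:Z * j.+1%:Z) = (s ^+ 2) ^+ j.+1 by rewrite -exprM.
  have e2 : s ^ (2%:Z * - j.+1%:Z) = ((s ^+ 2) ^+ j.+1)^-1.
    by rewrite -exprM exprnN; congr (_ ^ _); ring.
  rewrite e1 e2.
  have -> : s ^ (3%:Z * j.+1%:Z * j.+1%:Z + j.+1%:Z) =
     (s ^+ 2) ^+ (j.+1 * j.+1) * s ^ (j.+1%:Z * j%:Z) * (s ^+ 2) ^+ j.+1.
    by rewrite -!exprM !exprnP -!expfzDr //; congr (_ ^ _); lia.
  have -> : s ^ (3%:Z * - j.+1%:Z * - j.+1%:Z + - j.+1%:Z) =
     (s ^+ 2) ^+ (j.+1 * j.+1) * s ^ (j.+1%:Z * j%:Z).
    by rewrite -!exprM !exprnP -!expfzDr //; congr (_ ^ _); lia.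
  have := lattice_free_nat h j.+1.
  have := lattice_free_inv_nat s0 z0 h j; rewrite mulrA -exprSr => q1.
  have q2 : (s ^+ 2) ^+ j.+1 != 0 by rewrite !expf_neq0.
  have q3 : (s ^+ 2) ^+ j.+1 - z != 0.
    by move: q1; apply: contraNneq => /subr0_eq ->; rewrite divff // subrr.
  move: q2 q3; move: ((s ^+ 2) ^+ j.+1) (s ^ _) ((-1) ^+ _) ((s ^+ 2) ^+ (_ * _)) => a b c d q2 q3 q4.
  have -> : (1 - a^-1 * z) = (a - z) / a by field.
  by field; rewrite q2 q3 q4.
- by apply: (@Ccv_geom0 _ C (Cnorm s)) => [|n]; [split => //; exact: Cnorm_ge0|exact: hC].
Qed.

Lemma pentagonal_bilateral (s : CC) : s != 0 -> (Cnorm s < 1)%R ->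
  Bcv (fun k => (- 1) ^ k * s ^ (3%:Z * k * k + k)) (qpoch_inf (s ^+ 2) (s ^+ 2)).
Proof.
move=> s0 hs; have hq := sqr_norm_lt1 hs.
apply: (@Bcv_of_nat (fun j => (s ^+ 2) ^+ (j * j) * unit_alpha (s ^+ 2) j) _ _ _ _ _
  (pentagonal_limit hq)).
- by rewrite /= !mulr0 addr0 !expr0z !mul1r.
- move=> j; rewrite /unit_alpha exp_bin2.
  have -> : (- 1) ^ (- j.+1%:Z) = (- 1) ^+ j.+1 :> CC by rewrite -exprnN invr_sign.
  rewrite -exprnP.
  have -> : s ^ (3%:Z * j.+1%:Z * j.+1%:Z + j.+1%:Z) =
     (s ^+ 2) ^+ (j.+1 * j.+1) * s ^ (j.+1%:Z * j%:Z) * (s ^+ 2) ^+ j.+1.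
    by rewrite -!exprM !exprnP -!expfzDr //; congr (_ ^ _); lia.
  have -> : s ^ (3%:Z * - j.+1%:Z * - j.+1%:Z + - j.+1%:Z) =
     (s ^+ 2) ^+ (j.+1 * j.+1) * s ^ (j.+1%:Z * j%:Z).
    by rewrite -!exprM !exprnP -!expfzDr //; congr (_ ^ _); lia.
  ring.
- apply: (@Ccv_geom0 _ 1 (Cnorm s)) => [|n]; first by split => //; exact: Cnorm_ge0.
  exact: pentagonal_exponent_bound.
Qed.

(** * The dissection of the Appell sum *)

Definition theta_inf (x q : CC) : CC := qpoch_inf x q * qpoch_inf (q / x) q.

Lemma qpoch_inf_cv_comp (q x : CC) (phi : nat -> nat) : (Cnorm q < 1)%R ->
  (forall K, exists N : nat, forall n : nat, (N <= n)%N -> (K <= phi n)%N) ->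
  Ccv (fun n => poch x q (phi n)) (qpoch_inf x q).
Proof. by move=> hq hphi; apply: (Ccv_comp hphi (qpoch_inf_cv x hq)). Qed.

(** Limit of the contribution of one family of poles. The reciprocals of [theta_den] are uniformly
    bounded, so the decay of a alone dominates the sum. *)
Lemma family_limit (q x1 x2 : CC) (a : int -> CC) C r :
  (Cnorm q < 1)%R -> (0 <= C)%R -> (0 <= r < 1)%R ->
  (forall i, 1 - q ^+ i * x1 != 0) -> (forall i, 1 - q ^+ i * (q / x1) != 0) ->
  (forall i, 1 - q ^+ i * x2 != 0) -> (forall i, 1 - q ^+ i * (q / x2) != 0) ->
  (forall k, (Cnorm (a k) <= C * r ^ (absz k))%R) ->
  exists2 L, Bcv a L &
    Ccv (fun N => \sum_(i < N + N) a (i%:Z - N%:Z) / theta_den q x1 x2 (N + N) i)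
      (L / (qpoch_inf q q ^+ 2 * (theta_inf x1 q * theta_inf x2 q))).
Proof.
move=> hq C0 r01 h1 h1' h2 h2' ha.
have nz := no_root1_norm hq.
have [B B0 hB] := poch_inv_bound hq nz.
have [B1 B10 hB1] := poch_inv_bound hq h1.
have [B1' B10' hB1'] := poch_inv_bound hq h1'.
have [B2 B20 hB2] := poch_inv_bound hq h2.
have [B2' B20' hB2'] := poch_inv_bound hq h2'.
have Q0 := qpoch_inf_neq0 hq nz.
have Q1 := qpoch_inf_neq0 hq h1; have Q1' := qpoch_inf_neq0 hq h1'.
have Q2 := qpoch_inf_neq0 hq h2; have Q2' := qpoch_inf_neq0 hq h2'.
pose D := qpoch_inf q q ^+ 2 * (theta_inf x1 q * theta_inf x2 q).
have D0 : D != 0 by rewrite /D /theta_inf !mulf_neq0 // expf_neq0.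
have bound n i : (Cnorm (theta_den q x1 x2 n i)^-1 <= (B * B) * (B1' * B1) * (B2' * B2))%R.
  rewrite /theta_den !invfM !Cnorm_mul.
  by do ?[apply: Rmult_le => //; do ?[apply: Rmult_le_pos; do ?exact: Cnorm_ge0]; do ?exact: Cnorm_ge0].
(* [absz (N%:Z + k)] recovers the index i = N + k on the range of summation; its values outside that
   range are never summed. *)
have lim k : Ccv (fun N => theta_den q x1 x2 (N + N) (absz (N%:Z + k))) D.
  have -> : D = qpoch_inf q q * qpoch_inf q q * (qpoch_inf (q / x1) q * qpoch_inf x1 q)
     * (qpoch_inf (q / x2) q * qpoch_inf x2 q) by rewrite /D /theta_inf; ring.
  by do ?apply: Ccv_mul; apply: qpoch_inf_cv_comp => // K; exists (K + absz k + 1)%N => n; lia.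
have BB : (0 <= (B * B) * (B1' * B1) * (B2' * B2))%R.
  by do ?apply: Rmult_le_pos; lra.
have [||||L h h'] := @tannery_centered
  (fun N k => a k / theta_den q x1 x2 (N + N) (absz (N%:Z + k))) (fun k => a k / D)
  (C * ((B * B) * (B1' * B1) * (B2' * B2)))%R r => //.
- exact: Rmult_le_pos.
- move=> N i _; rewrite Cnorm_mul.
  have -> : (C * (B * B * (B1' * B1) * (B2' * B2)) * r ^ absz (i%:Z - N%:Z)%ring =
     (C * r ^ absz (i%:Z - N%:Z)%ring) * (B * B * (B1' * B1) * (B2' * B2)))%R by Rring.
  by apply: Rmult_le => //; exact: Cnorm_ge0.
- by move=> k; apply: Ccv_mul (Ccv_const _) (Ccv_inv D0 (lim k)).
exists (D * L).
  by apply: Bcv_ext (Bcv_scale D h) => k; rewrite mulrC divfK.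
rewrite -/D mulrC mulKf //; apply: Ccv_ext h' => N; apply: eq_bigr => i _.
by congr (_ / theta_den _ _ _ _ _); lia.
Qed.

Lemma two_neq0 : 2%:R != 0 :> CC.
Proof. by apply/eqP => -[]; lra. Qed.

Lemma sqrt_opp_neq0 (s o : CC) : s != 0 -> o ^+ 2 = - s ^+ 2 -> o != 0.
Proof.
move=> s0; apply: contra_eq_neq => ->; rewrite expr0n /= eq_sym oppr_eq0.
by rewrite expf_neq0.
Qed.

(** Otherwise s^(4k+2) = -1 would have norm 1, but 4k + 2 is never 0. *)
Lemma lattice_free_odd (s o : CC) : s != 0 -> (Cnorm s < 1)%R -> o ^+ 2 = - s ^+ 2 -> lattice_free s o.
Proof.
move=> s0 hs ho k; rewrite subr_eq0; apply/eqP => e.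
have := expz_norm1 (n := 4%:Z * k + 2%:Z) s0 hs; suff h : Cnorm (s ^ (4%:Z * k + 2%:Z)) = 1%R.
  by move=> /(_ h); lia.
have -> : s ^ (4%:Z * k + 2%:Z) = - (s ^ (2%:Z * k) * o) ^+ 2.
  rewrite exprMn ho mulrN opprK expfzDr // -exprnP; congr (_ * _).
  by rewrite exprnP exprz_exp; congr (_ ^ _); ring.
by rewrite -e expr1n Cnorm_opp Cnorm1.
Qed.

Lemma lattice_free_m1 (s : CC) : s != 0 -> (Cnorm s < 1)%R -> lattice_free s (- 1).
Proof.
move=> s0 hs k; rewrite mulrN1 opprK; apply/eqP => e.
have e' : s ^ (2%:Z * k) = - 1 by apply/eqP; rewrite -addr_eq0 addrC e.
have := expz_norm1 (n := 2%:Z * k) s0 hs; rewrite e' Cnorm_opp Cnorm1 => /(_ erefl) k0.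
move: e; rewrite k0 expr0z => /eqP; exact/negP/two_neq0.
Qed.

Lemma lattice_free_invr (s z : CC) : s != 0 -> z != 0 ->
  lattice_free s z -> lattice_free s (1 / z).
Proof.
move=> s0 z0 h k; have := lattice_free_inv s0 z0 h (k - 1).
have -> : s ^ (2%:Z * k) = s ^ (2%:Z * (k - 1)) * s ^+ 2.
  by rewrite exprnP -expfzDr //; congr (_ ^ _); ring.
by rewrite mul1r -mulrA.
Qed.

(* The contribution of the poles [1 / (o q^k)]; the even and the odd [k] produce the
   two Appell sums of base [q ^ 4]. *)
Definition half_term (s o Z : CC) (k : int) : CC :=
  o ^ k * s ^ (3%:Z * k * k + 3%:Z * k) / (1 - s ^ (2%:Z * k) * (o * Z)).

Lemma half_term_bound (s o Z : CC) : s != 0 -> (Cnorm s < 1)%R -> Z != 0 -> o ^+ 2 = - s ^+ 2 ->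
  lattice_free s (o * Z) ->
  exists2 C, (0 <= C)%R & forall k, (Cnorm (half_term s o Z k) <= C * Cnorm s ^ (absz k))%R.
Proof.
move=> s0 hs Z0 ho h.
have o0 := sqrt_opp_neq0 s0 ho.
have [B B0 hB] := lattice_inv_bound s0 hs (mulf_neq0 o0 Z0) h.
have no : Cnorm o = Cnorm s.
  have : Cnorm (o ^+ 2) = Cnorm (s ^+ 2) by rewrite ho Cnorm_opp.
  rewrite !Cnorm_pow /= => e; have := Cnorm_ge0 o; have := Cnorm_gt0 s0; nnra.
have noz k : Cnorm (o ^ k) = Cnorm (s ^ k).
  case: k => n; first by rewrite -!exprnP !Cnorm_pow no.
  by rewrite NegzE -!exprnN !Cnorm_inv ?expf_neq0 // !Cnorm_pow no.
(* As |o| = |s|, the effective exponent is 3k^2 + 4k. Its value -1 at k = -1 forces the offset 2. *)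
exists (Cnorm (s ^- 2) * B)%R => [|k]; first by apply: Rmult_le_pos; [exact: Cnorm_ge0|lra].
rewrite /half_term Cnorm_mul.
have -> : Cnorm (o ^ k * s ^ (3%:Z * k * k + 3%:Z * k)) = Cnorm (s ^ (3%:Z * k * k + 4%:Z * k)).
  rewrite Cnorm_mul noz -Cnorm_mul -expfzDr //; congr (Cnorm (_ ^ _)); ring.
rewrite Rmult_assoc (Rmult_comm B) -Rmult_assoc; apply: Rmult_le => //; try exact: Cnorm_ge0.
by apply: Cnorm_expz_le => //; nia.
Qed.

(** Only the sum over the poles q^-k is identified here. A and B stay abstract because only their
    difference can be expressed by Appell sums. *)
Lemma theta3_limit (s o Z : CC) : s != 0 -> (Cnorm s < 1)%R -> Z != 0 -> o ^+ 2 = - s ^+ 2 ->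
  lattice_free s Z -> lattice_free s (o * Z) -> lattice_free s (- o * Z) ->
  let q := s ^+ 2 in
  exists A B, [/\ Bcv (half_term s o Z) A, Bcv (half_term s (- o) Z) B &
   (theta_inf Z q * theta_inf (o * Z) q * theta_inf (- o * Z) q)^-1 =
    qpoch_inf q q * appell Z q / (qpoch_inf q q ^+ 2 * (theta_inf o q * theta_inf (- o) q)) +
    A / (qpoch_inf q q ^+ 2 * (theta_inf (1 / o) q * theta_inf (- o / o) q)) +
    B / (qpoch_inf q q ^+ 2 * (theta_inf (1 / - o) q * theta_inf (o / - o) q))].
Proof.
move=> s0 hs Z0 ho hZ hoZ hoZ' q.
have ho' : (- o) ^+ 2 = - s ^+ 2 by rewrite sqrrN.
have o0 := sqrt_opp_neq0 s0 ho.
have o0' : - o != 0 by rewrite oppr_eq0.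
have hq : (Cnorm q < 1)%R by exact: sqr_norm_lt1.
have q0 : q != 0 by rewrite expf_neq0.
have nz := no_root1_norm hq.
have fo := lattice_free_odd s0 hs ho; have fo' := lattice_free_odd s0 hs ho'.
have fi := lattice_free_invr s0 o0 fo; have fi' := lattice_free_invr s0 o0' fo'.
have fm := lattice_free_m1 s0 hs.
have i0 (x : CC) : x != 0 -> 1 / x != 0 by move=> x0; rewrite mul1r invr_eq0.
have moo : - o / o = - 1 by rewrite mulNr divff.
have moo' : o / - o = - 1 by rewrite invrN mulrN divff.
have m10 : (- 1 : CC) != 0 by rewrite oppr_eq0 oner_eq0.
have r01 : (0 <= Cnorm s < 1)%R by split => //; exact: Cnorm_ge0.
have N1 x : x != 0 -> lattice_free s x -> (forall i, 1 - q ^+ i * x != 0).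
  by move=> _; exact: lattice_free_nat.
have N2 x : x != 0 -> lattice_free s x -> (forall i, 1 - q ^+ i * (q / x) != 0).
  by move=> x0; exact: lattice_free_inv_nat.
have [C1 C10 b1] := appell_term_bound s0 hs Z0 hZ.
have [C2 C20 b2] := half_term_bound s0 hs Z0 ho hoZ.
have [C3 C30 b3] := half_term_bound s0 hs Z0 ho' hoZ'.
have [S hS cS] := family_limit hq C10 r01 (N1 _ o0 fo) (N2 _ o0 fo) (N1 _ o0' fo') (N2 _ o0' fo') b1.
have [A hA cA] := family_limit hq C20 r01 (N1 _ (i0 _ o0) fi) (N2 _ (i0 _ o0) fi)
   (N1 _ m10 fm) (N2 _ m10 fm) b2.
have [B hB cB] := family_limit hq C30 r01 (N1 _ (i0 _ o0') fi') (N2 _ (i0 _ o0') fi')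
   (N1 _ m10 fm) (N2 _ m10 fm) b3.
exists A, B; split => //.
have eS : S = qpoch_inf q q * appell Z q by apply: Ccv_unique hS (appell_bilateral s0 hs Z0 hZ).
rewrite -eS moo moo'.
have nzz x : x != 0 -> lattice_free s x -> theta_inf x q != 0.
  by move=> x0 hx; rewrite mulf_neq0 // qpoch_inf_neq0 //; [exact: N1|exact: N2].
have tcv x : Ccv (fun N => theta_trunc x q N) (theta_inf x q).
  by apply: Ccv_mul; exact: qpoch_inf_cv.
have L1 : Ccv (fun N => (theta_trunc Z q N * theta_trunc (o * Z) q N * theta_trunc (- o * Z) q N)^-1)
  (theta_inf Z q * theta_inf (o * Z) q * theta_inf (- o * Z) q)^-1.
  have oZ := mulf_neq0 o0 Z0; have oZ' := mulf_neq0 o0' Z0.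
  apply: Ccv_inv; first by apply: mulf_neq0; [apply: mulf_neq0|]; exact: nzz.
  by apply: Ccv_mul => //; apply: Ccv_mul.
apply: Ccv_unique L1 _.
apply: (@Ccv_eventually _ _ _ 1%N _ (Ccv_add (Ccv_add cS cA) cB)) => N hN.
rewrite theta3_partial_fractions ?two_neq0 // -!big_split /=; apply: eq_bigr => i _.
by rewrite moo moo' /appell_term /half_term !invfM !mulrA.
Qed.

Lemma qpoch_inf_shift (x q : CC) : (Cnorm q < 1)%R ->
  qpoch_inf x q = (1 - x) * qpoch_inf (q * x) q.
Proof.
move=> hq; have h1 : Ccv (fun n => poch x q n.+1) (qpoch_inf x q).
  by apply: qpoch_inf_cv_comp => // K; exists K => n; lia.
have h2 := Ccv_mul (Ccv_const (1 - x)) (qpoch_inf_cv (q * x) hq).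
by apply: Ccv_unique h1 _; apply: Ccv_ext h2 => n; rewrite pochSl.
Qed.

Lemma qpoch_inf_pm (x q : CC) : (Cnorm q < 1)%R ->
  qpoch_inf x q * qpoch_inf (- x) q = qpoch_inf (x ^+ 2) (q ^+ 2).
Proof.
move=> hq; have hq2 := sqr_norm_lt1 hq.
apply: Ccv_unique (qpoch_inf_cv _ hq2).
apply: Ccv_ext (Ccv_mul (qpoch_inf_cv x hq) (qpoch_inf_cv (- x) hq)) => n.
rewrite -big_split /=; apply: eq_bigr => i _; rewrite exprAC; ring.
Qed.

Lemma poch_even_odd (F : fieldType) (x q : F) n :
  poch x q (n + n) = poch x (q ^+ 2) n * poch (q * x) (q ^+ 2) n.
Proof.
elim: n => [|n IH]; first by rewrite !poch0 mulr1.
rewrite addnS addSn 2!pochS IH !pochS -!exprM.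
have -> : (q ^+ (n + n).+1 = q ^+ (2 * n) * q) by rewrite -exprSr; congr (_ ^+ _); lia.
have -> : (n + n = 2 * n)%N by lia.
by ring.
Qed.

Lemma qpoch_inf_even_odd (x q : CC) : (Cnorm q < 1)%R ->
  qpoch_inf x q = qpoch_inf x (q ^+ 2) * qpoch_inf (q * x) (q ^+ 2).
Proof.
move=> hq; have hq2 := sqr_norm_lt1 hq.
have h1 : Ccv (fun n => poch x q (n + n)) (qpoch_inf x q).
  by apply: qpoch_inf_cv_comp => // K; exists K => n; lia.
apply: Ccv_unique h1 _.
apply: Ccv_ext (Ccv_mul (qpoch_inf_cv x hq2) (qpoch_inf_cv (q * x) hq2)) => n.
by rewrite poch_even_odd.
Qed.

Lemma Csqrt_exists (q : CC) : exists s : CC, s ^+ 2 = q.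
Proof.
case: q => a b; set q := mkC a b.
have n0 := Cnorm_ge0 q; have nq := Cnorm_sqr q; rewrite /= in nq.
have na : (Rabs a <= Cnorm q)%R by exact: (Re_le_Cnorm q).
have := Rle_abs a; have := Rle_abs (- a); rewrite Rabs_Ropp => ha ha'.
have h1 := sqrt_sqrt ((Cnorm q + a) / 2) ltac:(lra).
have h2 := sqrt_sqrt ((Cnorm q - a) / 2) ltac:(lra).
have p1 := sqrt_pos ((Cnorm q + a) / 2); have p2 := sqrt_pos ((Cnorm q - a) / 2).
move: h1 h2 p1 p2; set u := sqrt ((Cnorm q + a) / 2); set v := sqrt ((Cnorm q - a) / 2).
move=> h1 h2 p1 p2.
have huv : (Rsqr (2 * (u * v)) = Rsqr b)%R.
  rewrite /Rsqr; have -> : (2 * (u * v) * (2 * (u * v)) = 4 * (u * u) * (v * v))%R by Rring.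
  by rewrite h1 h2; lra.
have puv : (0 <= 2 * (u * v))%R by have := Rmult_le_pos _ _ p1 p2; lra.
case: (Rle_lt_dec 0 b) => hb.
  have e := Rsqr_inj _ _ puv hb huv.
  by exists (mkC u v); rewrite expr2; apply: CC_eq => /=; lra.
rewrite (Rsqr_neg b) in huv.
have e : (2 * (u * v) = - b)%R by apply: Rsqr_inj => //; lra.
by exists (mkC u (- v)); rewrite expr2; apply: CC_eq => /=; lra.
Qed.

Lemma invr_signz (u : int) : ((- 1) ^ u)^-1 = (- 1) ^ u :> CC.
Proof. by case: u => n; rewrite ?NegzE -?exprnP -?exprnN ?invr_sign. Qed.

Section HalfTerms.
Variables (s o Z : CC).
Hypotheses (s0 : s != 0) (Z0 : Z != 0) (ho : o ^+ 2 = - s ^+ 2).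
Hypotheses (hoZ : lattice_free s (o * Z)) (hoZ' : lattice_free s (- o * Z)).

Let o0 : o != 0 := sqrt_opp_neq0 s0 ho.

Lemma odd_pole_neq0 (k : int) : 1 + s ^ (4%:Z * k + 2%:Z) * Z ^+ 2 != 0.
Proof.
have -> : 1 + s ^ (4%:Z * k + 2%:Z) * Z ^+ 2 =
  (1 - s ^ (2%:Z * k) * (o * Z)) * (1 - s ^ (2%:Z * k) * (- o * Z)).
  have -> : s ^ (4%:Z * k + 2%:Z) = s ^ (2%:Z * k) * s ^ (2%:Z * k) * s ^+ 2.
    by rewrite exprnP -!expfzDr //; congr (_ ^ _); ring.
  rewrite -[s ^+ 2]opprK -ho; ring.
by rewrite mulf_neq0.
Qed.

(** With q = s^2 and y = (q^4)^u (-q Z^2), the difference over o and -o is a multiple of y / (1 - y)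
    = 1/(1 - y) - 1, which separates an Appell term of base q^4 from a pentagonal term. *)
Lemma half_term_even u : half_term s o Z (2%:Z * u) - half_term s (- o) Z (2%:Z * u) =
  2%:R * o / (s ^+ 2 * Z) * ((- 1) ^ u * (s ^+ 4) ^ (3%:Z * u * u + u) -
     appell_term (s ^+ 4) (- s ^+ 2 * Z ^+ 2) u).
Proof.
rewrite /half_term /appell_term.
have e1 : o ^ (2%:Z * u) = (- 1) ^ u * s ^ (2%:Z * u).
  by rewrite -!exprz_exp -!exprnP ho -(mulN1r (s ^+ 2)) expfzMl.
have -> : (- o) ^ (2%:Z * u) = o ^ (2%:Z * u) by rewrite -!exprz_exp -!exprnP sqrrN.
have p1 := hoZ (2%:Z * u); have p2 := hoZ' (2%:Z * u); have := odd_pole_neq0 (2%:Z * u).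
have e2 : s ^ (4%:Z * (2%:Z * u) + 2%:Z) =
   s ^ (2%:Z * (2%:Z * u)) * s ^ (2%:Z * (2%:Z * u)) * s ^+ 2.
  by rewrite exprnP -!expfzDr //; congr (_ ^ _); ring.
rewrite e1 e2.
have -> : (s ^+ 4) ^ (2%:Z * u) = s ^ (2%:Z * (2%:Z * u)) * s ^ (2%:Z * (2%:Z * u)).
  by rewrite exprnP exprz_exp -!expfzDr //; congr (_ ^ _); ring.
have -> : s ^ (3%:Z * (2%:Z * u) * (2%:Z * u) + 3%:Z * (2%:Z * u)) =
   (s ^+ 4) ^ (3%:Z * u * u + u) * s ^ (2%:Z * u).
  by rewrite exprnP exprz_exp -!expfzDr //; congr (_ ^ _); ring.
have e3 : s ^ (2%:Z * (2%:Z * u)) = s ^ (2%:Z * u) * s ^ (2%:Z * u).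
  by rewrite -!expfzDr //; congr (_ ^ _); ring.
move: p1 p2; rewrite e3; move: (s ^ (2%:Z * u)) ((-1) ^ u) ((s ^+ 4) ^ _) => a b c p1 p2 p3.
have -> : 1 - a * a * (a * a) * (- s ^+ 2 * Z ^+ 2) = 1 + a * a * (a * a) * s ^+ 2 * Z ^+ 2 by ring.
have e : 1 + a * a * (a * a) * s ^+ 2 * Z ^+ 2 = (1 - a * a * (o * Z)) * (1 - a * a * (- o * Z)).
  by rewrite -[s ^+ 2]opprK -ho; ring.
transitivity (b * c * (2%:R * (a * a) * (a * a) * o * Z) / (1 + a * a * (a * a) * s ^+ 2 * Z ^+ 2)).
  by rewrite e; field; rewrite p1 p2.
by field; rewrite p3 Z0 s0.
Qed.

(** The odd index is written -2u - 1: this reversal turns the denominator, up to a monomial, into 1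
    - (q^4)^u (-q / Z^2), so the same kind of Appell term appears at the inverse argument. *)
Lemma half_term_odd u :
  half_term s o Z (2%:Z * (- u - 1) + 1) - half_term s (- o) Z (2%:Z * (- u - 1) + 1) =
  - (2%:R * o / s ^+ 2) * ((- 1) ^ u * (s ^+ 4) ^ (3%:Z * u * u + u) -
     appell_term (s ^+ 4) (- s ^+ 2 / Z ^+ 2) u).
Proof.
set k := 2%:Z * (- u - 1) + 1.
have o0' : - o != 0 by rewrite oppr_eq0.
have expo (c : CC) : c != 0 -> c ^+ 2 = - s ^+ 2 -> c ^ k = - ((- 1) ^ u * (s ^ (2%:Z * u))^-1 * c / s ^+ 2).
  move=> c0 hc.
  have -> : c ^ k = (c ^ (2%:Z * u))^-1 * c^-1.
    by rewrite invr_expz -[c^-1]/(c ^ (- 1)) -expfzDr //; congr (_ ^ _); rewrite /k; ring.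
  have -> : c ^ (2%:Z * u) = (- 1) ^ u * s ^ (2%:Z * u).
    by rewrite -!exprz_exp -!exprnP hc -(mulN1r (s ^+ 2)) expfzMl.
  have -> : c^-1 = - c / s ^+ 2 by rewrite -[s ^+ 2]opprK -hc invrN mulrNN expr2 invfM mulrA divff // mul1r.
  by rewrite invfM invr_signz; ring.
rewrite /half_term (expo o) // (expo (- o)) ?sqrrN // /appell_term.
have p1 := hoZ k; have p2 := hoZ' k; have := odd_pole_neq0 k.
have e2 : s ^ (4%:Z * k + 2%:Z) = s ^ (2%:Z * k) * s ^ (2%:Z * k) * s ^+ 2.
  by rewrite exprnP -!expfzDr //; congr (_ ^ _); ring.
rewrite e2.
have -> : (s ^+ 4) ^ (2%:Z * u) = (s ^ (2%:Z * k) * s ^ (2%:Z * k) * s ^+ 4)^-1.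
  rewrite exprnP exprz_exp -!expfzDr // invr_expz; congr (_ ^ _); rewrite /k; ring.
have -> : s ^ (3%:Z * k * k + 3%:Z * k) =
   (s ^+ 4) ^ (3%:Z * u * u + u) * s ^ (2%:Z * u).
  by rewrite exprnP exprz_exp -!expfzDr //; congr (_ ^ _); rewrite /k; ring.
have a0 : s ^ (2%:Z * u) != 0 by rewrite expfz_neq0.
have b0 : s ^ (2%:Z * k) != 0 by rewrite expfz_neq0.
move: p1 p2 a0 b0; move: (s ^ (2%:Z * k)) (s ^ (2%:Z * u)) ((-1) ^ u) ((s ^+ 4) ^ _) => a d b c p1 p2 d0 a0 p3.
have e : 1 + a * a * s ^+ 2 * Z ^+ 2 = (1 - a * (o * Z)) * (1 - a * (- o * Z)).
  by rewrite -[s ^+ 2]opprK -ho; ring.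
transitivity (- (b * c * (2%:R * o / s ^+ 2) / (1 + a * a * s ^+ 2 * Z ^+ 2))).
  by rewrite e; field; rewrite p1 p2 d0 s0.
have -> : 1 - (a * a * s ^+ 4)^-1 * (- s ^+ 2 / Z ^+ 2) =
  (1 + a * a * s ^+ 2 * Z ^+ 2) / (a * a * s ^+ 2 * Z ^+ 2) by field; rewrite a0 s0 Z0.
by field; rewrite p3 Z0 s0 a0.
Qed.

End HalfTerms.

(** The pentagonal terms sum to (q^4; q^4)_oo, and the Appell terms carry the same factor by
    Watson's identity; hence the common factor [Q4] and the differences 1 - A. *)
Lemma half_terms_limit (s o Z A B : CC) : s != 0 -> (Cnorm s < 1)%R -> Z != 0 ->
  o ^+ 2 = - s ^+ 2 -> lattice_free s (o * Z) -> lattice_free s (- o * Z) ->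
  Bcv (half_term s o Z) A -> Bcv (half_term s (- o) Z) B ->
  let q := s ^+ 2 in let Q4 := qpoch_inf (q ^+ 4) (q ^+ 4) in
  A - B = 2%:R * o / q * Q4 *
    ((1 - appell (- q * Z ^+ 2) (q ^+ 4)) / Z - (1 - appell (- q / Z ^+ 2) (q ^+ 4))).
Proof.
move=> s0 hs Z0 ho hoZ hoZ' hA hB q Q4.
have q0 : q != 0 by rewrite expf_neq0.
have s4 : s ^+ 4 != 0 by rewrite expf_neq0.
have hs4 : (Cnorm (s ^+ 4) < 1)%R.
  by rewrite (exprM s 2 2); do 2 apply: sqr_norm_lt1.
have eq4 : (s ^+ 4) ^+ 2 = q ^+ 4 by rewrite -!exprM.
have hp := pentagonal_bilateral s4 hs4; rewrite eq4 in hp.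
have pole k := odd_pole_neq0 s0 ho hoZ hoZ' k.
have w1 : - q * Z ^+ 2 != 0 by rewrite mulf_neq0 ?oppr_eq0 ?expf_neq0.
have w2 : - q / Z ^+ 2 != 0 by rewrite mulf_neq0 ?oppr_eq0 ?invr_eq0 ?expf_neq0.
have f1 : lattice_free (s ^+ 4) (- q * Z ^+ 2).
  move=> k; have := pole (2%:Z * k).
  have -> : (s ^+ 4) ^ (2%:Z * k) * (- q * Z ^+ 2) = - (s ^ (4%:Z * (2%:Z * k) + 2%:Z) * Z ^+ 2).
    rewrite mulNr mulrN (mulrA _ q); congr (- (_ * _)).
    by rewrite /q !exprnP exprz_exp -!expfzDr //; congr (_ ^ _); ring.
  by rewrite opprK.
have f2 : lattice_free (s ^+ 4) (- q / Z ^+ 2).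
  move=> k; have := pole (- (2%:Z * k) - 1).
  have -> : s ^ (4%:Z * (- (2%:Z * k) - 1) + 2%:Z) = ((s ^+ 4) ^ (2%:Z * k) * q)^-1.
    by rewrite /q !exprnP exprz_exp -!expfzDr // invr_expz; congr (_ ^ _); ring.
  have a0 : (s ^+ 4) ^ (2%:Z * k) != 0 by rewrite expfz_neq0.
  move: a0; move: (_ ^ (2%:Z * k)) => a a0 p; apply/eqP => e.
  case/eqP: p; have -> : 1 + (a * q)^-1 * Z ^+ 2 = (1 - a * (- q / Z ^+ 2)) * (Z ^+ 2 / (a * q)).
    by field; rewrite a0 q0 Z0.
  by rewrite e mul0r.
have a1 := appell_bilateral s4 hs4 w1 f1; have a2 := appell_bilateral s4 hs4 w2 f2.
rewrite !eq4 in a1 a2.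
have d := Bcv_sub hA hB.
have dE : Bcv (fun u => half_term s o Z (2%:Z * u) - half_term s (- o) Z (2%:Z * u))
   (2%:R * o / (q * Z) * (Q4 - Q4 * appell (- q * Z ^+ 2) (q ^+ 4))).
  by apply: Bcv_ext (Bcv_scale _ (Bcv_sub hp a1)) => u; rewrite half_term_even.
have dO : Bcv (fun u => half_term s o Z (2%:Z * u + 1) - half_term s (- o) Z (2%:Z * u + 1))
   (- (2%:R * o / q) * (Q4 - Q4 * appell (- q / Z ^+ 2) (q ^+ 4))).
  apply: Bcv_ext (Bcv_reflect (Bcv_scale (- (2%:R * o / q)) (Bcv_sub hp a2))) => u.
  rewrite -half_term_odd //.
  by have -> : - (- u - 1) - 1 = u by ring.
rewrite (Bcv_even_odd d dE dO); field; by rewrite Z0 q0.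
Qed.

Lemma theta_inf_neq0 (s x : CC) : s != 0 -> (Cnorm s < 1)%R -> x != 0 ->
  lattice_free s x -> theta_inf x (s ^+ 2) != 0.
Proof.
move=> s0 hs x0 h; rewrite mulf_neq0 // qpoch_inf_neq0 //; do ?exact: sqr_norm_lt1.
  exact: lattice_free_nat.
exact: lattice_free_inv_nat.
Qed.

(** [theta3_limit] solved for A(Z; q). The constants independent of Z are theta values at o, 1/o and
    -1; they combine so that the coefficients of both Appell functions of base q^4 carry no infinite
    product. *)
Lemma appell_dissection (s o Z : CC) : s != 0 -> (Cnorm s < 1)%R -> Z != 0 ->
  o ^+ 2 = - s ^+ 2 ->
  lattice_free s Z -> lattice_free s (o * Z) -> lattice_free s (- o * Z) ->
  let q := s ^+ 2 in
  appell Z q = qpoch_inf q q * theta_inf (- q) (q ^+ 2) /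
       (theta_inf Z q * theta_inf (- q * Z ^+ 2) (q ^+ 2)) +
    (appell (- q * Z ^+ 2) (q ^+ 4) - 1) / Z - (appell (- q / Z ^+ 2) (q ^+ 4) - 1).
Proof.
move=> s0 hs Z0 ho hZ hoZ hoZ' q.
have [A [B [hA hB]]] := theta3_limit s0 hs Z0 ho hZ hoZ hoZ'.
have := half_terms_limit s0 hs Z0 ho hoZ hoZ' hA hB; rewrite -/q; cbv zeta => eAB e.
have q0 : q != 0 by rewrite expf_neq0.
have o0 := sqrt_opp_neq0 s0 ho.
have oq : o ^+ 2 = - q by [].
have o0' : - o != 0 by rewrite oppr_eq0.
have hq : (Cnorm q < 1)%R by exact: sqr_norm_lt1.
have hq2 : (Cnorm (q ^+ 2) < 1)%R by exact: sqr_norm_lt1.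
have fo := lattice_free_odd s0 hs ho.
have fo' := lattice_free_odd s0 hs (_ : (- o) ^+ 2 = - s ^+ 2).
have {}fo' : lattice_free s (- o) by apply: fo'; rewrite sqrrN.
have nz := no_root1_norm hq.
have Q0 := qpoch_inf_neq0 hq nz.
have qo : q / o = - o by rewrite -[q]opprK -oq mulNr expr2 mulfK.
have qo' : q / - o = o by rewrite invrN mulrN qo opprK.
have k1 := qpoch_inf_neq0 hq (lattice_free_nat fo).
have k2 := qpoch_inf_neq0 hq (lattice_free_nat fo').
have ko : qpoch_inf o q * qpoch_inf (- o) q = qpoch_inf (- q) (q ^+ 2) by rewrite qpoch_inf_pm // oq.
have o1 : 1 - o != 0 by have := fo 0; rewrite mulr0 expr0z mul1r.
have o1' : 1 + o != 0 by have := fo' 0; rewrite mulr0 expr0z mul1r opprK.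
have t1 : theta_inf o q = qpoch_inf (- q) (q ^+ 2) by rewrite /theta_inf qo ko.
have t2 : theta_inf (- o) q = qpoch_inf (- q) (q ^+ 2) by rewrite /theta_inf qo' mulrC ko.
(* The minus sign and the division by c make the values at 1/o and -1/o opposite, which is why A - B
   is what enters. *)
have shift (c : CC) : c != 0 -> 1 - c != 0 -> c ^+ 2 = - q -> q / c = - c ->
  theta_inf (1 / c) q = - (qpoch_inf c q * qpoch_inf (- c) q / c).
  move=> c0 c1 hc qc; rewrite /theta_inf (qpoch_inf_shift (1 / c) hq).
  have -> : q * (1 / c) = - c by rewrite mulrA mulr1 qc.
  have -> : q / (1 / c) = q * c by rewrite mul1r invrK.
  rewrite (qpoch_inf_shift c hq); field; exact: c0.
have t3 := shift o o0 o1 oq qo; rewrite ko in t3.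
have := shift (- o) o0'; rewrite opprK sqrrN => /(_ o1' oq qo') t4.
rewrite (mulrC (qpoch_inf (- o) q)) ko in t4.
have moo : - o / o = - 1 by rewrite mulNr divff.
have moo' : o / - o = - 1 by rewrite invrN mulrN divff.
have T : theta_inf (- 1) q = 2%:R * qpoch_inf (- q) q ^+ 2.
  rewrite /theta_inf (qpoch_inf_shift (- 1) hq) invrN1 !mulrN1; ring.
have K0 : qpoch_inf (- q) (q ^+ 2) != 0 by rewrite -ko mulf_neq0.
(* Follows by splitting (q^4; q^4)_oo = (q)_oo (-q)_oo (-q^2; q^2)_oo and merging (-q; q^2)_oo with
   (-q^2; q^2)_oo. *)
have Q4 : qpoch_inf (- q) (q ^+ 2) * qpoch_inf (q ^+ 4) (q ^+ 4) = qpoch_inf (- q) q ^+ 2 * qpoch_inf q q.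
  have e1 := qpoch_inf_even_odd (- q) hq.
  have e2 := qpoch_inf_pm q hq.
  have e3 := qpoch_inf_pm (q ^+ 2) hq2; rewrite -(exprM q 2 2) in e3.
  rewrite -e3 -e2 (expr2 (qpoch_inf _ _)) {2}e1 mulrN -expr2; ring.
have M0 : qpoch_inf (- q) q != 0.
  apply: (qpoch_inf_neq0 hq) => i; have := lattice_free_m1 s0 hs (i%:Z + 1).
  have -> : s ^ (2%:Z * (i%:Z + 1)) = q ^+ i * q.
    by rewrite -exprSr -exprM exprnP; congr (_ ^ _); lia.
  by rewrite !mulrN1 mulrN.
have Th : theta_inf (o * Z) q * theta_inf (- o * Z) q = theta_inf (- q * Z ^+ 2) (q ^+ 2).
  rewrite /theta_inf mulrACA mulNr qpoch_inf_pm // (exprMn _ o Z) oq; congr (_ * _).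
  by rewrite invrN mulrN qpoch_inf_pm // expr_div_n (exprMn _ o Z) oq.
have ThN : theta_inf (- q) (q ^+ 2) = qpoch_inf (- q) (q ^+ 2) ^+ 2.
  rewrite /theta_inf (expr2 (qpoch_inf _ _)); congr (_ * qpoch_inf _ _).
  by rewrite invrN mulrN (expr2 q) mulfK.
have ThZ := theta_inf_neq0 s0 hs Z0 hZ.
have ThoZ := theta_inf_neq0 s0 hs (mulf_neq0 o0 Z0) hoZ.
have ThoZ' := theta_inf_neq0 s0 hs (mulf_neq0 o0' Z0) hoZ'.
move: e; rewrite -/q moo moo' t1 t2 t3 t4 T -mulrA Th.
have ThZ2 : theta_inf (- q * Z ^+ 2) (q ^+ 2) != 0 by rewrite -Th mulf_neq0.
rewrite ThN; move: eAB Q4; rewrite -/q in ThZ.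
move: (appell Z q) (appell (- q * Z ^+ 2) _) (appell (- q / Z ^+ 2) _) => a a1 a2.
move: ThZ ThZ2 K0 Q0 M0.
move: (theta_inf Z q) (theta_inf (- q * Z ^+ 2) _) (qpoch_inf (- q) (q ^+ 2)) (qpoch_inf q q)
  (qpoch_inf (- q) q) (qpoch_inf (q ^+ 4) _) => t t' K Q M P t0 t0' K0 Q0 M0 eAB eP e.
have two := two_neq0.
have {}e : a = Q * K ^+ 2 / (t * t') + K * o * (A - B) / (2%:R * M ^+ 2 * Q).
  have e' : Q * a / (Q ^+ 2 * (K * K)) = (t * t')^-1 - A / (Q ^+ 2 * (- (K / o) * (2%:R * M ^+ 2)))
    - B / (Q ^+ 2 * (- (K / - o) * (2%:R * M ^+ 2))) by rewrite e; ring.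
  transitivity (Q * K ^+ 2 * (Q * a / (Q ^+ 2 * (K * K)))); first by field; rewrite K0 Q0.
  by rewrite e'; field; rewrite !oppr_eq0 two t0 t0' K0 Q0 M0 o0.
rewrite e eAB.
have -> : P = M ^+ 2 * Q / K by rewrite -eP mulrC mulKf.
have -> : q = - (o ^+ 2) by rewrite oq opprK.
by field; rewrite Z0 t0' t0 Q0 M0 two K0 oppr_eq0 expf_neq0.
Qed.

(** * Theta functions *)

(** Limit of [jacobi_finite] by dominated convergence. The majorant of the terms is left to the
    caller, as it depends on the size of x relative to s. *)
Lemma jacobi_triple_product (s x : CC) C r : s != 0 -> (Cnorm s < 1)%R -> x != 0 ->
  (0 <= C)%R -> (0 <= r < 1)%R ->
  (forall k : int, (Cnorm ((- x) ^ k * s ^ (k * k - k))%ring <= C * r ^ (absz k))%R) ->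
  Bcv (fun k => (- x) ^ k * s ^ (k * k - k)) (jtheta x (s ^+ 2)).
Proof.
move=> s0 hs x0 C0 r01 hb.
set q := s ^+ 2; have hq : (Cnorm q < 1)%R by exact: sqr_norm_lt1.
have nz := no_root1_norm hq.
have [B B0 hB] := poch_inv_bound hq nz.
have [D D0 hD] := poch_bound q hq.
have Q0 := qpoch_inf_neq0 hq nz.
have [|||L h h'] := @tannery_centered
  (fun N k => (- x) ^ k * s ^ (k * k - k) * (poch q q (N + N).-1 /
    (poch q q (absz (N%:Z + k)) * poch q q (N + N - (absz (N%:Z + k)).+1))))
  (fun k => (- x) ^ k * s ^ (k * k - k) * (qpoch_inf q q / (qpoch_inf q q * qpoch_inf q q)))
  (C * (D * (B * B)))%R r _ r01.
- by do ?apply: Rmult_le_pos => //; lra.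
- move=> N i _; rewrite Cnorm_mul.
  have -> : (C * (D * (B * B)) * r ^ absz (i%:Z - N%:Z)%ring =
     (C * r ^ absz (i%:Z - N%:Z)%ring) * (D * (B * B)))%R by Rring.
  apply: Rmult_le => //; try exact: Cnorm_ge0.
  rewrite Cnorm_mul invfM Cnorm_mul.
  by do ?[apply: Rmult_le => //; try exact: Cnorm_ge0]; apply: Rmult_le_pos; exact: Cnorm_ge0.
- move=> k; apply: Ccv_mul (Ccv_const _) _; apply: Ccv_mul.
    by apply: qpoch_inf_cv_comp => // K; exists K.+1 => n; lia.
  apply: Ccv_inv; first by rewrite mulf_neq0.
  by apply: Ccv_mul; apply: qpoch_inf_cv_comp => // K; exists (K + absz k + 1)%N => n; lia.
have e : L = theta_inf x q.
  have h2 : Ccv (fun N => poch (q / x) q N * poch x q N.-1) (qpoch_inf (q / x) q * qpoch_inf x q).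
    by apply: Ccv_mul; apply: qpoch_inf_cv_comp => // K; exists K.+1 => n; lia.
  rewrite /theta_inf mulrC; apply: Ccv_unique h' _.
  apply: (@Ccv_eventually _ _ _ 1%N _ h2) => N hN; rewrite jacobi_finite //.
  apply: eq_bigr => i _; cbv zeta; congr (_ * (_ / (poch _ _ _ * poch _ _ (_ - _)))); lia.
have -> : jtheta x q = qpoch_inf q q * L by rewrite e mulrC.
apply: Bcv_ext (Bcv_scale (qpoch_inf q q) h) => k.
by field; rewrite Q0.
Qed.

Lemma theta_exponent_bound (q c : CC) (e : int -> int) : q != 0 -> (Cnorm q < 1)%R ->
  Cnorm c = 1%R -> (forall k : int, (`|k| <= e k + 1)%ring) ->
  forall k : int, (Cnorm (c ^ k * q ^ (e k))%ring <= Cnorm (q ^- 1)%ring * Cnorm q ^ (absz k))%R.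
Proof.
move=> q0 hq c1 he k; rewrite Cnorm_mul.
have c0 : c != 0 by apply/eqP => e0; rewrite e0 Cnorm0 in c1; lra.
have -> : Cnorm (c ^ k) = 1%R.
  case: k => n; first by rewrite -exprnP Cnorm_pow c1 pow1.
  by rewrite NegzE -exprnN Cnorm_inv ?expf_neq0 // Cnorm_pow c1 pow1 Rinv_1.
by rewrite Rmult_1_l; exact: Cnorm_expz_le.
Qed.

(** For x a signed power of q: c carries the sign and e the exponent. The offset 1 in the bound on e
    is attained by 4k^2 + 4k at k = -1. *)
Lemma theta_power_series (q c x s : CC) (e : int -> int) : q != 0 -> (Cnorm q < 1)%R ->
  Cnorm c = 1%R -> s != 0 -> (Cnorm s < 1)%R -> x != 0 ->
  (forall k : int, (`|k| <= e k + 1)%ring) ->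
  (forall k, (- x) ^ k * s ^ (k * k - k) = c ^ k * q ^ (e k)) ->
  Bcv (fun k => c ^ k * q ^ (e k)) (jtheta x (s ^+ 2)).
Proof.
move=> q0 hq c1 s0 hs x0 he heq.
apply: Bcv_ext (@jacobi_triple_product s x (Cnorm (q ^- 1)) (Cnorm q) s0 hs x0 _ _ _) => //.
- exact: Cnorm_ge0.
- by split => //; exact: Cnorm_ge0.
- by move=> k; rewrite heq; apply: theta_exponent_bound.
Qed.

Lemma exp_norm_lt1 (q : CC) n : (Cnorm q < 1)%R -> (Cnorm (q ^+ n.+1) < 1)%R.
Proof.
move=> hq; rewrite exprS Cnorm_mul; have := @Cnorm_exp_le1 q n hq.
have := Cnorm_ge0 q; have := Cnorm_ge0 (q ^+ n); nnra.
Qed.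

Lemma jtheta_sym (x q : CC) : x != 0 -> q != 0 -> jtheta (q / x) q = jtheta x q.
Proof.
move=> x0 q0; have e : q / (q / x) = x by field; rewrite x0 q0.
change (theta_inf (q / x) q * qpoch_inf q q = theta_inf x q * qpoch_inf q q).
by rewrite /theta_inf e (mulrC (qpoch_inf (q / x) q)).
Qed.

Lemma expfzMsign (q : CC) (n : nat) (k : int) : q != 0 -> (- (q ^+ n)) ^ k = (- 1) ^ k * q ^ (n%:Z * k).
Proof. by move=> q0; rewrite -(mulN1r (q ^+ n)) expfzMl exprnP exprz_exp. Qed.

Lemma signz_even (k : int) : (- 1) ^ (2%:Z * k) = 1 :> CC.
Proof. by rewrite -exprz_exp -exprnP sqrrN expr1n exp1rz. Qed.

Lemma signz_odd (k : int) : (- 1) ^ (2%:Z * k + 1) = - 1 :> CC.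
Proof. by rewrite expfzDr ?oppr_eq0 ?oner_eq0 // signz_even mul1r expr1z. Qed.

(** The even and the odd indices of the series of (-1)^k q^(k^2); an odd index 2k + 1 contributes -q
    times q^(4k^2 + 4k). *)
Lemma theta_split_2 (q : CC) : q != 0 -> (Cnorm q < 1)%R ->
  jtheta q (q ^+ 2) = jtheta (- q ^+ 4) (q ^+ 8) - q * jtheta (- 1) (q ^+ 8).
Proof.
move=> q0 hq.
have q4 : q ^+ 4 != 0 by rewrite expf_neq0.
have q8 : q ^+ 8 != 0 by rewrite expf_neq0.
have h1 : Bcv (fun k => (- 1) ^ k * q ^ (k * k)) (jtheta q (q ^+ 2)).
  apply: (theta_power_series (e := fun k => k * k)) => // [|k|k].
  - by rewrite Cnorm_opp Cnorm1.
  - nia.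
  - have := expfzMsign 1 k q0; rewrite expr1 => ->.
    by rewrite -mulrA -expfzDr //; congr (_ * _ ^ _); ring.
have h2 : Bcv (fun k => 1 ^ k * q ^ (4%:Z * k * k)) (jtheta (- q ^+ 4) (q ^+ 8)).
  have -> : q ^+ 8 = (q ^+ 4) ^+ 2 by rewrite -exprM.
  apply: (theta_power_series (e := fun k => 4%:Z * k * k)) => // [|||k|k].
  - by rewrite Cnorm1.
  - exact: exp_norm_lt1.
  - by rewrite oppr_eq0.
  - nia.
  - rewrite opprK exp1rz mul1r !exprnP !exprz_exp -expfzDr //; congr (_ ^ _); ring.
have h3 : Bcv (fun k => 1 ^ k * q ^ (4%:Z * k * k + 4%:Z * k)) (jtheta (- 1) (q ^+ 8)).
  (* At -1 the series would have exponents 4k^2 - 4k; the symmetric form at -q^8 has the 4k^2 + 4k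
     that the odd indices produce. *)
  have -> : jtheta (- 1) (q ^+ 8) = jtheta (- q ^+ 8) (q ^+ 8).
    rewrite -(jtheta_sym _ q8) ?oppr_eq0 ?oner_eq0 //; congr jtheta.
    by rewrite invrN1 mulrN1.
  have -> : q ^+ 8 = (q ^+ 4) ^+ 2 by rewrite -exprM.
  apply: (theta_power_series (e := fun k => 4%:Z * k * k + 4%:Z * k)) => // [|||k|k].
  - by rewrite Cnorm1.
  - exact: exp_norm_lt1.
  - by rewrite oppr_eq0 expf_neq0.
  - nia.
  - rewrite opprK exp1rz mul1r -exprM !exprnP !exprz_exp -expfzDr //; congr (_ ^ _); ring.
rewrite (Bcv_even_odd h1 (A := jtheta (- q ^+ 4) (q ^+ 8)) (B := - q * jtheta (- 1) (q ^+ 8))).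
- by rewrite mulNr.
- apply: Bcv_ext h2 => k; rewrite exp1rz mul1r signz_even mul1r.
  by congr (_ ^ _); ring.
- apply: Bcv_ext (Bcv_scale (- q) h3) => k.
  rewrite exp1rz mul1r signz_odd mulN1r mulNr; congr (- _).
  by rewrite -[X in X * _]expr1z -expfzDr //; congr (_ ^ _); ring.
Qed.

Lemma theta_split_4 (q : CC) : q != 0 -> (Cnorm q < 1)%R ->
  jtheta q (q ^+ 4) = jtheta (- q ^+ 6) (q ^+ 16) - q * jtheta (- q ^+ 14) (q ^+ 16).
Proof.
move=> q0 hq.
have h1 : Bcv (fun k => (- 1) ^ k * q ^ (2%:Z * k * k - k)) (jtheta q (q ^+ 4)).
  have -> : q ^+ 4 = (q ^+ 2) ^+ 2 by rewrite -exprM.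
  apply: (theta_power_series (e := fun k => 2%:Z * k * k - k)) => // [|||k|k].
  - by rewrite Cnorm_opp Cnorm1.
  - by rewrite expf_neq0.
  - exact: exp_norm_lt1.
  - nia.
  - have := expfzMsign 1 k q0; rewrite expr1 => ->.
    by rewrite exprnP exprz_exp -mulrA -expfzDr //; congr (_ * _ ^ _); ring.
have h2 : Bcv (fun k => 1 ^ k * q ^ (8%:Z * k * k - 2%:Z * k)) (jtheta (- q ^+ 6) (q ^+ 16)).
  have -> : q ^+ 16 = (q ^+ 8) ^+ 2 by rewrite -exprM.
  apply: (theta_power_series (e := fun k => 8%:Z * k * k - 2%:Z * k)) => // [||||k|k].
  - by rewrite Cnorm1.
  - by rewrite expf_neq0.
  - exact: exp_norm_lt1.
  - by rewrite oppr_eq0 expf_neq0.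
  - nia.
  - rewrite opprK exp1rz mul1r !exprnP !exprz_exp -expfzDr //; congr (_ ^ _); ring.
have h3 : Bcv (fun k => 1 ^ k * q ^ (8%:Z * k * k + 6%:Z * k)) (jtheta (- q ^+ 14) (q ^+ 16)).
  have -> : q ^+ 16 = (q ^+ 8) ^+ 2 by rewrite -exprM.
  apply: (theta_power_series (e := fun k => 8%:Z * k * k + 6%:Z * k)) => // [||||k|k].
  - by rewrite Cnorm1.
  - by rewrite expf_neq0.
  - exact: exp_norm_lt1.
  - by rewrite oppr_eq0 expf_neq0.
  - nia.
  - rewrite opprK exp1rz mul1r !exprnP !exprz_exp -expfzDr //; congr (_ ^ _); ring.
rewrite (Bcv_even_odd h1 (A := jtheta (- q ^+ 6) (q ^+ 16)) (B := - q * jtheta (- q ^+ 14) (q ^+ 16))).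
- by rewrite mulNr.
- apply: Bcv_ext h2 => k; rewrite exp1rz mul1r signz_even mul1r.
  by congr (_ ^ _); ring.
- apply: Bcv_ext (Bcv_scale (- q) h3) => k.
  rewrite exp1rz mul1r signz_odd mulN1r mulNr; congr (- _).
  by rewrite -[X in X * _]expr1z -expfzDr //; congr (_ ^ _); ring.
Qed.

(** * Product identities for the theta quotients *)

Lemma jthetaE (x q : CC) : jtheta x q = theta_inf x q * qpoch_inf q q.
Proof. by []. Qed.

Lemma poch_mod3 (F : fieldType) (x q : F) n :
  poch x q (n + n + n) = poch x (q ^+ 3) n * poch (q * x) (q ^+ 3) n * poch (q ^+ 2 * x) (q ^+ 3) n.
Proof.
elim: n => [|n IH]; first by rewrite !poch0 !mulr1.
rewrite !addnS !addSn 3!pochS IH !pochS -!exprM.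
have -> : (n + n + n = 3 * n)%N by lia.
by rewrite (exprSr q (3 * n).+1) !(exprSr q (3 * n)); ring.
Qed.

Lemma qpoch_inf_mod3 (x q : CC) : (Cnorm q < 1)%R -> qpoch_inf x q =
  qpoch_inf x (q ^+ 3) * qpoch_inf (q * x) (q ^+ 3) * qpoch_inf (q ^+ 2 * x) (q ^+ 3).
Proof.
move=> hq; have hq3 : (Cnorm (q ^+ 3) < 1)%R by exact: exp_norm_lt1.
have h1 : Ccv (fun n => poch x q (n + n + n)) (qpoch_inf x q).
  by apply: qpoch_inf_cv_comp => // K; exists K => n; lia.
apply: Ccv_unique h1 _.
apply: Ccv_ext (Ccv_mul (Ccv_mul (qpoch_inf_cv x hq3) (qpoch_inf_cv (q * x) hq3))
  (qpoch_inf_cv (q ^+ 2 * x) hq3)) => n.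
by rewrite poch_mod3.
Qed.

(** J_4 is a theta product of base q^12; its three symbols are the residue classes modulo 3 of (q^4;
    q^4)_oo. *)
Lemma Jm_4 (q : CC) : q != 0 -> (Cnorm q < 1)%R -> Jm q 4 = qpoch_inf (q ^+ 4) (q ^+ 4).
Proof.
move=> q0 hq; rewrite /Jm /Jam !CpowE jthetaE /theta_inf.
rewrite (qpoch_inf_mod3 _ (exp_norm_lt1 3 hq)).
have -> : q ^+ 4 * q ^+ 4 = q ^+ 8 by rewrite -exprD.
have -> : (q ^+ 4) ^+ 2 * q ^+ 4 = q ^+ 12 by rewrite -exprM -exprD.
have -> : (q ^+ 4) ^+ 3 = q ^+ 12 by rewrite -exprM.
have -> : q ^+ (3 * 4) / q ^+ 4 = q ^+ 8 by rewrite (exprD q 8 4) mulfK // expf_neq0.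
by [].
Qed.

Section Products.
Variables (q : CC).
Hypotheses (q0 : q != 0) (hq : (Cnorm q < 1)%R).

Let hqn n : (Cnorm (q ^+ n.+1) < 1)%R := exp_norm_lt1 n hq.

Lemma one_sub_exp_neq0 c n : Cnorm c = 1%R -> 1 - q ^+ n.+1 * c != 0.
Proof.
move=> c1; rewrite subr_eq0; apply/eqP => e.
have : Cnorm (q ^+ n.+1 * c) = 1%R by rewrite -e Cnorm1.
by rewrite Cnorm_mul c1; have := hqn n; nlra.
Qed.

Lemma qpoch_inf_exp_neq0 c n m : Cnorm c = 1%R -> qpoch_inf (c * q ^+ n.+1) (q ^+ m.+1) != 0.
Proof.
move=> c1; apply: (qpoch_inf_neq0 (hqn m)) => i.
by rewrite mulrCA -exprM -exprD mulrC addnS; apply: one_sub_exp_neq0.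
Qed.

Let N1 : Cnorm 1 = 1%R := Cnorm1.
Let N1' : Cnorm (- 1) = 1%R. Proof. by rewrite Cnorm_opp Cnorm1. Qed.

Lemma qpoch_pos_neq0 n m : qpoch_inf (q ^+ n.+1) (q ^+ m.+1) != 0.
Proof. by rewrite -[q ^+ n.+1]mul1r; apply: qpoch_inf_exp_neq0. Qed.

Lemma qpoch_opp_neq0 n m : qpoch_inf (- q ^+ n.+1) (q ^+ m.+1) != 0.
Proof. by rewrite -mulN1r; apply: qpoch_inf_exp_neq0. Qed.

Let o := qpoch_inf q (q ^+ 2).
Let p := qpoch_inf (- q) (q ^+ 2).
Let m := qpoch_inf (- q ^+ 2) (q ^+ 2).
Let e1 := qpoch_inf q q.
Let e2 := qpoch_inf (q ^+ 2) (q ^+ 2).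
Let e4 := qpoch_inf (q ^+ 4) (q ^+ 4).
Let e8 := qpoch_inf (q ^+ 8) (q ^+ 8).

Let E1 : e1 = o * e2.
Proof. by rewrite /e1 (qpoch_inf_even_odd q hq) -expr2. Qed.

Let E2 : qpoch_inf (- q) q = p * m.
Proof. by rewrite (qpoch_inf_even_odd (- q) hq) mulrN -expr2. Qed.

Let E3 : o * p = qpoch_inf (q ^+ 2) (q ^+ 4).
Proof. by rewrite /o /p (qpoch_inf_pm q (hqn 1)) -exprM. Qed.

Let E4 : qpoch_inf (q ^+ 2) (q ^+ 4) * e4 = e2.
Proof. by rewrite /e2 (qpoch_inf_even_odd _ (hqn 1)) -!exprM -exprD. Qed.

Let E5 : e2 * m = e4.
Proof. by rewrite /e2 /m (qpoch_inf_pm (q ^+ 2) (hqn 1)) -!exprM. Qed.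

Let e2_0 : e2 != 0. Proof. exact: qpoch_pos_neq0. Qed.
Let e4_0 : e4 != 0. Proof. exact: qpoch_pos_neq0. Qed.
Let o_0 : o != 0. Proof. exact: (qpoch_pos_neq0 0 1). Qed.
Let p_0 : p != 0. Proof. exact: (qpoch_opp_neq0 0 1). Qed.
Let m_0 : m != 0. Proof. exact: qpoch_opp_neq0. Qed.

(** Euler's identity (q; q^2)_oo (-q; q)_oo = 1, with the second factor split by parity. *)
Let opm : o * p * m = 1.
Proof. by apply: (mulfI e2_0); rewrite mulr1 mulrCA E5 E3 E4. Qed.

Let q2_div : q ^+ 2 / q = q. Proof. by rewrite expr2 mulfK. Qed.
Let q4_div : q ^+ 4 / q = q ^+ 3. Proof. by rewrite (exprSr q 3) mulfK. Qed.

Lemma jtheta_q_2 : jtheta q (q ^+ 2) = o ^+ 2 * e2.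
Proof. by rewrite jthetaE /theta_inf q2_div -expr2. Qed.

Lemma jtheta_q_4 : jtheta q (q ^+ 4) = o * e4.
Proof.
rewrite jthetaE /theta_inf /o (qpoch_inf_even_odd q (hqn 1)) -exprM -exprSr.
by rewrite q4_div.
Qed.

Lemma theta_quotient_m1 :
  2%:R * (qpoch_inf q q / theta_inf (- 1) q) = jtheta q (q ^+ 2) * jtheta q (q ^+ 4) / Jm q 4.
Proof.
have -> : theta_inf (- 1) q = 2%:R * qpoch_inf (- q) q ^+ 2.
  rewrite /theta_inf (qpoch_inf_shift (- 1) hq) invrN1 !mulrN1; ring.
rewrite Jm_4 // jtheta_q_2 jtheta_q_4 -/e1 -/e4 E2 E1.
have -> : o ^+ 2 * e2 * (o * e4) / e4 = o * e2 * (o * p * m) ^+ 2 / (p * m) ^+ 2.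
  by field; rewrite m_0 p_0 e4_0.
by rewrite opm; field; rewrite m_0 p_0 two_neq0.
Qed.

Lemma theta_quotient_i (i : CC) : i ^+ 2 = - 1 -> Cnorm i = 1%R -> 1 - i != 0 ->
  (1 - i) * (qpoch_inf q q * theta_inf (- q) (q ^+ 2) / (theta_inf i q * theta_inf q (q ^+ 2)))
  = jtheta (- q) (q ^+ 2) * jtheta (- q) (q ^+ 4) / Jm q 4.
Proof.
move=> hi ni i1.
have i0 : i != 0 by apply: contra_eq_neq hi => ->; rewrite expr0n /= eq_sym oppr_eq0 oner_neq0.
have -> : theta_inf i q = (1 - i) * m.
  have -> : m = qpoch_inf (q * i) q * qpoch_inf (- (q * i)) q.
    by rewrite (qpoch_inf_pm _ hq) exprMn hi mulrN1.
  rewrite /theta_inf (qpoch_inf_shift i hq) -mulrA; congr (_ * (_ * qpoch_inf _ _)).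
  have -> : i^-1 = - i by apply: (mulfI i0); rewrite divff // mulrN -expr2 hi opprK.
  by rewrite mulrN.
have -> : theta_inf (- q) (q ^+ 2) = p ^+ 2.
  by rewrite /theta_inf invrN mulrN q2_div -expr2.
have -> : theta_inf q (q ^+ 2) = o ^+ 2.
  by rewrite /theta_inf q2_div -expr2.
have -> : jtheta (- q) (q ^+ 2) = p ^+ 2 * e2.
  by rewrite jthetaE /theta_inf invrN mulrN q2_div -expr2.
have -> : jtheta (- q) (q ^+ 4) = p * e4.
  rewrite jthetaE /theta_inf /p (qpoch_inf_even_odd (- q) (hqn 1)) -exprM mulrN -exprSr.
  by rewrite invrN mulrN q4_div.
rewrite Jm_4 // -/e1 -/e4 E1.
have -> : p ^+ 2 * e2 * (p * e4) / e4 = p ^+ 2 * e2 * p * (o * p * m) ^-1.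
  by rewrite opm invr1 mulr1 mulrA mulfK.
by field; rewrite i1 o_0 m_0 p_0.
Qed.

Lemma theta_quotient_q4 :
  e4 * theta_inf (- q ^+ 4) (q ^+ 8) / (theta_inf (- q) (q ^+ 4) * theta_inf (- q ^+ 6) (q ^+ 8))
  = jtheta (- q ^+ 4) (q ^+ 8) * jtheta q (q ^+ 4) / Jm q 4.
Proof.
have -> : theta_inf (- q) (q ^+ 4) = p.
  rewrite /theta_inf /p (qpoch_inf_even_odd (- q) (hqn 1)) -exprM mulrN -exprSr.
  by rewrite invrN mulrN q4_div.
have -> : theta_inf (- q ^+ 6) (q ^+ 8) = qpoch_inf (- q ^+ 2) (q ^+ 4).
  rewrite /theta_inf (qpoch_inf_even_odd (- q ^+ 2) (hqn 3)) -exprM mulrN -exprD mulrC.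
  congr (_ * _); congr qpoch_inf.
  by rewrite invrN mulrN [q ^+ 8](exprD q 2 6) mulfK // expf_neq0.
rewrite Jm_4 // jtheta_q_4 jthetaE -/e4 -/e8.
have E6 : qpoch_inf (q ^+ 2) (q ^+ 4) * qpoch_inf (- q ^+ 2) (q ^+ 4) * e8 = e4.
  rewrite (qpoch_inf_pm (q ^+ 2) (hqn 3)) -!exprM.
  by rewrite /e4 (qpoch_inf_even_odd _ (hqn 3)) -!exprM -exprD.
have n_0 : qpoch_inf (- q ^+ 2) (q ^+ 4) != 0 by exact: qpoch_opp_neq0.
rewrite -E3 in E6.
move: E6 n_0; move: (qpoch_inf (- q ^+ 2) _) (theta_inf _ _) => n t E6 n_0.
rewrite -{1}E6; field; by rewrite p_0 n_0 e4_0.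
Qed.

End Products.

(** * The mock theta functions f and phi *)

Definition Ci : CC := mkC 0 1.

Lemma Ci_sqr : Ci ^+ 2 = - 1.
Proof. by rewrite expr2; apply: CC_eq => /=; Rring. Qed.

Lemma Ci_norm : Cnorm Ci = 1%R.
Proof. by rewrite /Cnorm /= Rmult_0_l Rplus_0_l Rmult_1_r sqrt_1. Qed.

Lemma one_sub_Ci_neq0 : 1 - Ci != 0.
Proof. by apply/eqP => -[]; lra. Qed.

(** Eliminates the auxiliary s and o = i s; the conditions at o Z and -o Z are both consequences of
    one condition on Z^2. *)
Lemma appell_dissection_q (q Z : CC) : q != 0 -> (Cnorm q < 1)%R -> Z != 0 ->
  (forall k : int, 1 - q ^ k * Z != 0) ->
  (forall k : int, 1 + q ^ (2%:Z * k + 1) * Z ^+ 2 != 0) ->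
  appell Z q = qpoch_inf q q * theta_inf (- q) (q ^+ 2) /
       (theta_inf Z q * theta_inf (- q * Z ^+ 2) (q ^+ 2)) +
    (appell (- q * Z ^+ 2) (q ^+ 4) - 1) / Z - (appell (- q / Z ^+ 2) (q ^+ 4) - 1).
Proof.
move=> q0 hq Z0 h1 h2; have [s hs] := Csqrt_exists q.
have s0 : s != 0 by move: q0; rewrite -hs expf_eq0.
have ns : (Cnorm s < 1)%R.
  by move: hq; rewrite -hs Cnorm_pow /=; have := Cnorm_ge0 s; nnra.
have sk k : s ^ (2%:Z * k) = q ^ k by rewrite -hs exprnP exprz_exp.
pose o := Ci * s.
have ho : o ^+ 2 = - s ^+ 2 by rewrite exprMn Ci_sqr mulN1r.
have fo (c : CC) : c ^+ 2 = - s ^+ 2 -> lattice_free s (c * Z).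
  move=> hc k; apply: contraNneq (h2 k) => /subr0_eq e.
  have -> : q ^ (2%:Z * k + 1) * Z ^+ 2 = - (s ^ (2%:Z * k) * (c * Z)) ^+ 2.
    have -> : q ^ (2%:Z * k + 1) = q ^ k * q ^ k * q.
      by rewrite expfzDr // expr1z -expfzDr //; congr (_ ^ _ * _); ring.
    by rewrite exprMn sk exprMn hc hs; ring.
  by rewrite -e expr1n subrr.
rewrite -!hs; apply: (appell_dissection s0 ns Z0 ho).
- by move=> k; rewrite sk.
- exact: fo.
- by apply: fo; rewrite sqrrN.
Qed.

Lemma one_sub_expz_neq0 (q c : CC) (n : int) : q != 0 -> (Cnorm q < 1)%R -> Cnorm c = 1%R ->
  (n = 0 -> 1 - c != 0) -> 1 - q ^ n * c != 0.
Proof.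
move=> q0 hq c1 h; rewrite subr_eq0; apply/eqP => e.
have n0 : n = 0.
  apply: (expz_norm1 q0 hq).
  have : Cnorm (q ^ n * c) = 1%R by rewrite -e Cnorm1.
  by rewrite Cnorm_mul c1 Rmult_1_r.
by move: e; rewrite n0 expr0z mul1r => /eqP; rewrite -subr_eq0 (negbTE (h n0)).
Qed.

Lemma Cnorm_m1 : Cnorm (- 1) = 1%R.
Proof. by rewrite Cnorm_opp Cnorm1. Qed.

Lemma one_add_expz_neq0 (q : CC) (n : int) : q != 0 -> (Cnorm q < 1)%R -> n != 0 ->
  1 + q ^ n != 0.
Proof.
move=> q0 hq n0; have -> : 1 + q ^ n = 1 - q ^ n * - 1 by rewrite mulrN1 opprK.
by apply: one_sub_expz_neq0 => //; [exact: Cnorm_m1|move/eqP; rewrite (negbTE n0)].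
Qed.

(** As Z^2 = 1, both Appell functions of the dissection are A(-q; q^4), and division by Z = -1 makes
    their contributions add. *)
Lemma appell_m1 (q : CC) : q != 0 -> (Cnorm q < 1)%R ->
  2%:R * appell (- 1) q = jtheta q (q ^+ 2) * jtheta q (q ^+ 4) / Jm q 4
    - 4%:R * (appell (- q) (q ^+ 4) - 1).
Proof.
move=> q0 hq; rewrite -theta_quotient_m1 // (appell_dissection_q (Z := - 1)) //.
- rewrite sqrrN expr1n mulr1 divr1 invrN1.
  have K0 : theta_inf (- q) (q ^+ 2) != 0.
    rewrite /theta_inf mulf_neq0 //; first exact: (qpoch_opp_neq0 hq 0 1).
    have -> : q ^+ 2 / - q = - q by rewrite invrN mulrN expr2 mulfK.
    exact: (qpoch_opp_neq0 hq 0 1).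
  rewrite -mulf_div divff // mulr1; ring.
- by rewrite oppr_eq0 oner_eq0.
- move=> k; apply: one_sub_expz_neq0 => //; first exact: Cnorm_m1.
  by move=> _; rewrite opprK; exact: two_neq0.
- move=> k; rewrite sqrrN expr1n mulr1; apply: one_add_expz_neq0 => //; lia.
Qed.

(** As Z^2 = -1, both Appell functions are A(q; q^4), with total coefficient 1/i - 1 = -(1 + i). The
    factor 1 - i turns it into -2, so the result is the same for i and -i. *)
Lemma appell_i (i q : CC) : q != 0 -> (Cnorm q < 1)%R -> i ^+ 2 = - 1 -> Cnorm i = 1%R ->
  1 - i != 0 ->
  (1 - i) * appell i q = jtheta (- q) (q ^+ 2) * jtheta (- q) (q ^+ 4) / Jm q 4
    - 2%:R * (appell q (q ^+ 4) - 1).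
Proof.
move=> q0 hq hi ni i1; rewrite -(theta_quotient_i q0 hq hi ni i1).
have i0 : i != 0 by apply: contra_eq_neq hi => ->; rewrite expr0n /= eq_sym oppr_eq0 oner_neq0.
rewrite (appell_dissection_q (Z := i)) //.
- have -> : i^-1 = - i by apply: (mulfI i0); rewrite divff // mulrN -expr2 hi opprK.
  rewrite hi invrN1 !mulrN1 !opprK.
  have e : i * i = - 1 by rewrite -expr2 hi.
  rewrite -addrA mulrDr; congr (_ + _).
  transitivity ((appell q (q ^+ 4) - 1) * (i * i - 1)); first ring.
  rewrite e; ring.
- by move=> k; apply: one_sub_expz_neq0.
- move=> k; rewrite hi mulrN1 -[X in _ - X]mulr1.
  apply: one_sub_expz_neq0 => //; [exact: Cnorm1|lia].
Qed.

Lemma gmockE (x q : CC) : gmock x q = x^-1 * (- 1 + appell x q).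
Proof.
rewrite /gmock /appell; congr (_ * (_ + Csum _)).
by apply: funext => n; rewrite !qpochE CpowE.
Qed.

Lemma G4E (b0 b1 : R) (q : CC) : G4 b0 b1 q =
  RtoC b0 * (- 1 + q ^+ 2 * ((- q ^+ 2)^-1 * (- 1 + appell (- q ^+ 2) (q ^+ 16)))) +
  RtoC b1 * q ^+ 5 * ((- q ^+ 6)^-1 * (- 1 + appell (- q ^+ 6) (q ^+ 16))).
Proof. by rewrite /G4 !gmockE !CpowE. Qed.

(** At base q^4 and Z = -q the new arguments are -q^6 and -q^2. The constant -1 in [G4] is the one
    subtracted on the left: q^2 g(-q^2; q^16) - 1 is just -A(-q^2; q^16). *)
Lemma appell_q4 (q : CC) : q != 0 -> (Cnorm q < 1)%R ->
  appell (- q) (q ^+ 4) - 1 =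
    jtheta (- q ^+ 4) (q ^+ 8) * jtheta q (q ^+ 4) / Jm q 4 + G4 1 1 q.
Proof.
move=> q0 hq.
have q40 : q ^+ 4 != 0 by rewrite expf_neq0.
have hq4 : (Cnorm (q ^+ 4) < 1)%R by exact: exp_norm_lt1.
have zE (k : int) : (q ^+ 4) ^ k = q ^ (4%:Z * k) by rewrite exprnP exprz_exp.
rewrite -theta_quotient_q4 // (appell_dissection_q (Z := - q) (q := q ^+ 4)) //.
- rewrite sqrrN.
  have -> : - q ^+ 4 * q ^+ 2 = - q ^+ 6 by rewrite mulNr -exprD.
  have -> : - q ^+ 4 / q ^+ 2 = - q ^+ 2 by rewrite mulNr (exprD q 2 2) mulfK // expf_neq0.
  rewrite -!exprM.
  rewrite G4E (_ : RtoC 1 = 1) //.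
  rewrite -[X in X - 1 = _]addrA -[LHS]addrA; congr (_ + _).
  move: (appell _ _) (appell _ _) => a b.
  by field; rewrite !oppr_eq0 q0 !expf_neq0.
- by rewrite oppr_eq0.
- move=> k; rewrite zE mulrN opprK -[X in _ * X]expr1z -expfzDr //.
  by apply: one_add_expz_neq0 => //; lia.
- move=> k; rewrite zE sqrrN exprnP -expfzDr //.
  by apply: one_add_expz_neq0 => //; lia.
Qed.

(** * The generating function of the rank *)

Lemma poch_add (F : fieldType) (x q : F) n m :
  poch x q (n + m) = poch x q n * poch (q ^+ n * x) q m.
Proof.
elim: m => [|m IH]; first by rewrite addn0 poch0 mulr1.
by rewrite addnS !pochS IH mulrA mulrA -exprD (addnC m) -mulrA.
Qed.

(** Fine's function F(a, b; t) at a = 0, with b q replaced by b. *)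
Definition fine_sum (q b t : CC) : CC := Csum (fun j => t ^+ j / poch b q j).

Lemma fine_sum_cv (q b t : CC) : (Cnorm q < 1)%R -> (Cnorm t < 1)%R ->
  (forall i, 1 - q ^+ i * b != 0) ->
  Ccv (fun J => \sum_(j < J) t ^+ j / poch b q j) (fine_sum q b t).
Proof.
move=> hq ht hb; have [B B0 hB] := poch_inv_bound hq hb.
have [L hL] : exists L, Ccv (fun J => \sum_(j < J) t ^+ j / poch b q j) L.
  apply: (@Ccv_series (fun j => t ^+ j / poch b q j) B (Cnorm t)).
  - lra.
  - by split => //; exact: Cnorm_ge0.
  - move=> i; rewrite Cnorm_mul Cnorm_pow Rmult_comm.
    by apply: Rmult_le => //; [exact: Cnorm_ge0|exact/pow_ge0/Cnorm_ge0|exact: Rle_refl].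
by rewrite /fine_sum (Csum_eq hL).
Qed.

(** Summation by parts: 1/(b)_(j+1) - 1/(b)_j = q^j b / (b)_(j+1), and (b)_(j+1) = (1 - b)(q b)_j
    turns the new sum into one with b and t both multiplied by q. *)
Lemma fine_recursion (q b t : CC) : (Cnorm q < 1)%R -> (Cnorm t < 1)%R ->
  (forall i, 1 - q ^+ i * b != 0) -> 1 - t != 0 ->
  fine_sum q b t = (1 - t)^-1 + t * b / ((1 - t) * (1 - b)) * fine_sum q (q * b) (q * t).
Proof.
move=> hq ht hb t1.
have b1 : 1 - b != 0 by have := hb 0%N; rewrite expr0 mul1r.
have hb' i : 1 - q ^+ i * (q * b) != 0 by have := hb i.+1; rewrite exprSr -mulrA.
have ht' : (Cnorm (q * t) < 1)%R.
  by rewrite Cnorm_mul; have := Cnorm_ge0 q; have := Cnorm_ge0 t; nnra.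
have [B B0 hB] := poch_inv_bound hq hb.
have h1 : Ccv (fun J => \sum_(j < J.+1) t ^+ j / poch b q j) (fine_sum q b t).
  apply: (@Ccv_comp _ _ (fun J => J.+1) _ (fine_sum_cv hq ht hb)) => K; exists K => n; lia.
have h2 := fine_sum_cv hq ht' hb'.
have h3 : Ccv (fun J => t ^+ J.+1 / poch b q J) 0.
  apply: (@Ccv_geom0 _ B (Cnorm t)) => [|n]; first by split => //; exact: Cnorm_ge0.
  rewrite Cnorm_mul Cnorm_pow Rmult_comm; apply: Rmult_le => //.
  - exact: Cnorm_ge0.
  - exact/pow_ge0/Cnorm_ge0.
  - by rewrite /=; have := @pow_ge0 _ n (Cnorm_ge0 t); have := Cnorm_ge0 t; nra.
have h4 := Ccv_sub (Ccv_add (Ccv_const 1) (Ccv_mul (Ccv_const (t * b / (1 - b))) h2)) h3.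
have e : (1 - t) * fine_sum q b t = 1 + t * b / (1 - b) * fine_sum q (q * b) (q * t) - 0.
  apply: Ccv_unique (Ccv_mul (Ccv_const (1 - t)) h1) _; apply: Ccv_ext h4.
  elim=> [|J IH].
    by rewrite big_ord0 big_ord1 poch0 expr1 expr0 !divr1; ring.
  rewrite big_ord_recr [in RHS]big_ord_recr /= [in RHS]mulrDr -IH.
  rewrite [poch b q J.+1]pochSl exprMn.
  have p0 : poch (q * b) q J != 0 by exact: poch_neq0.
  have p1 : poch b q J != 0 by exact: poch_neq0.
  have : poch b q J * (1 - q ^+ J * b) = (1 - b) * poch (q * b) q J by rewrite -pochS pochSl.
  have f0 := hb J.
  move=> /(canRL (mulfK f0)) ->.
  rewrite !(exprS t); move: p0 f0; move: (poch (q * b) q J) (q ^+ J) (t ^+ J) (\sum_(_ < _) _).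
  move=> P Q T S P0 f0.
  by field; rewrite b1 P0 f0.
apply: (mulfI t1); rewrite e; field; by rewrite b1 t1.
Qed.

(** Uniformity in n comes from 1/(q^n b)_j = (b)_n / (b)_(n+j); it controls the remainder of the
    iterated recursion. *)
Lemma fine_sum_shift_bound (q b t : CC) : (Cnorm q < 1)%R -> (Cnorm t < 1)%R ->
  (forall i, 1 - q ^+ i * b != 0) ->
  exists B, forall n, (Cnorm (fine_sum q (q ^+ n * b)%ring (q ^+ n * t)%ring) <= B)%R.
Proof.
move=> hq ht hb; have [B B0 hB] := poch_inv_bound hq hb.
have [D D0 hD] := poch_bound b hq.
exists (D * B * (Cnorm t) ^ 0 / (1 - Cnorm t))%R => n.
have hb' i : 1 - q ^+ i * (q ^+ n * b) != 0 by rewrite mulrA -exprD.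
have h := @Cnorm_exp_le1 q n hq; have t0 := Cnorm_ge0 t; have q0 := Cnorm_ge0 (q ^+ n).
have nt : (Cnorm (q ^+ n * t) <= Cnorm t)%R by rewrite Cnorm_mul; nnra.
apply: (@Ccv_norm_le (fun J => \sum_(0 <= j < J) (q ^+ n * t) ^+ j / poch (q ^+ n * b) q j)).
  move=> J; apply: geom_tail_bound => [||j]; [by apply: Rmult_le_pos; lra|by split|].
  rewrite Cnorm_mul Cnorm_pow Rmult_comm; apply: Rmult_le.
  - exact: Cnorm_ge0.
  - exact/pow_ge0/Cnorm_ge0.
  - have p0 := poch_neq0 n hb; have p1 : poch (q ^+ n * b) q j != 0 by exact: poch_neq0.
    have -> : (poch (q ^+ n * b) q j)^-1 = poch b q n * (poch b q (n + j))^-1.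
      by rewrite poch_add; field; rewrite p0 p1.
    by rewrite Cnorm_mul; apply: Rmult_le => //; exact: Cnorm_ge0.
  - by apply: pow_incr; split => //; exact: Cnorm_ge0.
have ht' : (Cnorm (q ^+ n * t) < 1)%R by lra.
by apply: Ccv_ext (fine_sum_cv hq ht' hb') => J; rewrite big_mkord.
Qed.

(* The Rogers-Fine identity turns the sum over the largest part into the sum over the
   side of the Durfee square. *)
Lemma appell_rank_sum (q z : CC) : q != 0 -> (Cnorm q < 1)%R -> Cnorm z = 1%R -> 1 - z != 0 ->
  Ccv (fun J => 1 + \sum_(j < J) z ^+ j * q ^+ j.+1 / poch (q / z) q j.+1) ((1 - z) * appell z q).
Proof.
move=> q0 hq nz z1.
have z0 : z != 0 by apply/eqP => e; rewrite e Cnorm0 in nz; lra.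
have iz : Cnorm z^-1 = 1%R by rewrite Cnorm_inv // nz Rinv_1.
have hz i : 1 - q ^+ i * z != 0.
  by rewrite exprnP; apply: one_sub_expz_neq0.
have hc i : 1 - q ^+ i * (q / z) != 0.
  by rewrite mulrA -exprSr exprnP; apply: one_sub_expz_neq0.
have hqz i : 1 - q ^+ i * (q * z) != 0 by rewrite mulrA -exprSr.
set c := q / z; set t := q * z.
have ht : (Cnorm t < 1)%R by rewrite Cnorm_mul nz Rmult_1_r.
have hqc i : 1 - q ^+ i * (q * c) != 0 by have := hc i.+1; rewrite exprSr -mulrA.
have [cA _] := watson_limit hq q0 z0 hz hc.
have [B hB] := fine_sum_shift_bound hq ht hqc.
have [B1 B10 hB1] := poch_inv_bound hq hqz; have [B2 B20 hB2] := poch_inv_bound hq hc.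
have c1 : 1 - c != 0 by have := hc 0%N; rewrite expr0 mul1r.
pose H n := fine_sum q (q ^+ n * (q * c)) (q ^+ n * t).
(* The N-th use of the recursion contributes the factor q^(2N+3) = q^((N+2)^2 - (N+1)^2): this is
   how the squares of the Durfee side arise. The remainder vanishes by the uniform bound on [H]. *)
have iter N : q / (1 - c) * H 0%N = \sum_(n < N) q ^+ (n.+1 * n.+1) / (poch t q n.+1 * poch c q n.+1)
   + q ^+ (N.+1 * N.+1) / (poch t q N * poch c q N.+1) * H N.
  elim: N => [|N IH].
    by rewrite big_ord0 add0r pochS !poch0 expr0 !mul1r mul1n expr1.
  rewrite IH big_ord_recr /= -addrA; congr (_ + _).
  have hqc' i : 1 - q ^+ i * (q ^+ N * (q * c)) != 0 by rewrite mulrA -exprD.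
  have ht' : (Cnorm (q ^+ N * t) < 1)%R.
    rewrite Cnorm_mul; have := @Cnorm_exp_le1 q N hq; have := Cnorm_ge0 t; have := Cnorm_ge0 (q ^+ N); nnra.
  rewrite {1}/H (fine_recursion hq ht' hqc') ?hqz //.
  have -> : q * (q ^+ N * (q * c)) = q ^+ N.+1 * (q * c) by rewrite mulrA -exprS.
  have -> : q * (q ^+ N * t) = q ^+ N.+1 * t by rewrite mulrA -exprS.
  rewrite -/(H N.+1).
  have p1 : poch t q N != 0 by exact: poch_neq0.
  have p2 : poch c q N.+1 != 0 by exact: poch_neq0.
  have f1 := hqz N; have f2 : 1 - q ^+ N.+1 * c != 0 by exact: hc.
  rewrite (pochS t) (pochS c q N.+1).
  have -> : (N.+2 * N.+2 = N.+1 * N.+1 + (2 * N.+1).+1)%N by lia.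
  rewrite exprD.
  have -> : q ^+ (2 * N.+1).+1 = q ^+ N * t * (q ^+ N * (q * c)).
    rewrite /t /c (exprS q (2 * N.+1)) mulnS exprD mul2n -addnn exprD; field; exact: z0.
  have -> : q ^+ N * (q * c) = q ^+ N.+1 * c by rewrite exprSr !mulrA.
  move: f1 f2 p1 p2; rewrite -/t.
  move: (poch t q N) (poch c q N.+1) (H N.+1) (q ^+ N * t) (q ^+ N.+1 * c) (q ^+ _) => a b h x y w.
  by move=> *; field; do ?(apply/andP; split).
have lim1 : Ccv (fun N => \sum_(n < N) q ^+ (n.+1 * n.+1) / (poch t q n.+1 * poch c q n.+1))
   (q / (1 - c) * H 0%N).
  rewrite -[q / _ * _]subr0.
  have rem : Ccv (fun N => q ^+ (N.+1 * N.+1) / (poch t q N * poch c q N.+1) * H N) 0.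
    apply: (@Ccv_geom0 _ (B1 * B2 * B)%R (Cnorm q)) => [|n]; first by split => //; exact: Cnorm_ge0.
    have Hb := hB n; rewrite -/(H n) in Hb.
    have e1 : (Cnorm (q ^+ (n.+1 * n.+1)) <= Cnorm q ^ n)%R by apply: Cnorm_exp_le => //; lia.
    rewrite invfM !Cnorm_mul Rmult_comm -!Rmult_assoc (Rmult_comm (B1 * B2 * B)) -!Rmult_assoc.
    have e2 : (Cnorm (q ^+ (n.+1 * n.+1)) * Cnorm (poch t q n)^-1 <= Cnorm q ^ n * B1)%R.
      by apply: Rmult_le => //; exact: Cnorm_ge0.
    have e3 : (Cnorm (q ^+ (n.+1 * n.+1)) * Cnorm (poch t q n)^-1 * Cnorm (poch c q n.+1)^-1 <= Cnorm q ^ n * B1 * B2)%R.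
      by apply: Rmult_le => //; [apply: Rmult_le_pos; exact: Cnorm_ge0|exact: Cnorm_ge0].
    rewrite Rmult_assoc Rmult_assoc Rmult_comm -Rmult_assoc; apply: Rmult_le => //; last exact: Cnorm_ge0.
    by do ?apply: Rmult_le_pos; exact: Cnorm_ge0.
  by apply: Ccv_ext (Ccv_sub (Ccv_const _) rem) => N; rewrite {1}(iter N) addrK.
have lim2 : Ccv (fun N => 1 + \sum_(n < N) q ^+ (n.+1 * n.+1) / (poch t q n.+1 * poch c q n.+1))
   ((1 - z) * appell z q).
  have h : Ccv (fun N => (1 - z) * \sum_(n < N.+1) q ^+ (n * n) / (poch z q n.+1 * poch c q n)) ((1 - z) * appell z q).
    apply: Ccv_mul (Ccv_const _) _.
    by apply: (@Ccv_comp _ _ (fun N => N.+1) _ cA) => K; exists K => n; lia.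
  apply: Ccv_ext h => N; rewrite big_ord_recl mulrDr; congr (_ + _).
    by rewrite /= mul0n expr0 pochS !poch0 expr0 !mul1r mulr1 mulfV.
  rewrite mulr_sumr; apply: eq_bigr => n _; rewrite lift0 [poch z q _]pochSl -/t.
  have p1 : poch t q n.+1 != 0 by exact: poch_neq0.
  have p2 : poch c q n.+1 != 0 by exact: poch_neq0.
  by field; rewrite z1 p1 p2.
have eA := Ccv_unique lim2 (Ccv_add (Ccv_const 1) lim1).
rewrite eA; apply: Ccv_add (Ccv_const _) _.
have hH : Ccv (fun J => \sum_(j < J) t ^+ j / poch (q * c) q j) (H 0%N).
  by rewrite /H !expr0 !mul1r; apply: fine_sum_cv.
apply: Ccv_ext (Ccv_mul (Ccv_const (q / (1 - c))) hH) => J.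
rewrite mulr_sumr; apply: eq_bigr => j _; rewrite pochSl /t exprMn exprS.
have p1 : poch (q * c) q j != 0 by exact: poch_neq0.
by field; rewrite c1 p1.
Qed.

(** * Partitions weighted by their length *)

Lemma big_flat_map (A B : Type) (g : A -> list B) (s : list A) (F : B -> CC) :
  \sum_(x <- List.flat_map g s) F x = \sum_(j <- s) \sum_(x <- g j) F x.
Proof. by elim: s => [|a s IH]; rewrite ?big_nil //= big_cat big_cons -IH. Qed.

Lemma big_List_map (A B : Type) (h : A -> B) (s : list A) (F : B -> CC) :
  \sum_(x <- List.map h s) F x = \sum_(x <- s) F (h x).
Proof. by elim: s => [|a s IH]; rewrite ?big_nil //= !big_cons IH. Qed.

Lemma List_seqE a n : List.seq a n = iota a n.
Proof. by elim: n a => [|n IH] a //=; rewrite IH. Qed.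

Definition plist_weight (t : CC) f n k : CC := \sum_(l <- plist f n k) t ^+ size l.

Lemma plist_weight0 (t : CC) f k : plist_weight t f 0 k = 1.
Proof. by rewrite /plist_weight; case: f => [|f] /=; rewrite big_seq1. Qed.

Lemma plist_weightS (t : CC) f n k : plist_weight t f.+1 n.+1 k =
  \sum_(j <- iota 1 (minn k n.+1)) t * plist_weight t f (n.+1 - j) j.
Proof.
rewrite /plist_weight [plist _ _ _]/= List_seqE big_flat_map.
have -> : Nat.min k n.+1 = minn k n.+1 by lia.
apply: eq_bigr => j _; rewrite big_List_map mulr_sumr.
by apply: eq_bigr => l _; rewrite /= exprS.
Qed.

Lemma plist_weight_fuel (t : CC) f f' n k : (n <= f)%N -> (n <= f')%N ->
  plist_weight t f n k = plist_weight t f' n k.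
Proof.
elim: f f' n k => [|f IH] [|f'] [|n] k // hf hf'; rewrite ?plist_weight0 //.
rewrite !plist_weightS big_seq [RHS]big_seq; apply: eq_bigr => j.
by rewrite mem_iota => hj; congr (_ * _); apply: IH; lia.
Qed.

(* The sum of [t ^ length] over the partitions of [n] into parts at most [k]. *)
Definition bounded_weight (t : CC) n k : CC := plist_weight t n n k.

Lemma bounded_weight0 (t : CC) k : bounded_weight t 0 k = 1.
Proof. exact: plist_weight0. Qed.

Lemma bounded_weightS0 (t : CC) n : bounded_weight t n.+1 0 = 0.
Proof. by rewrite /bounded_weight plist_weightS min0n big_nil. Qed.

(** Either no part equals k + 1, or one such part is removed at the cost of a factor t. *)
Lemma bounded_weightSS (t : CC) n k : bounded_weight t n.+1 k.+1 =
  bounded_weight t n.+1 k + (if (k <= n)%N then t * bounded_weight t (n - k) k.+1 else 0).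
Proof.
rewrite /bounded_weight !plist_weightS; case: leqP => h.
  have -> : minn k.+1 n.+1 = (k + 1)%N by lia.
  have -> : minn k n.+1 = k by lia.
  rewrite iotaD big_cat /= big_seq1 add1n subSS; congr (_ + _ * _).
  by apply: plist_weight_fuel; lia.
by rewrite addr0; congr (\sum_(_ <- iota _ _) _); lia.
Qed.

(** For |t| = 1 the recursion is dominated by that of the coefficients of 1/(r; r)_k. The relation
    [bS] mirrors [bounded_weightSS], which makes the double induction close with the bound b k. *)
Lemma bounded_weight_le (t : CC) r : Cnorm t = 1%R -> (0 < r < 1)%R ->
  exists2 B, (0 < B)%R & forall n k, (Cnorm (bounded_weight t n k) * r ^ n <= B)%R.
Proof.
move=> nt r01; pose q := RtoC r.
have nq : Cnorm q = r.
  by rewrite /Cnorm /= Rmult_0_l Rplus_0_r sqrt_square; lra.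
have hq : (Cnorm q < 1)%R by rewrite nq; lra.
have nz := no_root1_norm hq.
have [B B0 hB] := poch_inv_bound hq nz; exists B => // n k.
pose b k := Cnorm (poch q q k)^-1.
apply: (Rle_trans _ (b k)); last exact: hB.
have fk j : Cnorm (1 - q ^+ j * q) = (1 - r ^ j.+1)%R.
  have -> : q ^+ j * q = RtoC (r ^ j.+1).
    rewrite -exprSr; elim: j.+1 => [|m IH] //.
    by rewrite exprS IH; apply: CC_eq => /=; Rring.
  rewrite /Cnorm /= Ropp_0 Rplus_0_r Rmult_0_l Rplus_0_r sqrt_square //.
  have := @pow_incr r 1 j ltac:(lra); rewrite pow1 => h.
  have := @pow_ge0 r j ltac:(lra); rewrite /Rminus; nra.
have bS j : (b j.+1 * (1 - r ^ j.+1) = b j)%R.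
  rewrite /b pochS invfM Cnorm_mul Rmult_assoc -fk -Cnorm_mul mulVf //.
  by rewrite Cnorm1 Rmult_1_r.
elim: k n => [|k IHk] n.
  case: n => [|n]; rewrite ?bounded_weight0 ?bounded_weightS0 ?Cnorm1 ?Cnorm0 /b poch0 invr1 Cnorm1; lra.
elim/ltn_ind: n => -[|n] IHn.
  rewrite bounded_weight0 Cnorm1; have := IHk 0%N; rewrite bounded_weight0 Cnorm1.
  have p : (0 < r ^ k.+1)%R by apply: pow_lt; lra.
  have b0 : (0 <= b k.+1)%R by exact: Cnorm_ge0.
  have := bS k; rewrite [(r ^ 0)%R]/=; move: (r ^ k.+1)%R (b k.+1) p b0 => u v u0 v0.
  by nra.
rewrite bounded_weightSS.
have h1 := IHk n.+1.
have b0 : (0 <= b k.+1)%R by exact: Cnorm_ge0.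
have p : (0 < r ^ k.+1)%R by apply: pow_lt; lra.
have pn : (0 < r ^ n.+1)%R by apply: pow_lt; lra.
case: leqP => h; last by rewrite addr0; have := bS k; nra.
have h2 := IHn (n - k)%N ltac:(lia).
have e : (r ^ n.+1 = r ^ k.+1 * r ^ (n - k))%R by rewrite -pow_add; congr (_ ^ _)%R; lia.
have tri := Cnorm_triangle (bounded_weight t n.+1 k) (t * bounded_weight t (n - k) k.+1).
rewrite Cnorm_mul nt Rmult_1_l in tri.
have h3 : (Cnorm (bounded_weight t (n - k) k.+1) * r ^ n.+1 <= r ^ k.+1 * b k.+1)%R.
  by rewrite e; move: h2; move: (r ^ (n - k))%R (r ^ k.+1)%R p => u v v0; nnra.
have := bS k; move: tri h1 h3; move: (r ^ n.+1)%R (r ^ k.+1)%R p pn => u v v0 u0; nnra.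
Qed.

Definition weight_series (t q : CC) k M : CC := \sum_(m < M) bounded_weight t m k * q ^+ m.

Lemma sum_shift_if (h : nat -> CC) d M :
  \sum_(m < M) (if (d <= m)%N then h (m - d)%N else 0) = \sum_(m < M - d) h m.
Proof.
case: (leqP d M) => hd; last first.
  have -> : (M - d = 0)%N by lia.
  by rewrite big_ord0 big1 // => m _; case: leqP => // ?; have := ltn_ord m; lia.
rewrite -(big_mkord predT (fun m => if (d <= m)%N then h (m - d)%N else 0)).
rewrite (big_cat_nat (n := d)) //= big_nat big1 ?add0r; last first.
  by move=> i /andP[_ hi]; rewrite leqNgt hi.
rewrite -{1}[d]add0n big_addn big_mkord; apply: eq_bigr => i _.
by rewrite leq_addl addnK.
Qed.

Lemma weight_series_rec (t q : CC) k M : weight_series t q k.+1 M =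
  weight_series t q k M + t * q ^+ k.+1 * weight_series t q k.+1 (M - k.+1).
Proof.
rewrite /weight_series mulr_sumr.
rewrite -(sum_shift_if (fun m => t * q ^+ k.+1 * (bounded_weight t m k.+1 * q ^+ m))) -big_split /=.
apply: eq_bigr => -[[|m] hm] _ /=; first by rewrite !bounded_weight0 addr0.
rewrite bounded_weightSS mulrDl subSS ltnS; congr (_ + _).
case: leqP => h; last by rewrite mul0r.
have -> : q ^+ m.+1 = q ^+ k.+1 * q ^+ (m - k) by rewrite -exprD; congr (_ ^+ _); lia.
ring.
Qed.

(** The bound is uniform in k, as needed to sum over the largest part. The limit is found from the
    linear equation that the recursion gives for it, whose coefficient 1 - t q^(k+1) is nonzero. *)
Lemma weight_series_limit (t q : CC) : (Cnorm q < 1)%R -> Cnorm t = 1%R ->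
  exists2 B, (0 <= B)%R & forall k,
   (forall M, (Cnorm (weight_series t q k M) <= B)%R) /\
   ((forall i, 1 - q ^+ i * (t * q) != 0) -> Ccv (weight_series t q k) (poch (t * q) q k)^-1).
Proof.
move=> hq nt; have q0 := Cnorm_ge0 q.
(* With |q| < r < 1, the weights are at most B r^(-m), which leaves (|q| / r)^m as majorant. *)
pose r := ((1 + Cnorm q) / 2)%R.
have r01 : (0 < r < 1)%R by rewrite /r; lra.
have [B B0 hB] := bounded_weight_le nt r01.
pose s := (Cnorm q / r)%R.
have s01 : (0 <= s < 1)%R.
  split; first by apply: Rmult_le_pos => //; left; apply: Rinv_0_lt_compat; lra.
  apply: (Rmult_lt_reg_r r); first lra.
  rewrite /s /Rdiv Rmult_assoc Rinv_l; last lra.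
  by rewrite /r; lra.
have term k m : (Cnorm (bounded_weight t m k * q ^+ m) <= B * s ^ m)%R.
  rewrite Cnorm_mul Cnorm_pow.
  have -> : (Cnorm q ^ m = r ^ m * s ^ m)%R.
    by rewrite -Rpow_mult_distr; congr (_ ^ _)%R; rewrite /s; Rfield; lra.
  rewrite -Rmult_assoc; apply: Rmult_le_compat_r; last exact: hB.
  by apply: pow_ge0; lra.
exists (B * s ^ 0 / (1 - s))%R => [|k].
  by apply: Rmult_le_pos; [rewrite /=; lra|left; apply: Rinv_0_lt_compat; lra].
split=> [M|hx].
  rewrite /weight_series -(big_mkord predT (fun m => bounded_weight t m k * q ^+ m)).
  by apply: geom_tail_bound => //; lra.
elim: k => [|k IH].
  rewrite poch0 invr1; apply: (@Ccv_eventually _ _ _ 1%N _ (Ccv_const 1)) => -[|M] // _.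
  rewrite /weight_series big_ord_recl bounded_weight0 expr0 mul1r big1 ?addr0 // => m _.
  by rewrite lift0 bounded_weightS0 mul0r.
have [L hL] : exists L, Ccv (weight_series t q k.+1) L by apply: (Ccv_series _ s01 (term k.+1)); lra.
have hL' : Ccv (fun M => weight_series t q k.+1 (M - k.+1)) L.
  by apply: (@Ccv_comp _ _ (fun M => M - k.+1)%N _ hL) => K; exists (K + k.+1)%N => n; lia.
have e : L = (poch (t * q) q k)^-1 + t * q ^+ k.+1 * L.
  apply: Ccv_unique hL _; apply: Ccv_ext (Ccv_add IH (Ccv_mul (Ccv_const _) hL')) => M.
  by rewrite [RHS]weight_series_rec.
suff -> : (poch (t * q) q k.+1)^-1 = L by [].
have f0 := hx k; have p0 : poch (t * q) q k != 0 by exact: poch_neq0.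
rewrite pochS; apply: (mulfI f0); rewrite invfM mulrCA divff // mulr1 mulrBl mul1r {1}e.
rewrite exprS; ring.
Qed.

(* [z ^ rank l], written without integer exponents. *)
Definition rank_weight (z : CC) (l : list nat) : CC := z ^+ List.hd 0%N l * z^-1 ^+ size l.
Definition rank_poly (z : CC) n : CC := \sum_(l <- partitions n) rank_weight z l.

(** The empty partition has default head 0 and length 0, hence weight 1, in accordance with N(m,0)
    being 1 at m = 0 only. *)
Lemma rank_poly0 (z : CC) : rank_poly z 0 = 1.
Proof. by rewrite /rank_poly /partitions /= big_seq1 /rank_weight /= mulr1. Qed.

(** The largest part is j + 1; it contributes z^(j+1) as largest part and z^-1 as a part, hence
    z^j. *)
Lemma rank_polyS (z : CC) n : z != 0 -> rank_poly z n.+1 =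
  \sum_(j < n.+1) z ^+ j * bounded_weight z^-1 (n - j) j.+1.
Proof.
move=> z0; rewrite /rank_poly.
have -> : partitions n.+1 = List.flat_map
    (fun j => List.map (cons j) (plist n (n.+1 - j) j)) (List.seq 1 (Nat.min n.+1 n.+1)) by [].
rewrite List_seqE big_flat_map.
rewrite -[in RHS](big_mkord predT (fun j => z ^+ j * bounded_weight z^-1 (n - j) j.+1)).
have -> : Nat.min n.+1 n.+1 = n.+1 by lia.
rewrite /index_iota subn0 (iotaDl 1 0) big_map big_seq [RHS]big_seq; apply: eq_bigr => j.
rewrite mem_iota => hj; rewrite big_List_map /bounded_weight.
rewrite (plist_weight_fuel z^-1 j.+1 (leqnn (n - j)) (_ : n - j <= n)%N) ?leq_subr // /plist_weight.
rewrite mulr_sumr; apply: eq_bigr => l _.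
rewrite /rank_weight /= add1n (exprS z) (exprS z^-1); field; exact: z0.
Qed.

(** The partial sums over the size n are regrouped by the largest part j + 1, which truncates the
    inner series at N - j. Dominated convergence then gives the sum over largest parts evaluated in
    [appell_rank_sum]. *)
Lemma rank_generating_function (q z : CC) : q != 0 -> (Cnorm q < 1)%R -> Cnorm z = 1%R ->
  1 - z != 0 -> Ccv (fun N => \sum_(n < N) rank_poly z n * q ^+ n) ((1 - z) * appell z q).
Proof.
move=> q0 hq nz z1.
have z0 : z != 0 by apply/eqP => e; rewrite e Cnorm0 in nz; lra.
have iz : Cnorm z^-1 = 1%R by rewrite Cnorm_inv // nz Rinv_1.
have [B B0 hB] := weight_series_limit hq iz.
have hc i : 1 - q ^+ i * (z^-1 * q) != 0.
  by rewrite [z^-1 * q]mulrC mulrA -exprSr exprnP; apply: one_sub_expz_neq0.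
have [||||L h1 h2] := @tannery (fun N j => z ^+ j * q ^+ j.+1 * weight_series z^-1 q j.+1 (N - j))
  (fun j => z ^+ j * q ^+ j.+1 / poch (z^-1 * q) q j.+1) B (Cnorm q) => //.
- by split => //; exact: Cnorm_ge0.
- move=> N j _; rewrite !Cnorm_mul (Cnorm_pow z) nz pow1 Rmult_1_l Rmult_comm.
  apply: Rmult_le; try exact: Cnorm_ge0; first exact: (hB j.+1).1.
  by apply: Cnorm_exp_le.
- move=> j; apply: Ccv_mul (Ccv_const _) _.
  by apply: (@Ccv_comp _ _ (fun N => N - j)%N _ ((hB j.+1).2 hc)) => K; exists (K + j)%N => n; lia.
have e := Ccv_unique (appell_rank_sum q0 hq nz z1) (_ : Ccv _ (1 + L)).
rewrite e; last by apply: Ccv_ext (Ccv_add (Ccv_const 1) h1) => J; rewrite [z^-1 * q]mulrC.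
have h3 : Ccv (fun N => \sum_(n < N.+1) rank_poly z n * q ^+ n) (1 + L).
  apply: Ccv_ext (Ccv_add (Ccv_const 1) h2) => N.
  rewrite big_ord_recl rank_poly0 mul1r; congr (_ + _).
  transitivity (\sum_(n < N) \sum_(j < N | (j <= n)%N)
    z ^+ j * q ^+ j.+1 * (bounded_weight z^-1 (n - j) j.+1 * q ^+ (n - j))).
    rewrite (exchange_big_dep predT) //=; apply: eq_bigr => j _.
    rewrite /weight_series -mulr_sumr; congr (_ * _).
    by rewrite -(sum_shift_if (fun m => bounded_weight z^-1 m j.+1 * q ^+ m)) [RHS]big_mkcond.
  apply: eq_bigr => n _; rewrite lift0 rank_polyS // mulr_suml.
  rewrite (big_ord_widen N (fun j => z ^+ j * bounded_weight z^-1 (n - j) j.+1 * q ^+ n.+1)) //.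
  apply: eq_bigr => j hj.
  have -> : q ^+ n.+1 = q ^+ j.+1 * q ^+ (n - j) by rewrite -exprD; congr (_ ^+ _); lia.
  ring.
apply: (@Ccv_eventually _ _ _ 1%N _ (Ccv_comp (@cvg_pred) h3)) => -[|n] //.
Qed.

(** * Rank deviations modulo 4 *)

Definition quarter : CC := RtoC (1 / 4)%R.

(** Orthogonality of fourth roots of unity, with the contribution 1/4 of the root 1 moved to the
    left; the exponent 3a stands for -a. *)
Lemma fourth_root_filter a r : (a < 4)%N -> (r < 4)%N ->
  RtoC ((if (r == a)%N then 1 else 0) - 1 / 4)%R = quarter *
   (Ci ^+ (3 * a) * Ci ^+ r + (- 1) ^+ (3 * a) * (- 1) ^+ r + (- Ci) ^+ (3 * a) * (- Ci) ^+ r).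
Proof.
have ci2 : Ci ^+ 2 = - 1 by exact: Ci_sqr.
have ci3 : Ci ^+ 3 = - Ci by rewrite exprSr ci2 mulN1r.
have ci6 : Ci ^+ 6 = - 1 by rewrite (exprM Ci 3 2) ci3 sqrrN.
have ci9 : Ci ^+ 9 = Ci by rewrite (exprD Ci 6 3) ci6 ci3 mulN1r opprK.
have n3 (x : CC) : (- x) ^+ 3 = - x ^+ 3 by rewrite exprNn -signr_odd expr1 mulN1r.
have n6 (x : CC) : (- x) ^+ 6 = x ^+ 6 by rewrite exprNn -signr_odd expr0 mul1r.
have n9 (x : CC) : (- x) ^+ 9 = - x ^+ 9 by rewrite exprNn -signr_odd expr1 mulN1r.
case: a => [|[|[|[|//]]]] _; case: r => [|[|[|[|//]]]] _;
  rewrite /= ?muln0 ?muln1 ?n3 ?n6 ?n9 ?expr1n ?sqrrN ?expr0 ?expr1 ?ci3 ?ci6 ?ci9 ?ci2;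
  apply: CC_eq; rewrite /=; lra.
Qed.

Lemma root4_weight (z : CC) l : z ^+ 4 = 1 ->
  rank_weight z l = z ^+ ((List.hd 0%N l + 3 * size l) %% 4).
Proof.
move=> z4; have z0 : z != 0 by apply: contra_eq_neq z4 => ->; rewrite expr0n /= eq_sym oner_neq0.
have zi : z^-1 = z ^+ 3 by apply: (mulfI z0); rewrite divff // -exprS.
rewrite /rank_weight zi -exprM -exprD [in LHS](divn_eq (_ + _) 4) exprD mulnC exprM z4.
by rewrite expr1n mul1r.
Qed.

(** Modulo 4 the rank h - m is h + 3m, a natural number, so integer exponents of the roots are
    avoided. *)
Lemma rank_mod4 l a : (a < 4)%N ->
  Z.eqb (Z.modulo (rank l) 4) (Z.modulo (Z.of_nat a) 4) =
  ((List.hd 0%N l + 3 * size l) %% 4 == a)%N.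
Proof.
move=> ha; rewrite /rank; have -> : length l = size l by elim: l => //= _ l ->.
move: (List.hd 0%N l) (size l) => h m.
have e := divn_eq (h + 3 * m) 4; have hr : ((h + 3 * m) %% 4 < 4)%N by rewrite ltn_mod.
move: (_ %/ 4)%N (_ %% 4)%N e hr => k r e hr.
have -> : (Z.of_nat h - Z.of_nat m = Z.of_nat r + (Z.of_nat k - Z.of_nat m) * 4)%Z by lia.
rewrite Z.mod_add // !Z.mod_small; [|lia|lia].
by apply/Z.eqb_spec/eqP; lia.
Qed.

Lemma CmulE (x y : CC) : Cmul x y = x * y. Proof. by []. Qed.

Lemma RtoC_add (x y : R) : RtoC (x + y)%R = RtoC x + RtoC y.
Proof. by apply: CC_eq => //=; rewrite Rplus_0_r. Qed.

Lemma one_sub_m1_neq0 : 1 - - 1 != 0 :> CC.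
Proof. by apply/eqP => -[]; lra. Qed.

Lemma one_sub_opp_Ci_neq0 : 1 - - Ci != 0.
Proof. by apply/eqP => -[]; lra. Qed.

Lemma RtoC_count (A : Type) (P : A -> bool) (s : list A) :
  RtoC (INR (length (List.filter P s)) - INR (length s) / IZR 4)%R =
  \sum_(l <- s) RtoC ((if P l then 1 else 0) - 1 / 4)%R.
Proof.
elim: s => [|x s IH]; first by rewrite big_nil; apply: CC_eq => /=; lra.
rewrite big_cons -IH -RtoC_add; congr RtoC.
have -> : INR (length (x :: s)) = (INR (length s) + 1)%R by exact: S_INR.
have -> : INR (length (List.filter P (x :: s))) =
   (INR (length (List.filter P s)) + if P x then 1 else 0)%R.
  rewrite [List.filter P _]/=; case: (P x); last by rewrite Rplus_0_r.
  exact: S_INR.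
lra.
Qed.

Lemma Drank_coefficient a n : (a < 4)%N ->
  RtoC (INR (NrankMod (Z.of_nat a) 4 n) - INR (npart n) / IZR 4)%R = quarter *
   (Ci ^+ (3 * a) * rank_poly Ci n + (- 1) ^+ (3 * a) * rank_poly (- 1) n
     + (- Ci) ^+ (3 * a) * rank_poly (- Ci) n).
Proof.
move=> ha; rewrite /NrankMod /npart RtoC_count /rank_poly !mulr_sumr -!big_split /= mulr_sumr.
have c4 : Ci ^+ 4 = 1 by rewrite (exprM Ci 2 2) Ci_sqr sqrrN expr1n.
apply: eq_bigr => l _; rewrite rank_mod4 // fourth_root_filter ?ltn_mod //.
by rewrite !root4_weight // ?sqrrN ?(exprM _ 2 2) ?sqrrN ?Ci_sqr ?sqrrN ?expr1n.
Qed.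

Lemma Drank_appell a (q : CC) : (a < 4)%N -> q != 0 -> (Cnorm q < 1)%R ->
  Drank (Z.of_nat a) 4 q = quarter *
   (Ci ^+ (3 * a) * ((1 - Ci) * appell Ci q) + (- 1) ^+ (3 * a) * ((1 - - 1) * appell (- 1) q)
     + (- Ci) ^+ (3 * a) * ((1 - - Ci) * appell (- Ci) q)).
Proof.
move=> ha q0 hq; apply: Csum_eq.
have nC : Cnorm (- Ci) = 1%R by rewrite Cnorm_opp Ci_norm.
have h1 := rank_generating_function q0 hq Ci_norm one_sub_Ci_neq0.
have h2 := rank_generating_function q0 hq Cnorm_m1 one_sub_m1_neq0.
have h3 := rank_generating_function q0 hq nC one_sub_opp_Ci_neq0.
apply: Ccv_ext (Ccv_mul (Ccv_const quarter) (Ccv_add (Ccv_add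
  (Ccv_mul (Ccv_const (Ci ^+ (3 * a))) h1) (Ccv_mul (Ccv_const ((- 1) ^+ (3 * a))) h2))
  (Ccv_mul (Ccv_const ((- Ci) ^+ (3 * a))) h3))) => N.
rewrite !mulr_sumr -!big_split /= mulr_sumr; apply: eq_bigr => n _.
rewrite Drank_coefficient // CpowE CmulE; ring.
Qed.

(** Turns the real literals of the statement into ring constants that [ring] and [field] can compute
    with. *)
Lemma RtoC_pos n : RtoC (IZR (Z.of_nat n)) = n%:R.
Proof.
rewrite -INR_IZR_INZ; elim: n => [|n IH] //.
by rewrite S_INR RtoC_add IH mulrSr.
Qed.

Lemma RtoC_neg n : RtoC (IZR (- Z.of_nat n)) = - n%:R.
Proof. by rewrite -RtoC_pos opp_IZR; apply: CC_eq => /=; rewrite ?Ropp_0. Qed.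

Lemma theta4E (a0 a1 a2 a3 : R) (q : CC) : theta4 a0 a1 a2 a3 q = (4%:R * Jm q 4)^-1 *
  (RtoC a0 * jtheta (- q ^+ 4) (q ^+ 8) * jtheta (- q ^+ 6) (q ^+ 16) +
   RtoC a1 * q ^+ 2 * jtheta (- 1) (q ^+ 8) * jtheta (- q ^+ 14) (q ^+ 16) +
   RtoC a2 * q * jtheta (- q ^+ 4) (q ^+ 8) * jtheta (- q ^+ 14) (q ^+ 16) +
   RtoC a3 * q * jtheta (- 1) (q ^+ 8) * jtheta (- q ^+ 6) (q ^+ 16)).
Proof. by rewrite -(RtoC_pos 4) /theta4 /Jbar !CpowE. Qed.

Lemma G4_opp (q : CC) : q != 0 -> G4 1 1 (- q) = G4 1 (- 1) q.
Proof.
move=> q0; rewrite !G4E.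
have -> : (- q) ^+ 2 = q ^+ 2 by ring.
have -> : (- q) ^+ 6 = q ^+ 6 by ring.
have -> : (- q) ^+ 16 = q ^+ 16 by ring.
have -> : (- q) ^+ 5 = - q ^+ 5 by ring.
have -> : RtoC (- 1) = - 1 := RtoC_neg 1.
by rewrite (RtoC_pos 1); ring.
Qed.

Lemma mock_theta_f (q : CC) : q != 0 -> (Cnorm q < 1)%R ->
  let A := jtheta (- q ^+ 4) (q ^+ 8) in let B := q * jtheta (- 1) (q ^+ 8) in
  let U := jtheta (- q ^+ 6) (q ^+ 16) in let V := q * jtheta (- q ^+ 14) (q ^+ 16) in
  2%:R * appell (- 1) q =
    ((A - B) * (U - V) - 4%:R * A * (U - V)) / Jm q 4 - 4%:R * G4 1 1 q.
Proof.
move=> q0 hq A B U V.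
have J0 : Jm q 4 != 0 by rewrite Jm_4 //; exact: (qpoch_pos_neq0 hq 3 3).
rewrite appell_m1 // appell_q4 // theta_split_2 // theta_split_4 // -/A -/B -/U -/V.
by field.
Qed.

(** A(q; q^4) is [appell_q4] at -q, and the theta factors are those of f at -q; the substitution
    changes only the signs of B, V and the second coefficient of [G4]. *)
Lemma mock_theta_phi (i q : CC) : q != 0 -> (Cnorm q < 1)%R -> i ^+ 2 = - 1 -> Cnorm i = 1%R ->
  1 - i != 0 ->
  let A := jtheta (- q ^+ 4) (q ^+ 8) in let B := q * jtheta (- 1) (q ^+ 8) in
  let U := jtheta (- q ^+ 6) (q ^+ 16) in let V := q * jtheta (- q ^+ 14) (q ^+ 16) in
  (1 - i) * appell i q =
    ((A + B) * (U + V) - 2%:R * A * (U + V)) / Jm q 4 - 2%:R * G4 1 (- 1) q.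
Proof.
move=> q0 hq hi ni i1 A B U V.
have J0 : Jm q 4 != 0 by rewrite Jm_4 //; exact: (qpoch_pos_neq0 hq 3 3).
have q0' : - q != 0 by rewrite oppr_eq0.
have hq' : (Cnorm (- q) < 1)%R by rewrite Cnorm_opp.
have e2 : (- q) ^+ 2 = q ^+ 2 by ring.
have e4 : (- q) ^+ 4 = q ^+ 4 by ring.
have e6 : (- q) ^+ 6 = q ^+ 6 by ring.
have e8 : (- q) ^+ 8 = q ^+ 8 by ring.
have e14 : (- q) ^+ 14 = q ^+ 14 by ring.
have e16 : (- q) ^+ 16 = q ^+ 16 by ring.
have eJ : Jm (- q) 4 = Jm q 4 by rewrite !Jm_4 // e4.
have s2 := theta_split_2 q0' hq'; rewrite e2 e4 e8 in s2.
have s4 := theta_split_4 q0' hq'; rewrite e4 e6 e14 e16 in s4.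
have := appell_q4 q0' hq'; rewrite opprK e4 e8 eJ G4_opp // => aq.
rewrite appell_i // aq s2 s4 !mulNr !opprK -/A -/B -/U -/V.
by field.
Qed.

Lemma quarterE : quarter = 4%:R^-1.
Proof.
have n4 : 4%:R != 0 :> CC by rewrite -(RtoC_pos 4); apply/eqP => -[]; rewrite /=; lra.
apply: (mulfI n4); rewrite divff // -(RtoC_pos 4).
by apply: CC_eq; rewrite /=; lra.
Qed.

Lemma rank_deviations_mod4 (q : CC) : q != 0 -> (Cnorm q < 1)%R ->
  [/\ Drank 0 4 q = theta4 (-5) 3 1 1 q + RtoC 2 * G4 (-1) 0 q,
      Drank 1 4 q = theta4 3 (-1) (-3) 1 q + G4 1 1 q,
      Drank 3 4 q = theta4 3 (-1) (-3) 1 q + G4 1 1 q &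
      Drank 2 4 q = theta4 (-1) (-1) 5 (-3) q + RtoC 2 * G4 0 (-1) q].
Proof.
move=> q0 hq.
have J0 : Jm q 4 != 0 by rewrite Jm_4 //; exact: (qpoch_pos_neq0 hq 3 3).
have n2 := two_neq0.
have n4 : 4%:R != 0 :> CC by rewrite (natrM _ 2 2) mulf_neq0.
have nC : Cnorm (- Ci) = 1%R by rewrite Cnorm_opp Ci_norm.
have C2 : (- Ci) ^+ 2 = - 1 by rewrite sqrrN Ci_sqr.
have f := mock_theta_f q0 hq.
have phi := mock_theta_phi q0 hq Ci_sqr Ci_norm one_sub_Ci_neq0.
have phi' := mock_theta_phi q0 hq C2 nC one_sub_opp_Ci_neq0.
cbv zeta in f, phi, phi'.
have ci3 : Ci ^+ 3 = - Ci by rewrite exprSr Ci_sqr mulN1r.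
have ci6 : Ci ^+ 6 = - 1 by rewrite (exprM Ci 3 2) ci3 C2.
have ci9 : Ci ^+ 9 = Ci by rewrite (exprD Ci 6 3) ci6 ci3 mulN1r opprK.
have n3 (x : CC) : (- x) ^+ 3 = - x ^+ 3 by ring.
have n6 (x : CC) : (- x) ^+ 6 = x ^+ 6 by ring.
have n9 (x : CC) : (- x) ^+ 9 = - x ^+ 9 by ring.
(* [phi] and [phi'] have the same right-hand side, so the roots i and -i share one factor, with
   coefficient 2, 0, -2, 0 for a = 0, 1, 2, 3. This is why D(1,4) and D(3,4) agree. *)
have D a : (a < 4)%N -> Drank (Z.of_nat a) 4 q = 4%:R^-1 *
   ((Ci ^+ (3 * a) + (- Ci) ^+ (3 * a)) * ((1 - Ci) * appell Ci q)
     + (- 1) ^+ (3 * a) * (2%:R * appell (- 1) q)).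
  move=> ha; rewrite (Drank_appell ha q0 hq) quarterE phi phi'; ring.
have c0 := RtoC_pos 0; have c1 := RtoC_pos 1; have c2 := RtoC_pos 2; have c3 := RtoC_pos 3.
have c5 := RtoC_pos 5; have m1 := RtoC_neg 1; have m3 := RtoC_neg 3; have m5 := RtoC_neg 5.
rewrite /= in c0 c1 c2 c3 c5 m1 m3 m5.
move: (D 0%N isT) (D 1%N isT) (D 2%N isT) (D 3%N isT).
rewrite [Z.of_nat 0]/= [Z.of_nat 1]/= [Z.of_nat 2]/= [Z.of_nat 3]/=.
move=> -> -> -> ->.
rewrite [(3 * 0)%N]/= [(3 * 1)%N]/= [(3 * 2)%N]/= [(3 * 3)%N]/=.
(* Here f = -(3A + B)(U - V)/J_4 - 4 G(1,1) and phi = (B - A)(U + V)/J_4 - 2 G(1,-1). The listed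
   coefficients are those of (f + 2 phi)/4, -f/4 and (f - 2 phi)/4 in AU, BV, AV, BU. *)
rewrite !n3 !n6 !n9 ci3 ci6 ci9 !expr1n !expr0 phi f !theta4E !G4E !(c0, c1, c2, c3, c5, m1, m3, m5).
move: (appell _ _) (appell _ _) (jtheta _ _) (jtheta _ _) (jtheta _ _) (jtheta _ _) (Jm q 4) J0.
move=> u v w x y z J J0.
by split; field; rewrite ?J0 ?n4 ?n2 ?q0 ?oppr_eq0 ?expf_neq0.
Qed.

Close Scope ring_scope.
Open Scope R_scope.
Unset Implicit Arguments.

Theorem theorem1p4 (q : CC) (hq0 : 0 < Cnorm q) (hq1 : Cnorm q < 1) :
  Drank 0 4 q = Cadd (theta4 (-5) 3 1 1 q) (Cmul (RtoC 2) (G4 (-1) 0 q)) /\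
  Drank 1 4 q = Cadd (theta4 3 (-1) (-3) 1 q) (G4 1 1 q) /\
  Drank 3 4 q = Cadd (theta4 3 (-1) (-3) 1 q) (G4 1 1 q) /\
  Drank 2 4 q = Cadd (theta4 (-1) (-1) 5 (-3) q) (Cmul (RtoC 2) (G4 0 (-1) q)).
Proof.
have q0 : q != 0%ring by apply/eqP => e; move: hq0; rewrite e Cnorm0; lra.
by have [] := rank_deviations_mod4 q0 hq1.
Qed.
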